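(* Let $f(z,t)$ be the solution of the chordal L\''owner equation $$\frac{df(z,t)}{dt}=\frac{2}{f(z,t)-\sqrt[3]{t}},\qquad f(z,0)=z,\qquad \operatorname{Im} z\ge 0 .$$ Then there exist $T>0$ and a curve $\gamma$ with $\gamma(0)=0$, emanating from the real axis into $\mathbb H$, such that for every $0<t<T$ the function $f(\cdot,t)$ maps the slit domain $D(t)=\mathbb H\setminus\gamma(t)$ onto $\mathbb H$, where $\gamma(t)$ denotes the arc $\gamma[0,t]$, and $\gamma(t)$ is a $C^1$-curve, except possibly at the point $\gamma(0)=0$.
   Context: $\mathbb H=\{z\in\mathbb C:\operatorname{Im} z>0\}$ is the upper half-plane. For $z\in\mathbb H$ the L\''owner equation is solved up to the first time at which $f(z,t)-\sqrt[3]{t}$ reaches $0$; $K_t$ is the hull of those $z\in\mathbb H$ for which the solution no longer exists at time $t$, so that $f(\cdot,t)$ is a conformal map of $\mathbb H\setminus K_t$ onto $\mathbb H$ with expansion $f(z,t)=z+\frac{2t}{z}+O(z^{-2})$ as $z\to\infty$. The map $f(\cdot,t)$ is called a slit mapping when $K_t$ is a Jordan arc emanating from the real axis, i.e. $K_t=\gamma(t)$ (where the arc is understood up to its starting point on $\mathbb R$); in that case $f(\cdot,t)$ extends continuously to the two sides (prime ends) of the arc and its tip at time $t$ is sent to $\sqrt[3]{t}$. *)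

(* Defs.v *)
(* Stdlib reals with Coquelicot. *)
From Stdlib Require Import Reals Lra.
From Coquelicot Require Import Coquelicot.
Open Scope R_scope.

(* The case split is needed because [Rpower 0 (/ 3) = 1]. Only t >= 0 is ever
   used; for t < 0 the value 0 is a dummy. *)
Definition cbrt (t : R) : R := if Rlt_dec 0 t then Rpower t (/ 3) else 0.

Lemma cbrt_spec (t : R) : 0 <= t -> 0 <= cbrt t /\ cbrt t ^ 3 = t.
Proof.
intros Ht; unfold cbrt; destruct (Rlt_dec 0 t) as [H | H].
- assert (Hp : 0 < Rpower t (/ 3)) by apply exp_pos.
  split; [lra |].
  rewrite <- (Rpower_pow 3 _ Hp), Rpower_mult.
  replace (/ 3 * INR 3) with 1 by (simpl; field).
  now apply Rpower_1.
- split; [lra |]. replace t with 0 by lra. ring.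
Qed.

Definition upper_half_plane (z : C) : Prop := 0 < Im z.

(* Derivative relative to D: one-sided at the endpoints when D is an interval. *)
Definition is_derive_on (D : R -> Prop) (u : R -> C) (s : R) (l : C) : Prop :=
  filterdiff (K := R_AbsRing) (U := R_NormedModule) (V := C_R_NormedModule)
    u (within D (locally s)) (fun h : R => @scal R_AbsRing C_R_NormedModule h l).

Definition continuous_on_set (D : R -> Prop) (u : R -> C) : Prop :=
  forall s : R, D s ->
    filterlim u (within D (locally s)) (locally (T := C_UniformSpace) (u s)).

(* The condition [u s <> lam s] is explicit because division in C is total. *)
Definition loewner_solution (lam : R -> R) (z : C) (t : R) (u : R -> C) : Prop :=
  u 0 = z /\
  forall s : R, 0 <= s <= t ->
    u s <> RtoC (lam s) /\
    is_derive_on (fun r => 0 <= r <= t) u s (RtoC 2 / (u s - RtoC (lam s)))%C.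

(* z survives up to and including time t. A solution can be continued for as
   long as u - lam stays away from 0, so this fails exactly when u - lam has
   reached 0 at some time <= t. *)
Definition loewner_alive (lam : R -> R) (z : C) (t : R) : Prop :=
  exists u : R -> C, loewner_solution lam z t u.

(* [f z t] carries information only while z is alive at time t; in particular
   nothing is required of [f (lam 0)]. *)
Definition loewner_flow (lam : R -> R) (f : C -> R -> C) : Prop :=
  forall (z : C) (t : R), 0 <= Im z -> 0 <= t ->
    loewner_alive lam z t -> loewner_solution lam z t (f z).

Definition loewner_hull (lam : R -> R) (t : R) (z : C) : Prop :=
  upper_half_plane z /\ ~ loewner_alive lam z t.

Definition arc (gamma : R -> C) (t : R) (z : C) : Prop :=
  exists s : R, 0 <= s <= t /\ gamma s = z.

Definition slit_domain (gamma : R -> C) (t : R) (z : C) : Prop :=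
  upper_half_plane z /\ ~ arc gamma t z.

Definition jordan_arc_from_real_axis (gamma : R -> C) (t : R) : Prop :=
  continuous_on_set (fun s => 0 <= s <= t) gamma /\
  (forall r s : R, 0 <= r <= t -> 0 <= s <= t -> gamma r = gamma s -> r = s) /\
  Im (gamma 0) = 0 /\
  (forall s : R, 0 < s <= t -> upper_half_plane (gamma s)).

(* Regularity (nonzero derivative) excludes corners and cusps of the trace. *)
Definition regular_C1_curve_on (D : R -> Prop) (gamma : R -> C) : Prop :=
  exists dgamma : R -> C,
    (forall s : R, D s ->
       is_derive_on D gamma s (dgamma s) /\ dgamma s <> RtoC 0) /\
    continuous_on_set D dgamma.

(* Meant for open D, so that the values of g off D are irrelevant. *)
Definition conformal_map_onto (D E : C -> Prop) (g : C -> C) : Prop :=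
  (forall z : C, D z ->
     ex_derive (K := C_AbsRing) (V := C_NormedModule) g z) /\
  (forall z w : C, D z -> D w -> g z = g w -> z = w) /\
  (forall w : C, E w <-> exists z : C, D z /\ g z = w).

(* Main.v *)
Require Import Defs.
From Stdlib Require Import Reals.
From Coquelicot Require Import Coquelicot.
From Stdlib Require Import Lra Lia Psatz ClassicalEpsilon.
Open Scope R_scope.

(** Write [h = u - lam] for a solution u and [lam = cbrt].

Outside the tip everything is the flow of a smooth field: cutting the imaginary
part off from below makes the field bounded and Lipschitz, and Gronwall's lemma
gives uniqueness, stability and, for two solutions, a Lipschitz ratio
(u2 - u1)(t) / (u2 - u1)(0), hence complex differentiability of f(., t).
Running the equation backward from any point of the half-plane never meets the
singularity, so f(., t) maps the set of surviving points onto the half-plane.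

At the tip the right variable is q = h^2: since q' = 4 - 2 lam' h, a solution
that stops existing at time s has q -> 0, that is, u -> lam; and for two
solutions (q2 - q1)' = - 2 lam' (q2 - q1) / (h1 + h2). Moreover
(Im h^2 - Re h^2)' <= - 2 and 0 <= Re u - lam near s, so Im h >= sqrt (s - r),
and 1 / (h1 + h2) has an integrable singularity. Hence exactly one point gamma s
is swallowed at time s; it is the limit of the backward solutions from
lam s + i / (n + 1).

For s1 < s2 near s0 and a time r0 shortly before s0, the same estimate gives
(q2 - q1)(r0) = - 4 (s2 - s1) (1 + small), while the flow on [0, r0] turns
(q2 - q1)(r0) into gamma s2 - gamma s1 with a ratio that converges as
s1, s2 -> s0. So the difference quotients of gamma are Cauchy and bounded away
from 0, which makes gamma continuously differentiable and regular. *)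

(** * Calculus of curves in the complex plane *)

Lemma decreasing_on (phi dphi : R -> R) (a b : R) :
  a <= b ->
  (forall r, a <= r <= b -> continuous phi r) ->
  (forall r, a < r < b -> is_derive phi r (dphi r) /\ dphi r <= 0) ->
  phi b <= phi a.
Proof.
intros Hab Hc Hd.
pose (df := fun r => if Rlt_dec a r then if Rlt_dec r b then dphi r else 0 else 0).
assert (Hdf : forall r, df r <= 0).
{ intros r; unfold df.
  destruct (Rlt_dec a r); [destruct (Rlt_dec r b)|]; try lra.
  apply Hd; lra. }
destruct (MVT_gen phi a b df) as [c [_ E]].
- rewrite Rmin_left, Rmax_right by lra. intros r Hr.
  unfold df. destruct (Rlt_dec a r); [destruct (Rlt_dec r b)|]; try lra.
  now apply Hd.
- rewrite Rmin_left, Rmax_right by lra. intros r Hr.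
  apply continuity_pt_filterlim. now apply Hc.
- specialize (Hdf c). nra.
Qed.

Lemma increasing_on (phi dphi : R -> R) (a b : R) :
  a <= b ->
  (forall r, a <= r <= b -> continuous phi r) ->
  (forall r, a < r < b -> is_derive phi r (dphi r) /\ 0 <= dphi r) ->
  phi a <= phi b.
Proof.
intros Hab Hc Hd.
enough (- phi b <= - phi a) by lra.
apply (decreasing_on (fun r => - phi r) (fun r => - dphi r)); auto.
- intros r Hr. apply (continuous_opp phi). now apply Hc.
- intros r Hr. destruct (Hd r Hr) as [H1 H2]. split; [|lra].
  now apply (is_derive_opp phi).
Qed.

Lemma nonpos_backward (phi dphi : R -> R) (a b : R) :
  a <= b ->
  (forall r, a <= r <= b -> continuous phi r) ->
  (forall r, a < r < b -> is_derive phi r (dphi r) /\ (0 < phi r -> 0 <= dphi r)) ->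
  phi b <= 0 -> phi a <= 0.
Proof.
intros Hab Hc Hd Hb.
destruct (Rle_lt_dec (phi a) 0) as [|Ha]; [assumption|exfalso].
pose (E := fun r => a <= r <= b /\ forall r', a <= r' <= r -> 0 < phi r').
destruct (completeness E) as [c [Hub Hlub]].
{ exists b. intros r [Hr _]. lra. }
{ exists a. split; [lra|]. intros r' Hr'. now replace r' with a by lra. }
assert (Hac : a <= c).
{ apply Hub. split; [lra|]. intros r' Hr'. now replace r' with a by lra. }
assert (Hcb : c <= b) by (apply Hlub; intros r [Hr _]; lra).
assert (Hpos : forall r, a <= r < c -> 0 < phi r).
{ intros r Hr. destruct (Rlt_le_dec 0 (phi r)) as [|Hn]; [assumption|exfalso].
  assert (c <= r); [|lra]. apply Hlub. intros r' [Hr' Hp].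
  destruct (Rle_lt_dec r' r) as [|Hlt]; [assumption|].
  specialize (Hp r ltac:(lra)). lra. }
assert (Hcc : phi a <= phi c).
{ apply (increasing_on phi dphi); auto.
  - intros r Hr. apply Hc; lra.
  - intros r Hr. destruct (Hd r ltac:(lra)) as [H1 H2]. split; [assumption|].
    apply H2, Hpos; lra. }
destruct (Rle_lt_or_eq_dec c b Hcb) as [Hlt|Heq]; [|rewrite Heq in Hcc; lra].
assert (Hpc : 0 < phi c) by lra.
assert (Hcab : a <= c <= b) by lra.
destruct (proj1 (filterlim_locally _ _) (Hc c Hcab) (mkposreal (phi c) Hpc)) as [d Hdl].
pose (e := Rmin (d / 2) (b - c)).
assert (He : 0 < e <= b - c /\ e < d).
{ unfold e. destruct d as [d Hdp]; simpl in *.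
  pose proof (Rmin_l (d / 2) (b - c)). pose proof (Rmin_r (d / 2) (b - c)).
  assert (0 < Rmin (d / 2) (b - c)) by (apply Rmin_glb_lt; lra). lra. }
assert (c + e <= c); [|lra].
apply Hub. split; [lra|]. intros r' Hr'.
destruct (Rlt_le_dec r' c) as [Hrc|Hrc]; [apply Hpos; lra|].
assert (B : ball c d r').
{ change (Rabs (r' - c) < d). rewrite Rabs_pos_eq; lra. }
specialize (Hdl r' B). change (Rabs (phi r' - phi c) < phi c) in Hdl.
apply Rabs_def2 in Hdl. lra.
Qed.

Definition contC (u : R -> C) (r : R) : Prop :=
  continuous (fun s => Re (u s)) r /\ continuous (fun s => Im (u s)) r.

Definition derC (u : R -> C) (r : R) (l : C) : Prop :=
  is_derive (fun s => Re (u s)) r (Re l) /\ is_derive (fun s => Im (u s)) r (Im l).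

Lemma derC_contC u r l : derC u r l -> contC u r.
Proof.
intros [H1 H2]; split; apply (ex_derive_continuous (K := R_AbsRing) (V := R_NormedModule));
  [now exists (Re l)|now exists (Im l)].
Qed.

Lemma derC_eq u r l m : derC u r l -> l = m -> derC u r m.
Proof. now intros H <-. Qed.

Lemma derC_ext u v r l :
  locally r (fun s => u s = v s) -> derC u r l -> derC v r l.
Proof.
intros He [H1 H2]; split.
- apply (is_derive_ext_loc (fun s => Re (u s))); [|exact H1].
  revert He. apply filter_imp. now intros s ->.
- apply (is_derive_ext_loc (fun s => Im (u s))); [|exact H2].
  revert He. apply filter_imp. now intros s ->.
Qed.

Lemma derC_const c r : derC (fun _ => c) r 0.
Proof.
split; [apply (is_derive_const (Re c) r)|apply (is_derive_const (Im c) r)].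
Qed.

Lemma derC_plus u v r l m :
  derC u r l -> derC v r m -> derC (fun s => (u s + v s)%C) r (l + m).
Proof.
intros [H1 H2] [H3 H4]; split.
- now apply (is_derive_plus (fun s => Re (u s)) (fun s => Re (v s))).
- now apply (is_derive_plus (fun s => Im (u s)) (fun s => Im (v s))).
Qed.

Lemma derC_minus u v r l m :
  derC u r l -> derC v r m -> derC (fun s => (u s - v s)%C) r (l - m).
Proof.
intros [H1 H2] [H3 H4]; split.
- now apply (is_derive_minus (fun s => Re (u s)) (fun s => Re (v s))).
- now apply (is_derive_minus (fun s => Im (u s)) (fun s => Im (v s))).
Qed.

Lemma is_derive_mult_R (f g : R -> R) (x l m : R) :
  is_derive f x l -> is_derive g x m ->
  is_derive (fun s => f s * g s) x (l * g x + f x * m).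
Proof.
intros Hf Hg. apply (is_derive_mult f g); auto. intros; apply Rmult_comm.
Qed.

Lemma derC_mult u v r l m :
  derC u r l -> derC v r m -> derC (fun s => (u s * v s)%C) r (l * v r + u r * m).
Proof.
intros [H1 H2] [H3 H4]; split.
- replace (Re (l * v r + u r * m)%C) with
    ((Re l * Re (v r) + Re (u r) * Re m) - (Im l * Im (v r) + Im (u r) * Im m))
    by (unfold Re, Im; simpl; ring).
  apply (is_derive_minus (fun s => Re (u s) * Re (v s)) (fun s => Im (u s) * Im (v s)));
  now apply is_derive_mult_R.
- replace (Im (l * v r + u r * m)%C) with
    ((Re l * Im (v r) + Re (u r) * Im m) + (Im l * Re (v r) + Im (u r) * Re m))
    by (unfold Re, Im; simpl; ring).
  apply (is_derive_plus (fun s => Re (u s) * Im (v s)) (fun s => Im (u s) * Re (v s)));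
  now apply is_derive_mult_R.
Qed.

Lemma derC_RtoC f r l : is_derive f r l -> derC (fun s => RtoC (f s)) r (RtoC l).
Proof. intros H; split; [exact H|apply (is_derive_const 0 r)]. Qed.

Lemma contC_const c r : contC (fun _ => c) r.
Proof. split; apply continuous_const. Qed.

Lemma contC_plus u v r : contC u r -> contC v r -> contC (fun s => (u s + v s)%C) r.
Proof.
intros [H1 H2] [H3 H4]; split.
- now apply (continuous_plus (fun s => Re (u s)) (fun s => Re (v s))).
- now apply (continuous_plus (fun s => Im (u s)) (fun s => Im (v s))).
Qed.

Lemma contC_minus u v r : contC u r -> contC v r -> contC (fun s => (u s - v s)%C) r.
Proof.
intros [H1 H2] [H3 H4]; split.
- now apply (continuous_minus (fun s => Re (u s)) (fun s => Re (v s))).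
- now apply (continuous_minus (fun s => Im (u s)) (fun s => Im (v s))).
Qed.

Lemma continuous_mult_R (f g : R -> R) (x : R) :
  continuous f x -> continuous g x -> continuous (fun s => f s * g s) x.
Proof. intros Hf Hg. now apply (continuous_mult f g). Qed.

Lemma continuous_plus_R (f g : R -> R) (x : R) :
  continuous f x -> continuous g x -> continuous (fun s => f s + g s) x.
Proof. intros Hf Hg. now apply (continuous_plus f g). Qed.

Lemma continuous_minus_R (f g : R -> R) (x : R) :
  continuous f x -> continuous g x -> continuous (fun s => f s - g s) x.
Proof. intros Hf Hg. now apply (continuous_minus f g). Qed.

Lemma contC_mult u v r : contC u r -> contC v r -> contC (fun s => (u s * v s)%C) r.
Proof.
intros [H1 H2] [H3 H4]; split.
- apply (continuous_minus_R (fun s => Re (u s) * Re (v s)) (fun s => Im (u s) * Im (v s)));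
  now apply continuous_mult_R.
- apply (continuous_plus_R (fun s => Re (u s) * Im (v s)) (fun s => Im (u s) * Re (v s)));
  now apply continuous_mult_R.
Qed.

Lemma contC_RtoC f r : continuous f r -> contC (fun s => RtoC (f s)) r.
Proof. intros H; split; [exact H|apply (continuous_const 0 r)]. Qed.

Lemma im_le_Cmod c : Rabs (Im c) <= Cmod c.
Proof.
apply Rle_trans with (2 := Rmax_Cmod c). apply Rmax_r.
Qed.

Lemma Cmod_Re_Im c : Cmod c <= Rabs (Re c) + Rabs (Im c).
Proof.
apply Rsqr_incr_0_var; [|pose proof (Rabs_pos (Re c)); pose proof (Rabs_pos (Im c)); lra].
rewrite !Rsqr_pow2, Cmod2_alt.
rewrite <- (pow2_abs (Re c)), <- (pow2_abs (Im c)).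
pose proof (Rabs_pos (Re c)); pose proof (Rabs_pos (Im c)). nra.
Qed.

Definition dot (u v : C) : R := Re u * Re v + Im u * Im v.

Lemma dot_le u v : dot u v <= Cmod u * Cmod v.
Proof.
replace (dot u v) with (Re (Cconj u * v)%C) by (unfold dot, Re, Im; simpl; ring).
rewrite <- (Cmod_conj u), <- Cmod_mult.
apply Rle_trans with (2 := re_le_Cmod _), Rle_abs.
Qed.

Lemma dot_self u : dot u u = Cmod u ^ 2.
Proof. rewrite Cmod2_alt. unfold dot. ring. Qed.

Lemma derC_dot u v r l m :
  derC u r l -> derC v r m -> is_derive (fun s => dot (u s) (v s)) r (dot l (v r) + dot (u r) m).
Proof.
intros [H1 H2] [H3 H4]. unfold dot.
replace (Re l * Re (v r) + Im l * Im (v r) + (Re (u r) * Re m + Im (u r) * Im m))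
  with ((Re l * Re (v r) + Re (u r) * Re m) + (Im l * Im (v r) + Im (u r) * Im m)) by ring.
apply (is_derive_plus (fun s => Re (u s) * Re (v s)) (fun s => Im (u s) * Im (v s)));
  now apply is_derive_mult_R.
Qed.

Lemma contC_dot u v r : contC u r -> contC v r -> continuous (fun s => dot (u s) (v s)) r.
Proof.
intros [H1 H2] [H3 H4]. unfold dot.
apply continuous_plus_R; now apply continuous_mult_R.
Qed.

Lemma derC_normsq u r l :
  derC u r l -> is_derive (fun s => Cmod (u s) ^ 2) r (2 * dot (u r) l).
Proof.
intros H. apply (is_derive_ext (fun s => dot (u s) (u s))).
{ intros s. apply dot_self. }
replace (2 * dot (u r) l) with (dot l (u r) + dot (u r) l) by (unfold dot; ring).
now apply derC_dot.
Qed.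

Lemma contC_normsq u r : contC u r -> continuous (fun s => Cmod (u s) ^ 2) r.
Proof.
intros H. apply (continuous_ext (fun s => dot (u s) (u s))).
{ intros s. apply dot_self. }
now apply contC_dot.
Qed.

Lemma contC_Cmod u r : contC u r -> continuous (fun s => Cmod (u s)) r.
Proof.
intros H. apply (continuous_ext (fun s => sqrt (Cmod (u s) ^ 2))).
{ intros s. apply sqrt_pow2, Cmod_ge_0. }
apply (continuous_comp (fun s => Cmod (u s) ^ 2) sqrt).
- now apply contC_normsq.
- apply continuous_sqrt.
Qed.

Lemma mean_value_C (u du : R -> C) (g dg : R -> R) (a b : R) :
  a <= b ->
  (forall r, a <= r <= b -> contC u r /\ continuous g r) ->
  (forall r, a < r < b -> derC u r (du r) /\ is_derive g r (dg r) /\ Cmod (du r) <= dg r) ->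
  Cmod (u b - u a) <= g b - g a.
Proof.
intros Hab Hc Hd.
pose (w := (u b - u a)%C).
assert (H : dot w (u b) - Cmod w * g b <= dot w (u a) - Cmod w * g a).
{ apply (decreasing_on (fun r => dot w (u r) - Cmod w * g r)
    (fun r => dot w (du r) - Cmod w * dg r)); auto.
  - intros r Hr. destruct (Hc r Hr) as [H1 H2].
    apply continuous_minus_R.
    + apply contC_dot; [apply contC_const|assumption].
    + apply continuous_mult_R; [apply continuous_const|assumption].
  - intros r Hr. destruct (Hd r Hr) as [H1 [H2 H3]]. split.
    + apply (is_derive_minus (fun r => dot w (u r)) (fun r => Cmod w * g r)).
      * replace (dot w (du r)) with (dot 0 (u r) + dot w (du r))
          by (unfold dot, Re, Im; simpl; ring).
        apply derC_dot; [apply derC_const|assumption].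
      * now apply is_derive_scal.
    + pose proof (dot_le w (du r)). pose proof (Cmod_ge_0 w). nra. }
assert (E : dot w (u b) - dot w (u a) = Cmod w ^ 2).
{ rewrite <- dot_self. unfold dot, w, Re, Im; simpl; ring. }
assert (Hg : g a <= g b).
{ apply (increasing_on g dg); auto.
  - intros r Hr. now apply Hc.
  - intros r Hr. destruct (Hd r Hr) as [H1 [H2 H3]]. split; auto.
    apply Rle_trans with (2 := H3), Cmod_ge_0. }
fold w. destruct (Rle_lt_or_eq_dec 0 _ (Cmod_ge_0 w)) as [Hp|<-]; nra.
Qed.

Lemma gronwall_forward (u du : R -> C) (g dg : R -> R) (a b : R) :
  a <= b ->
  (forall r, a <= r <= b -> contC u r /\ continuous g r) ->
  (forall r, a < r < b ->
     derC u r (du r) /\ is_derive g r (dg r) /\ Cmod (du r) <= dg r * Cmod (u r)) ->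
  Cmod (u b) <= exp (g b - g a) * Cmod (u a).
Proof.
intros Hab Hc Hd.
assert (H : Cmod (u b) ^ 2 * exp (- 2 * g b) <= Cmod (u a) ^ 2 * exp (- 2 * g a)).
{ apply (decreasing_on (fun r => Cmod (u r) ^ 2 * exp (- 2 * g r))
    (fun r => 2 * dot (u r) (du r) * exp (- 2 * g r)
      + Cmod (u r) ^ 2 * (exp (- 2 * g r) * (- 2 * dg r)))); auto.
  - intros r Hr. destruct (Hc r Hr) as [H1 H2].
    apply (continuous_mult_R (fun r => Cmod (u r) ^ 2)); [now apply contC_normsq|].
    apply (continuous_comp (fun r => - 2 * g r) exp).
    + apply continuous_mult_R; [apply continuous_const|assumption].
    + apply (ex_derive_continuous (K := R_AbsRing) (V := R_NormedModule)). auto_derive; auto.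
  - intros r Hr. destruct (Hd r Hr) as [H1 [H2 H3]]. split.
    + apply (is_derive_mult_R (fun r => Cmod (u r) ^ 2) (fun r => exp (- 2 * g r)));
        [now apply derC_normsq|].
      rewrite (Rmult_comm (exp _)).
      apply (is_derive_comp exp (fun r => - 2 * g r)); [apply is_derive_exp|].
      now apply is_derive_scal.
    + pose proof (dot_le (u r) (du r)). pose proof (Cmod_ge_0 (u r)).
      pose proof (exp_pos (- 2 * g r)).
      assert (dot (u r) (du r) <= dg r * Cmod (u r) ^ 2) by nra.
      nra. }
apply Rsqr_incr_0_var; [|apply Rmult_le_pos; [apply Rlt_le, exp_pos|apply Cmod_ge_0]].
rewrite !Rsqr_pow2, Rpow_mult_distr.
replace (exp (g b - g a) ^ 2) with (exp (- 2 * g a) * exp (2 * g b)).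
2:{ simpl. rewrite Rmult_1_r, <- !exp_plus. f_equal. ring. }
apply Rmult_le_compat_r with (r := exp (2 * g b)) in H; [|apply Rlt_le, exp_pos].
rewrite Rmult_assoc, <- exp_plus in H.
replace (- 2 * g b + 2 * g b) with 0 in H by ring. rewrite exp_0 in H. lra.
Qed.

Lemma derC_reverse u c r l :
  derC u (c - r) l -> derC (fun s => u (c - s)) r (- l)%C.
Proof.
intros [H1 H2]; split.
- replace (Re (- l)%C) with (scal (-1) (Re l)) by (unfold Re, Im, scal; simpl; unfold mult; simpl; ring).
  apply (is_derive_comp (fun s => Re (u s)) (fun s => c - s)); [exact H1|].
  auto_derive; auto; ring.
- replace (Im (- l)%C) with (scal (-1) (Im l)) by (unfold Re, Im, scal; simpl; unfold mult; simpl; ring).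
  apply (is_derive_comp (fun s => Im (u s)) (fun s => c - s)); [exact H2|].
  auto_derive; auto; ring.
Qed.

Lemma continuous_reverse (f : R -> R) c r :
  continuous f (c - r) -> continuous (fun s => f (c - s)) r.
Proof.
intros H. apply (continuous_comp (fun s => c - s) f); [|exact H].
apply continuous_minus_R; [apply continuous_const|apply continuous_id].
Qed.

Lemma contC_reverse u c r : contC u (c - r) -> contC (fun s => u (c - s)) r.
Proof.
intros [H1 H2]; split.
- now apply (continuous_reverse (fun s => Re (u s))).
- now apply (continuous_reverse (fun s => Im (u s))).
Qed.

Lemma gronwall_backward (u du : R -> C) (g dg : R -> R) (a b : R) :
  a <= b ->
  (forall r, a <= r <= b -> contC u r /\ continuous g r) ->
  (forall r, a < r < b ->
     derC u r (du r) /\ is_derive g r (dg r) /\ Cmod (du r) <= dg r * Cmod (u r)) ->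
  Cmod (u a) <= exp (g b - g a) * Cmod (u b).
Proof.
intros Hab Hc Hd.
pose proof (gronwall_forward (fun s => u (a + b - s)) (fun s => (- du (a + b - s)%R)%C)
  (fun s => - g (a + b - s)) (fun s => dg (a + b - s)) a b Hab) as H.
cbv beta in H.
replace (a + b - a) with b in H by ring. replace (a + b - b) with a in H by ring.
replace (- g a - - g b) with (g b - g a) in H by ring.
apply H.
- intros r Hr. destruct (Hc (a + b - r) ltac:(lra)) as [H1 H2]. split.
  + now apply contC_reverse.
  + apply (continuous_opp (fun s => g (a + b - s))). now apply continuous_reverse.
- intros r Hr. destruct (Hd (a + b - r) ltac:(lra)) as [H1 [H2 H3]]. split; [|split].
  + now apply derC_reverse.
  + replace (dg (a + b - r)) with (opp (scal (-1) (dg (a + b - r))))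
      by (unfold opp, scal; simpl; unfold mult; simpl; ring).
    apply (is_derive_opp (fun s => g (a + b - s))).
    apply (is_derive_comp g (fun s => a + b - s)); [exact H2|].
    auto_derive; auto; ring.
  + now rewrite Cmod_opp.
Qed.

Lemma gronwall_affine (u du : R -> C) (K eta a b : R) :
  a <= b -> 0 <= K ->
  (forall r, a <= r <= b -> contC u r) ->
  (forall r, a < r < b -> derC u r (du r) /\ Cmod (du r) <= K * Cmod (u r) + eta) ->
  Cmod (u b) ^ 2 <= (Cmod (u a) ^ 2 + eta ^ 2) * exp ((2 * K + 1) * (b - a)).
Proof.
intros Hab HK Hc Hd.
pose (M := 2 * K + 1).
assert (H : (Cmod (u b) ^ 2 + eta ^ 2) * exp (- M * b)
            <= (Cmod (u a) ^ 2 + eta ^ 2) * exp (- M * a)).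
{ apply (decreasing_on (fun r => (Cmod (u r) ^ 2 + eta ^ 2) * exp (- M * r))
    (fun r => (2 * dot (u r) (du r) + 0) * exp (- M * r)
      + (Cmod (u r) ^ 2 + eta ^ 2) * (- M * exp (- M * r)))); auto.
  - intros r Hr. apply (continuous_mult_R (fun r => Cmod (u r) ^ 2 + eta ^ 2)).
    + apply (continuous_plus_R (fun r => Cmod (u r) ^ 2)); [now apply contC_normsq, Hc|apply continuous_const].
    + apply (ex_derive_continuous (K := R_AbsRing) (V := R_NormedModule)). auto_derive; auto.
  - intros r Hr. destruct (Hd r Hr) as [H1 H3]. split.
    + apply (is_derive_mult_R (fun r => Cmod (u r) ^ 2 + eta ^ 2) (fun r => exp (- M * r))).
      * apply (is_derive_plus (fun r => Cmod (u r) ^ 2) (fun _ => eta ^ 2)).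
        -- now apply derC_normsq.
        -- apply (is_derive_const (eta ^ 2) r).
      * auto_derive; auto; ring.
    + pose proof (dot_le (u r) (du r)). pose proof (Cmod_ge_0 (u r)).
      pose proof (exp_pos (- M * r)).
      assert (2 * dot (u r) (du r) <= M * (Cmod (u r) ^ 2 + eta ^ 2)).
      { unfold M. assert (Cmod (u r) * Cmod (du r) <= Cmod (u r) * (K * Cmod (u r) + eta)) by nra.
        assert (0 <= (Cmod (u r) - eta) ^ 2) by apply pow2_ge_0.
        assert (0 <= K * eta ^ 2) by (apply Rmult_le_pos; auto; apply pow2_ge_0).
        nra. }
      nra. }
apply Rmult_le_compat_r with (r := exp (M * b)) in H; [|apply Rlt_le, exp_pos].
rewrite !Rmult_assoc, <- !exp_plus in H.
replace (- M * b + M * b) with 0 in H by ring. rewrite exp_0 in H.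
replace (- M * a + M * b) with (M * (b - a)) in H by ring.
unfold M in H. pose proof (pow2_ge_0 eta). lra.
Qed.

(** * Picard's theorem for fields of the form phi (u - lam) *)

Lemma contC_iff (u : R -> C) (s : R) :
  contC u s <->
  forall eps, 0 < eps -> exists d, 0 < d /\
    forall r, Rabs (r - s) < d -> Cmod (u r - u s) < eps.
Proof.
split.
- intros [H1 H2] eps He.
  assert (He2 : 0 < eps / 2) by lra.
  destruct (proj1 (filterlim_locally _ _) H1 (mkposreal _ He2)) as [d1 D1].
  destruct (proj1 (filterlim_locally _ _) H2 (mkposreal _ He2)) as [d2 D2].
  exists (Rmin d1 d2). split; [apply Rmin_glb_lt; [apply d1|apply d2]|].
  intros r Hr.
  specialize (D1 r (Rlt_le_trans _ _ _ Hr (Rmin_l _ _))).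
  specialize (D2 r (Rlt_le_trans _ _ _ Hr (Rmin_r _ _))).
  change (Rabs (Re (u r) - Re (u s)) < eps / 2) in D1.
  change (Rabs (Im (u r) - Im (u s)) < eps / 2) in D2.
  apply Rle_lt_trans with (1 := Cmod_Re_Im _).
  change (Rabs (Re (u r) - Re (u s)) + Rabs (Im (u r) - Im (u s)) < eps). lra.
- intros H. split; apply filterlim_locally; intros [eps He];
    destruct (H eps He) as [d [Hd D]]; exists (mkposreal d Hd); intros r Hr;
    specialize (D r Hr); apply Rle_lt_trans with (2 := D).
  + apply (re_le_Cmod (u r - u s)%C).
  + apply (im_le_Cmod (u r - u s)%C).
Qed.

Lemma contC_lipschitz (u : R -> C) (M s : R) :
  (forall r, Cmod (u r - u s) <= M * Rabs (r - s)) -> contC u s.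
Proof.
intros H. apply contC_iff. intros eps He.
assert (HM : 0 < Rabs M + 1) by (pose proof (Rabs_pos M); lra).
exists (eps / (Rabs M + 1)). split; [now apply Rdiv_lt_0_compat|].
intros r Hr. apply Rle_lt_trans with (1 := H r).
apply Rmult_lt_compat_r with (r := Rabs M + 1) in Hr; [|assumption].
unfold Rdiv in Hr. rewrite Rmult_assoc, Rinv_l in Hr by lra.
pose proof (Rle_abs M). pose proof (Rabs_pos (r - s)). nra.
Qed.

Lemma derC_is_derive (u : R -> C) (s : R) (l : C) :
  derC u s l <-> is_derive (K := R_AbsRing) (V := C_R_NormedModule) u s l.
Proof.
split.
- intros [H1 H2].
  apply (filterdiff_ext (U := R_NormedModule) (V := C_R_NormedModule)
    (fun r : R => (Re (u r), Im (u r)))).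
  { intros r. now destruct (u r). }
  apply (filterdiff_ext_lin (U := R_NormedModule) (V := C_R_NormedModule)
    _ (fun h : R => (scal h (Re l), scal h (Im l)))).
  2:{ intros h. now destruct l. }
  apply (filterdiff_comp'_2 (U := R_NormedModule) (V := R_NormedModule)
    (W := C_R_NormedModule) (fun r : R => Re (u r)) (fun r : R => Im (u r))
    (fun x y => (x, y)) s _ _ (fun x y => (x, y)) H1 H2).
  apply (filterdiff_ext (U := C_R_NormedModule) (V := C_R_NormedModule) (fun x => x)).
  { now intros [x y]. }
  apply (filterdiff_ext_lin (U := C_R_NormedModule) (V := C_R_NormedModule) _ (fun x => x)).
  2:{ now intros [x y]. }
  apply filterdiff_id.
- intros H; split.
  + apply (filterdiff_comp' (U := R_NormedModule) (V := C_R_NormedModule) (W := R_NormedModule)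
      u fst s _ fst H).
    apply filterdiff_linear. exact (is_linear_fst (U := R_NormedModule) (V := R_NormedModule)).
  + apply (filterdiff_comp' (U := R_NormedModule) (V := C_R_NormedModule) (W := R_NormedModule)
      u snd s _ snd H).
    apply filterdiff_linear. exact (is_linear_snd (U := R_NormedModule) (V := R_NormedModule)).
Qed.

Lemma is_filter_lim_within (D : R -> Prop) (s x : R) :
  D s -> is_filter_lim (within D (locally s)) x -> s = x.
Proof.
intros HD H.
destruct (Req_dec s x) as [|Hne]; [assumption|exfalso].
assert (Hp : 0 < Rabs (s - x)) by (apply Rabs_pos_lt; lra).
destruct (H (fun r => Rabs (r - x) < Rabs (s - x))) as [d Hd].
{ exists (mkposreal _ Hp). intros r Hr. exact Hr. }
specialize (Hd s (ball_center _ _) HD). lra.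
Qed.

Lemma derC_is_derive_on (D : R -> Prop) (u : R -> C) (s : R) (l : C) :
  D s -> derC u s l -> is_derive_on D u s l.
Proof.
intros HD H. apply derC_is_derive in H. destruct H as [Hl Hd].
split; [assumption|].
intros x Hx. apply (is_filter_lim_within D s x HD) in Hx. subst x.
intros eps. apply filter_le_within, (Hd s (fun P H => H) eps).
Qed.

Lemma is_derive_on_derC (D : R -> Prop) (u : R -> C) (s : R) (l : C) :
  locally s D -> is_derive_on D u s l -> derC u s l.
Proof.
intros HD [Hl Hd]. apply derC_is_derive. split; [assumption|].
intros x Hx. apply (is_filter_lim_locally_unique (K := R_AbsRing) (V := R_NormedModule)) in Hx. subst x.
intros eps.
assert (Hlim : is_filter_lim (within D (locally s)) s).
{ intros P HP. now apply filter_le_within. }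
specialize (Hd s Hlim eps). unfold within in Hd.
generalize (filter_and _ _ HD Hd). apply filter_imp. tauto.
Qed.

Lemma scalC (h : R) (l : C) : @scal R_AbsRing C_R_NormedModule h l = (RtoC h * l)%C.
Proof.
destruct l as [a b]. unfold scal; simpl. unfold prod_scal, scal; simpl.
unfold mult; simpl. unfold Cmult, RtoC; simpl. f_equal; ring.
Qed.

Lemma is_derive_on_lipschitz (D : R -> Prop) (u : R -> C) (s : R) (l : C) :
  D s -> is_derive_on D u s l ->
  exists d, 0 < d /\ forall r, D r -> Rabs (r - s) < d ->
    Cmod (u r - u s) <= (1 + Cmod l) * Rabs (r - s).
Proof.
intros HD [_ Hd].
assert (Hlim : is_filter_lim (within D (locally s)) s).
{ intros P HP. now apply filter_le_within. }
destruct (Hd s Hlim (mkposreal 1 Rlt_0_1)) as [d D1].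
exists d. split; [apply d|]. intros r Hr Hrs.
specialize (D1 r Hrs Hr). cbv beta in D1. rewrite scalC, <- Cmod_norm in D1.
change (Cmod (u r - u s - RtoC (r - s) * l) <= 1 * Rabs (r - s)) in D1.
replace (u r - u s)%C with ((u r - u s - RtoC (r - s) * l) + RtoC (r - s) * l)%C by ring.
apply Rle_trans with (1 := Cmod_triangle _ _).
rewrite Cmod_mult, Cmod_R. lra.
Qed.

Definition clamp (a b r : R) : R := Rmax a (Rmin b r).

Lemma clamp_in a b r : a <= b -> a <= clamp a b r <= b.
Proof. intros H. unfold clamp, Rmax, Rmin. repeat destruct Rle_dec; lra. Qed.

Lemma clamp_id a b r : a <= r <= b -> clamp a b r = r.
Proof. intros H. unfold clamp, Rmax, Rmin. repeat destruct Rle_dec; lra. Qed.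

Lemma clamp_lipschitz a b r s : Rabs (clamp a b r - clamp a b s) <= Rabs (r - s).
Proof.
unfold clamp, Rmax, Rmin, Rabs.
repeat destruct Rle_dec; repeat destruct Rcase_abs; lra.
Qed.

Lemma contC_clamp (D : R -> Prop) (u du : R -> C) (a b : R) :
  a <= b ->
  (forall s, D s <-> a <= s <= b) ->
  (forall s, D s -> is_derive_on D u s (du s)) ->
  forall s, contC (fun r => u (clamp a b r)) s.
Proof.
intros Hab HD Hd s.
assert (Hs : D (clamp a b s)) by (apply HD, clamp_in, Hab).
destruct (is_derive_on_lipschitz D u _ _ Hs (Hd _ Hs)) as [d [Hdp H]].
apply contC_iff. intros eps He.
set (M := 1 + Cmod (du (clamp a b s))) in *.
assert (HM : 0 < M) by (unfold M; pose proof (Cmod_ge_0 (du (clamp a b s))); lra).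
exists (Rmin d (eps / M)). split.
{ apply Rmin_glb_lt; [assumption|now apply Rdiv_lt_0_compat]. }
intros r Hr. pose proof (clamp_lipschitz a b r s) as Hc.
pose proof (Rmin_l d (eps / M)). pose proof (Rmin_r d (eps / M)).
apply Rle_lt_trans with (M * Rabs (clamp a b r - clamp a b s)).
- apply H; [apply HD, clamp_in, Hab|lra].
- apply Rlt_le_trans with (M * (eps / M)); [|right; field; lra].
  apply Rmult_lt_compat_l; lra.
Qed.

Definition limC (v : nat -> C) (l : C) : Prop :=
  forall eps, 0 < eps -> exists N, forall n, (N <= n)%nat -> Cmod (v n - l) < eps.

Lemma Cmod_minus_sym (a b : C) : Cmod (a - b) = Cmod (b - a).
Proof. rewrite <- Cmod_opp. f_equal. ring. Qed.

Lemma Cmod_triangle_minus (a b c : C) : Cmod (a - c) <= Cmod (a - b) + Cmod (b - c).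
Proof. replace (a - c)%C with ((a - b) + (b - c))%C by ring. apply Cmod_triangle. Qed.

Lemma Cmod_minus_le (a b : C) : Cmod a - Cmod b <= Cmod (a - b).
Proof.
replace a with ((a - b) + b)%C at 1 by ring.
pose proof (Cmod_triangle (a - b) b). lra.
Qed.

Lemma limC_cauchy (v : nat -> C) :
  (forall eps, 0 < eps -> exists N, forall n m, (N <= n)%nat -> (N <= m)%nat ->
     Cmod (v n - v m) < eps) ->
  exists l, limC v l.
Proof.
intros H.
assert (C1 : Cauchy_crit (fun n => Re (v n))).
{ intros eps He. destruct (H eps He) as [N HN]. exists N. intros n m Hn Hm.
  apply Rle_lt_trans with (2 := HN n m Hn Hm). apply (re_le_Cmod (v n - v m)%C). }
assert (C2 : Cauchy_crit (fun n => Im (v n))).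
{ intros eps He. destruct (H eps He) as [N HN]. exists N. intros n m Hn Hm.
  apply Rle_lt_trans with (2 := HN n m Hn Hm). apply (im_le_Cmod (v n - v m)%C). }
destruct (Rcomplete.R_complete _ C1) as [x Hx]. destruct (Rcomplete.R_complete _ C2) as [y Hy].
exists (x, y). intros eps He.
destruct (Hx (eps / 2) ltac:(lra)) as [N1 H1].
destruct (Hy (eps / 2) ltac:(lra)) as [N2 H2].
exists (max N1 N2). intros n Hn.
specialize (H1 n ltac:(lia)). specialize (H2 n ltac:(lia)). unfold Rdist in *.
apply Rle_lt_trans with (1 := Cmod_Re_Im _).
change (Rabs (Re (v n) - x) + Rabs (Im (v n) - y) < eps). lra.
Qed.

Lemma limC_le (v : nat -> C) (l c : C) (B : R) (N : nat) :
  limC v l -> (forall n, (N <= n)%nat -> Cmod (v n - c) <= B) -> Cmod (l - c) <= B.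
Proof.
intros Hl HB. apply Rnot_lt_le. intros Hlt.
destruct (Hl (Cmod (l - c) - B) ltac:(lra)) as [N' HN].
specialize (HN (max N N') ltac:(lia)). specialize (HB (max N N') ltac:(lia)).
pose proof (Cmod_triangle_minus l (v (max N N')) c) as H.
rewrite (Cmod_minus_sym l (v _)) in H. lra.
Qed.

Lemma Cmod_small_eq (a b : C) : (forall eps, 0 < eps -> Cmod (a - b) < eps) -> a = b.
Proof.
intros H. assert (E : Cmod (a - b) = 0).
{ destruct (Rle_lt_or_eq_dec 0 _ (Cmod_ge_0 (a - b))) as [Hp|He]; [|now symmetry].
  specialize (H _ Hp). lra. }
apply Cmod_eq_0 in E. replace a with ((a - b) + b)%C by ring. rewrite E. ring.
Qed.

Lemma limC_unique (v : nat -> C) (l m : C) : limC v l -> limC v m -> l = m.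
Proof.
intros Hl Hm. apply Cmod_small_eq. intros eps He.
destruct (Hl (eps / 2) ltac:(lra)) as [N1 H1].
destruct (Hm (eps / 2) ltac:(lra)) as [N2 H2].
specialize (H1 (max N1 N2) ltac:(lia)). specialize (H2 (max N1 N2) ltac:(lia)).
pose proof (Cmod_triangle_minus l (v (max N1 N2)) m) as H.
rewrite (Cmod_minus_sym l (v _)) in H. lra.
Qed.

Lemma half_pow_small (B eps : R) : 0 < eps -> exists N, forall n, (N <= n)%nat -> B * (/ 2) ^ n < eps.
Proof.
intros He.
destruct (pow_lt_1_zero (/ 2)) with (y := eps / (Rabs B + 1)) as [N HN].
{ rewrite Rabs_pos_eq; lra. }
{ apply Rdiv_lt_0_compat; [assumption|]. pose proof (Rabs_pos B); lra. }
exists N. intros n Hn. specialize (HN n Hn).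
assert (Hp : 0 < (/ 2) ^ n) by (apply pow_lt; lra).
rewrite Rabs_pos_eq in HN by lra.
assert (HB : 0 < Rabs B + 1) by (pose proof (Rabs_pos B); lra).
apply Rmult_lt_compat_r with (r := Rabs B + 1) in HN; [|assumption].
unfold Rdiv in HN. rewrite Rmult_assoc, Rinv_l in HN by lra.
pose proof (Rle_abs B). nra.
Qed.

Lemma limC_geometric (v : nat -> C) (B : R) :
  (forall n, Cmod (v (S n) - v n) <= B * (/ 2) ^ n) ->
  exists l, limC v l /\ forall n, Cmod (l - v n) <= 2 * B * (/ 2) ^ n.
Proof.
intros H.
assert (HS : forall n k, Cmod (v (n + k)%nat - v n) <= 2 * B * (/ 2) ^ n * (1 - (/ 2) ^ k)).
{ intros n k. induction k as [|k IH].
  - rewrite Nat.add_0_r. replace (v n - v n)%C with (RtoC 0) by ring. rewrite Cmod_0. simpl. lra.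
  - pose proof (Cmod_triangle_minus (v (n + S k)%nat) (v (n + k)%nat) (v n)).
    specialize (H (n + k)%nat). rewrite Nat.add_succ_r in *.
    rewrite pow_add in H. simpl. nra. }
assert (HB : 0 <= B).
{ specialize (H 0%nat). simpl in H. pose proof (Cmod_ge_0 (v 1%nat - v 0%nat)). lra. }
assert (HS' : forall n m, (n <= m)%nat -> Cmod (v m - v n) <= 2 * B * (/ 2) ^ n).
{ intros n m Hnm. specialize (HS n (m - n)%nat). replace (n + (m - n))%nat with m in HS by lia.
  assert (0 < (/ 2) ^ n) by (apply pow_lt; lra).
  assert (0 < (/ 2) ^ (m - n)) by (apply pow_lt; lra).
  assert (0 <= 2 * B * (/ 2) ^ n) by nra. nra. }
destruct (limC_cauchy v) as [l Hl].
{ intros eps He. destruct (half_pow_small (2 * B) (eps / 2) ltac:(lra)) as [N HN].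
  exists N. intros n m Hn Hm. specialize (HN N (le_n N)).
  pose proof (Cmod_triangle_minus (v n) (v N) (v m)) as Ht.
  pose proof (HS' N n Hn). pose proof (HS' N m Hm).
  rewrite (Cmod_minus_sym (v N) (v m)) in Ht. lra. }
exists l. split; [assumption|]. intros n.
apply (limC_le v l (v n) _ n Hl). intros m Hm. now apply HS'.
Qed.

Definition IntC (f : R -> C) (r : R) : C :=
  (RInt (fun s => Re (f s)) 0 r, RInt (fun s => Im (f s)) 0 r).

Lemma derC_IntC (f : R -> C) (r : R) : (forall s, contC f s) -> derC (IntC f) r (f r).
Proof.
intros H. split; simpl.
- apply (is_derive_RInt (fun s => Re (f s)) _ 0).
  + exists (mkposreal 1 Rlt_0_1). intros y _.
    apply (RInt_correct (V := R_CompleteNormedModule)), ex_RInt_continuous. intros x _; exact (proj1 (H x)).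
  + exact (proj1 (H r)).
- apply (is_derive_RInt (fun s => Im (f s)) _ 0).
  + exists (mkposreal 1 Rlt_0_1). intros y _.
    apply (RInt_correct (V := R_CompleteNormedModule)), ex_RInt_continuous. intros x _; exact (proj2 (H x)).
  + exact (proj2 (H r)).
Qed.

Lemma IntC_0 f : IntC f 0 = 0.
Proof. unfold IntC. rewrite !RInt_point. reflexivity. Qed.

Lemma lipschitz_from_derC (u : R -> C) (M : R) :
  (forall r, exists l, derC u r l /\ Cmod l <= M) ->
  forall r s, Cmod (u r - u s) <= M * Rabs (r - s).
Proof.
intros H.
assert (Hw : forall r s, s <= r -> Cmod (u r - u s) <= M * (r - s)).
{ intros r s Hsr.
  replace (M * (r - s)) with (M * r - M * s) by ring.
  pose (du := fun x => proj1_sig (constructive_indefinite_description _ (H x))).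
  apply (mean_value_C u du (fun x => M * x) (fun _ => M)); [assumption| |].
  - intros x _. split.
    + destruct (H x) as [l [Hl _]]. now apply derC_contC with l.
    + apply (ex_derive_continuous (K := R_AbsRing) (V := R_NormedModule)). auto_derive; auto.
  - intros x _. unfold du. destruct constructive_indefinite_description as [l [H1 H2]]; simpl.
    split; [exact H1|split; [|exact H2]]. auto_derive; auto; ring. }
intros r s. destruct (Rle_lt_dec s r) as [Hsr|Hsr].
- rewrite Rabs_pos_eq by lra. now apply Hw.
- rewrite Cmod_minus_sym, Rabs_minus_sym, Rabs_pos_eq by lra. apply Hw; lra.
Qed.

Section Picard.

Variables (phi : C -> C) (lam : R -> R) (K M : R) (z : C).
Hypothesis HK : 0 < K.
Hypothesis phi_lipschitz : forall a b, Cmod (phi a - phi b) <= K * Cmod (a - b).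
Hypothesis phi_bounded : forall a, Cmod (phi a) <= M.
Hypothesis lam_continuous : forall r, continuous lam r.

(* The field is reflected in time, so that solutions for r >= 0 are two-sidedly
   differentiable at 0. *)
Let field (u : R -> C) (s : R) : C := phi (u (Rabs s) - RtoC (lam (Rabs s)))%C.

Fixpoint picard_iter (n : nat) : R -> C :=
  match n with
  | O => fun _ => z
  | S n => fun r => (z + IntC (field (picard_iter n)) r)%C
  end.

Lemma field_continuous u : (forall r, 0 <= r -> contC u r) -> forall s, contC (field u) s.
Proof.
intros Hu s. apply contC_iff. intros eps He.
assert (Hcl : contC (fun r => (u (Rabs r) - RtoC (lam (Rabs r)))%C) s).
{ apply contC_minus.
  - destruct (Hu (Rabs s) (Rabs_pos s)) as [H1 H2].
    split; [apply (continuous_comp Rabs (fun r => Re (u r)))|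
            apply (continuous_comp Rabs (fun r => Im (u r)))]; auto;
      apply (continuous_abs (K := R_AbsRing) s).
  - apply contC_RtoC. apply (continuous_comp Rabs lam); auto.
    apply (continuous_abs (K := R_AbsRing) s). }
destruct (proj1 (contC_iff _ _) Hcl (eps / K)) as [d [Hd D]].
{ now apply Rdiv_lt_0_compat. }
exists d. split; [assumption|]. intros r Hr. specialize (D r Hr). cbv beta in D.
unfold field. apply Rle_lt_trans with (1 := phi_lipschitz _ _).
apply Rlt_le_trans with (K * (eps / K)); [|right; field; lra].
now apply Rmult_lt_compat_l.
Qed.

Lemma picard_iter_continuous n r : contC (picard_iter n) r.
Proof.
revert r. induction n as [|n IH]; intros r; simpl.
- apply contC_const.
- apply contC_plus; [apply contC_const|].
  apply derC_contC with (1 := derC_IntC _ r (field_continuous _ (fun r _ => IH r))).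
Qed.

Lemma picard_iter_derC n r : derC (picard_iter (S n)) r (field (picard_iter n) r).
Proof.
simpl. apply derC_eq with (0 + field (picard_iter n) r)%C; [|ring].
apply (derC_plus (fun _ => z) (IntC (field (picard_iter n)))).
- apply derC_const.
- apply derC_IntC, field_continuous. intros; apply picard_iter_continuous.
Qed.

Lemma picard_iter_0 n : picard_iter n 0 = z.
Proof. destruct n; simpl; [reflexivity|]. rewrite IntC_0. ring. Qed.

Lemma field_bound_nonneg : 0 <= M.
Proof. apply Rle_trans with (2 := phi_bounded 0), Cmod_ge_0. Qed.

Lemma picard_iter_lipschitz n r s :
  Cmod (picard_iter n r - picard_iter n s) <= M * Rabs (r - s).
Proof.
destruct n as [|n].
- simpl. replace (z - z)%C with (RtoC 0) by ring. rewrite Cmod_0.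
  apply Rmult_le_pos; [apply field_bound_nonneg|apply Rabs_pos].
- apply lipschitz_from_derC. intros x. exists (field (picard_iter n) x).
  split; [apply picard_iter_derC|apply phi_bounded].
Qed.

Lemma exp_bound_propagates (u du : R -> C) (B r : R) :
  0 <= r -> 0 <= B -> u 0 = 0 ->
  (forall s, 0 <= s -> derC u s (du s) /\ Cmod (du s) <= 2 * K * B * exp (2 * K * s)) ->
  Cmod (u r) <= B * exp (2 * K * r).
Proof.
intros Hr HB H0 Hd.
assert (Hm : Cmod (u r - u 0) <= B * exp (2 * K * r) - B * exp (2 * K * 0)).
{ apply (mean_value_C u du (fun s => B * exp (2 * K * s)) (fun s => 2 * K * B * exp (2 * K * s)));
    [assumption| |].
  - intros s Hs. split; [apply derC_contC with (du s), Hd; lra|].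
    apply (ex_derive_continuous (K := R_AbsRing) (V := R_NormedModule)). auto_derive; auto.
  - intros s Hs. destruct (Hd s ltac:(lra)) as [H1 H2]. split; [exact H1|split; [|exact H2]].
    auto_derive; auto; ring. }
rewrite H0 in Hm. replace (u r - 0)%C with (u r) in Hm by ring.
pose proof (exp_pos (2 * K * 0)). nra.
Qed.

Lemma picard_iter_step n r :
  0 <= r ->
  Cmod (picard_iter (S n) r - picard_iter n r)
    <= M / (2 * K) * exp (2 * K * r) * (/ 2) ^ n.
Proof.
assert (HA : 0 <= M / (2 * K)).
{ apply Rmult_le_pos; [apply field_bound_nonneg|apply Rlt_le, Rinv_0_lt_compat; lra]. }
revert r. induction n as [|n IH]; intros r Hr.
- rewrite pow_O, Rmult_1_r.
  apply (exp_bound_propagates (fun r => (picard_iter 1 r - picard_iter 0 r)%C)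
    (fun r => (field (picard_iter 0) r - 0)%C)); auto.
  + rewrite !picard_iter_0. ring.
  + intros s Hs. split.
    * apply derC_minus; [apply picard_iter_derC|apply derC_const].
    * replace (2 * K * (M / (2 * K))) with M by (field; lra).
      replace (field (picard_iter 0) s - 0)%C with (field (picard_iter 0) s) by ring.
      apply Rle_trans with (1 := phi_bounded _).
      assert (1 <= exp (2 * K * s)).
      { pose proof (exp_ineq1_le (2 * K * s)). nra. }
      pose proof field_bound_nonneg. nra.
- replace (M / (2 * K) * exp (2 * K * r) * (/ 2) ^ S n)
    with (M / (2 * K) * (/ 2) ^ S n * exp (2 * K * r)) by ring.
  apply (exp_bound_propagates (fun r => (picard_iter (S (S n)) r - picard_iter (S n) r)%C)
    (fun r => (field (picard_iter (S n)) r - field (picard_iter n) r)%C)); auto.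
  + apply Rmult_le_pos; [assumption|apply pow_le; lra].
  + rewrite !picard_iter_0. ring.
  + intros s Hs. split.
    * apply derC_minus; apply picard_iter_derC.
    * unfold field. rewrite (Rabs_pos_eq s) by assumption.
      apply Rle_trans with (1 := phi_lipschitz _ _).
      replace (picard_iter (S n) s - RtoC (lam s) - (picard_iter n s - RtoC (lam s)))%C
        with (picard_iter (S n) s - picard_iter n s)%C by ring.
      specialize (IH s Hs).
      replace ((/ 2) ^ S n) with (/ 2 * (/ 2) ^ n) by reflexivity.
      nra.
Qed.

Lemma picard :
  exists u : R -> C, u 0 = z /\ forall r, 0 <= r -> derC u r (phi (u r - RtoC (lam r))%C).
Proof.
assert (Hex : forall r, exists l, 0 <= r ->
  limC (fun n => picard_iter n r) l /\
  forall n, Cmod (l - picard_iter n r) <= 2 * (M / (2 * K) * exp (2 * K * r)) * (/ 2) ^ n).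
{ intros r. destruct (Rle_lt_dec 0 r) as [Hr|Hr].
  - destruct (limC_geometric (fun n => picard_iter n r) (M / (2 * K) * exp (2 * K * r)))
      as [l Hl].
    + intros n. now apply picard_iter_step.
    + now exists l.
  - exists z. intros; lra. }
pose (v := fun r => proj1_sig (constructive_indefinite_description _ (Hex r))).
assert (Hv : forall r, 0 <= r -> limC (fun n => picard_iter n r) (v r) /\
  forall n, Cmod (v r - picard_iter n r) <= 2 * (M / (2 * K) * exp (2 * K * r)) * (/ 2) ^ n).
{ intros r. unfold v. destruct constructive_indefinite_description as [l Hl]; exact Hl. }
assert (Hvc : forall s, contC (fun r => v (Rabs r)) s).
{ intros s. apply contC_lipschitz with M. intros r.
  destruct (Hv (Rabs r) (Rabs_pos r)) as [H1 _]. destruct (Hv (Rabs s) (Rabs_pos s)) as [H2 _].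
  apply Rnot_lt_le. intros Hlt.
  set (D := Cmod (v (Rabs r) - v (Rabs s)) - M * Rabs (r - s)) in *.
  assert (HD : 0 < D) by (unfold D; lra).
  destruct (H1 (D / 2) ltac:(lra)) as [N1 K1]. destruct (H2 (D / 2) ltac:(lra)) as [N2 K2].
  specialize (K1 (max N1 N2) ltac:(lia)). specialize (K2 (max N1 N2) ltac:(lia)).
  cbv beta in K1, K2. set (w := picard_iter (max N1 N2)) in *.
  pose proof (Cmod_triangle_minus (v (Rabs r)) (w (Rabs r)) (v (Rabs s))) as T1.
  pose proof (Cmod_triangle_minus (w (Rabs r)) (w (Rabs s)) (v (Rabs s))) as T2.
  pose proof (picard_iter_lipschitz (max N1 N2) (Rabs r) (Rabs s)) as T3. fold w in T3.
  rewrite Cmod_minus_sym in K1.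
  assert (M * Rabs (Rabs r - Rabs s) <= M * Rabs (r - s)).
  { apply Rmult_le_compat_l; [apply field_bound_nonneg|apply Rabs_triang_inv2]. }
  unfold D in *. lra. }
assert (Hfc : forall s, contC (field v) s).
{ intros s. assert (H := field_continuous (fun r => v (Rabs r)) (fun r _ => Hvc r) s).
  revert H. unfold field. intros [H1 H2].
  split; [revert H1|revert H2]; apply continuous_ext; intros x; now rewrite Rabs_Rabsolu. }
pose (W := fun r => (z + IntC (field v) r)%C).
assert (HW : forall r, derC W r (field v r)).
{ intros r. unfold W. apply derC_eq with (0 + field v r)%C; [|ring].
  apply (derC_plus (fun _ => z) (IntC (field v))); [apply derC_const|now apply derC_IntC]. }
assert (HWv : forall r, 0 <= r -> W r = v r).
{ intros r Hr. apply (limC_unique (fun n => picard_iter n r)); [|now apply Hv].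
  assert (Hb : forall n, Cmod (W r - picard_iter (S n) r)
     <= 2 * (M / (2 * K)) * (/ 2) ^ S n * exp (2 * K * r)).
  { intros n. apply (exp_bound_propagates (fun r => (W r - picard_iter (S n) r)%C)
      (fun r => (field v r - field (picard_iter n) r)%C)); auto.
    - apply Rmult_le_pos; [|apply pow_le; lra].
      apply Rmult_le_pos; [lra|].
      apply Rmult_le_pos; [apply field_bound_nonneg|apply Rlt_le, Rinv_0_lt_compat; lra].
    - rewrite picard_iter_0. unfold W. rewrite IntC_0. ring.
    - intros s Hs. split; [apply derC_minus; [apply HW|apply picard_iter_derC]|].
      unfold field. rewrite (Rabs_pos_eq s) by assumption.
      apply Rle_trans with (1 := phi_lipschitz _ _).
      replace (v s - RtoC (lam s) - (picard_iter n s - RtoC (lam s)))%C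
        with (v s - picard_iter n s)%C by ring.
      destruct (Hv s Hs) as [_ Hn]. specialize (Hn n).
      replace ((/ 2) ^ S n) with (/ 2 * (/ 2) ^ n) by reflexivity. nra. }
  intros eps He.
  destruct (half_pow_small (2 * (M / (2 * K)) * exp (2 * K * r)) eps He) as [N HN].
  exists (S N). intros n Hn. destruct n as [|n]; [lia|].
  specialize (Hb n). specialize (HN (S n) ltac:(lia)).
  rewrite Cmod_minus_sym. lra. }
exists W. split.
- unfold W. rewrite IntC_0. ring.
- intros r Hr. apply derC_eq with (1 := HW r). unfold field.
  rewrite (Rabs_pos_eq r) by assumption. now rewrite HWv.
Qed.

End Picard.

(** * The Loewner flow for a continuous driving function *)

Lemma Cmod_sq (h : C) : Cmod h ^ 2 = Re h ^ 2 + Im h ^ 2.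
Proof. apply Cmod2_alt. Qed.

Lemma Re_div2 (h : C) : h <> RtoC 0 -> Re (RtoC 2 / h) = 2 * Re h / Cmod h ^ 2.
Proof.
intros H. apply Cmod_gt_0 in H. assert (Hp : 0 < Cmod h ^ 2) by (apply pow_lt; lra).
rewrite Cmod_sq in *. unfold Re, Im in *. simpl in *. field. lra.
Qed.

Lemma Im_div2 (h : C) : h <> RtoC 0 -> Im (RtoC 2 / h) = - 2 * Im h / Cmod h ^ 2.
Proof.
intros H. apply Cmod_gt_0 in H. assert (Hp : 0 < Cmod h ^ 2) by (apply pow_lt; lra).
rewrite Cmod_sq in *. unfold Re, Im in *. simpl in *. field. lra.
Qed.

Lemma Cmod_div2 (h : C) : h <> RtoC 0 -> Cmod (RtoC 2 / h) = 2 / Cmod h.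
Proof. intros H. rewrite Cmod_div, Cmod_R, Rabs_pos_eq by (auto; lra). reflexivity. Qed.

Lemma div2_lipschitz (a b : C) (c : R) :
  0 < c -> c <= Cmod a -> c <= Cmod b ->
  Cmod (RtoC 2 / a - RtoC 2 / b) <= 2 / c ^ 2 * Cmod (a - b).
Proof.
intros Hc Ha Hb.
assert (Ha0 : a <> RtoC 0) by (apply Cmod_gt_0; lra).
assert (Hb0 : b <> RtoC 0) by (apply Cmod_gt_0; lra).
replace (RtoC 2 / a - RtoC 2 / b)%C with (RtoC 2 / a * (b - a) / b)%C by (field; auto).
rewrite Cmod_div, Cmod_mult, Cmod_div2, Cmod_minus_sym by assumption.
assert (Hp : 0 <= Cmod (a - b)) by apply Cmod_ge_0.
replace (2 / Cmod a * Cmod (a - b) / Cmod b)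
  with (2 * Cmod (a - b) * (/ Cmod a * / Cmod b)) by (field; lra).
replace (2 / c ^ 2 * Cmod (a - b)) with (2 * Cmod (a - b) * (/ c * / c)) by (field; lra).
apply Rmult_le_compat_l; [lra|].
apply Rmult_le_compat; try (apply Rlt_le, Rinv_0_lt_compat; lra);
  apply Rinv_le_contravar; lra.
Qed.

Definition cut (eta : R) (h : C) : C := (Re h, Rmax eta (Im h)).
Definition cut_field (eta : R) (h : C) : C := (RtoC 2 / cut eta h)%C.

Lemma cut_id eta h : eta <= Im h -> cut eta h = h.
Proof. intros H. unfold cut. rewrite Rmax_right by assumption. now destruct h. Qed.

Lemma Cmod_cut eta h : 0 < eta -> eta <= Cmod (cut eta h).
Proof.
intros He. apply Rle_trans with (2 := im_le_Cmod _). simpl.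
apply Rle_trans with (2 := Rle_abs _). apply Rmax_l.
Qed.

Lemma cut_neq0 eta h : 0 < eta -> cut eta h <> RtoC 0.
Proof. intros He. apply Cmod_gt_0. pose proof (Cmod_cut eta h He). lra. Qed.

Lemma cut_lipschitz eta a b : Cmod (cut eta a - cut eta b) <= Cmod (a - b).
Proof.
apply Rsqr_incr_0_var; [|apply Cmod_ge_0].
rewrite !Rsqr_pow2, !Cmod_sq.
change (Re (cut eta a - cut eta b)%C) with (Re a - Re b).
change (Im (cut eta a - cut eta b)%C) with (Rmax eta (Im a) - Rmax eta (Im b)).
change (Re (a - b)%C) with (Re a - Re b). change (Im (a - b)%C) with (Im a - Im b).
apply Rplus_le_compat_l. rewrite <- !Rsqr_pow2. apply Rsqr_le_abs_1.
unfold Rmax, Rabs. repeat destruct Rle_dec; repeat destruct Rcase_abs; lra.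
Qed.

Lemma cut_field_bounded eta h : 0 < eta -> Cmod (cut_field eta h) <= 2 / eta.
Proof.
intros He. unfold cut_field. rewrite Cmod_div2 by now apply cut_neq0.
apply Rmult_le_compat_l; [lra|]. apply Rinv_le_contravar; [assumption|now apply Cmod_cut].
Qed.

Lemma cut_field_lipschitz eta a b :
  0 < eta -> Cmod (cut_field eta a - cut_field eta b) <= 2 / eta ^ 2 * Cmod (a - b).
Proof.
intros He. unfold cut_field.
apply Rle_trans with (1 := div2_lipschitz _ _ eta He (Cmod_cut _ _ He) (Cmod_cut _ _ He)).
apply Rmult_le_compat_l; [|apply cut_lipschitz].
apply Rlt_le, Rdiv_lt_0_compat; [lra|]. now apply pow_lt.
Qed.

Lemma exp_ge_1 x : 0 <= x -> 1 <= exp x.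
Proof. intros H. pose proof (exp_ineq1_le x). lra. Qed.

Lemma exp_le_mono x y : x <= y -> exp x <= exp y.
Proof.
intros H. destruct (Rle_lt_or_eq_dec x y H) as [Hlt|E]; [|rewrite E; lra].
now apply Rlt_le, exp_increasing.
Qed.

Lemma continuous_linear (k r : R) : continuous (fun s => k * s) r.
Proof. apply continuous_mult_R; [apply continuous_const|apply continuous_id]. Qed.

Lemma is_derive_linear (k r : R) : is_derive (fun s => k * s) r k.
Proof. auto_derive; auto; ring. Qed.

Section Loewner.

Variable lam : R -> R.
Hypothesis lam_continuous : forall r, continuous lam r.

Definition traj (t : R) (u : R -> C) : Prop :=
  (forall r, contC u r) /\
  forall r, 0 < r < t -> u r <> RtoC (lam r) /\ derC u r (RtoC 2 / (u r - RtoC (lam r)))%C.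

Lemma neq_minus (a b : C) : a <> b -> (a - b)%C <> RtoC 0.
Proof.
intros H E. apply H. replace a with ((a - b) + b)%C by ring. rewrite E. ring.
Qed.

Lemma Im_pos_neq_R (a : C) (x : R) : 0 < Im a -> a <> RtoC x.
Proof. intros H E. rewrite E in H. simpl in H. lra. Qed.

Lemma traj_weaken t t' u : t' <= t -> traj t u -> traj t' u.
Proof. intros Ht [H1 H2]. split; [assumption|]. intros r Hr. apply H2; lra. Qed.

Lemma traj_cut_derC t u eta r :
  traj t u -> 0 < r < t -> eta <= Im (u r) -> derC u r (cut_field eta (u r - RtoC (lam r))%C).
Proof.
intros [_ H] Hr He. destruct (H r Hr) as [_ H2].
unfold cut_field. rewrite cut_id; [assumption|]. simpl. unfold Im in He. lra.
Qed.

Lemma solution_traj z t u :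
  0 <= t -> loewner_solution lam z t u -> traj t (fun r => u (clamp 0 t r)).
Proof.
intros Ht [H0 H]. split.
- apply contC_clamp with (D := fun r => 0 <= r <= t)
    (du := fun s => (RtoC 2 / (u s - RtoC (lam s)))%C); auto.
  + tauto.
  + intros s Hs. now apply H.
- intros r Hr. rewrite (clamp_id 0 t r) by lra.
  destruct (H r ltac:(lra)) as [H1 H2]. split; [assumption|].
  assert (Hloc : locally r (fun s => 0 <= s <= t)).
  { assert (Hd : 0 < Rmin r (t - r)) by (apply Rmin_glb_lt; lra).
    exists (mkposreal _ Hd). intros s Hs.
    change (Rabs (s - r) < Rmin r (t - r)) in Hs.
    pose proof (Rmin_l r (t - r)). pose proof (Rmin_r r (t - r)).
    apply Rabs_def2 in Hs. lra. }
  apply derC_ext with u.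
  + revert Hloc. apply filter_imp. intros s Hs. now rewrite clamp_id.
  + now apply is_derive_on_derC with (fun s => 0 <= s <= t).
Qed.

Lemma h_continuous u r : contC u r -> contC (fun s => (u s - RtoC (lam s))%C) r.
Proof. intros H. apply contC_minus; [assumption|]. now apply contC_RtoC. Qed.

Lemma solution_away z t u :
  0 <= t -> loewner_solution lam z t u ->
  exists c, 0 < c /\ forall r, 0 <= r <= t -> c <= Cmod (u r - RtoC (lam r)).
Proof.
intros Ht H. pose proof (solution_traj z t u Ht H) as [Hc _].
destruct (continuity_ab_min (fun r => Cmod (u (clamp 0 t r) - RtoC (lam r))) 0 t Ht)
  as [m [Hm1 Hm2]].
{ intros r _. apply continuity_pt_filterlim.
  apply (contC_Cmod (fun r => (u (clamp 0 t r) - RtoC (lam r))%C)).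
  now apply (h_continuous (fun r => u (clamp 0 t r))). }
exists (Cmod (u m - RtoC (lam m))). destruct H as [_ H]. split.
- apply Cmod_gt_0, neq_minus. now apply H.
- intros r Hr. specialize (Hm1 r Hr). cbv beta in Hm1. now rewrite !clamp_id in Hm1.
Qed.

Lemma traj_im_derive t u r :
  traj t u -> 0 < r < t ->
  is_derive (fun s => Im (u s)) r (- 2 * Im (u r) / Cmod (u r - RtoC (lam r)) ^ 2).
Proof.
intros [_ H] Hr. destruct (H r Hr) as [H1 [_ H2]].
rewrite Im_div2 in H2 by now apply neq_minus.
replace (Im (u r - RtoC (lam r))%C) with (Im (u r)) in H2 by (unfold Im; simpl; ring).
exact H2.
Qed.

Lemma traj_re_derive t u r :
  traj t u -> 0 < r < t ->
  is_derive (fun s => Re (u s)) r (2 * (Re (u r) - lam r) / Cmod (u r - RtoC (lam r)) ^ 2).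
Proof.
intros [_ H] Hr. destruct (H r Hr) as [H1 [H2 _]].
rewrite Re_div2 in H2 by now apply neq_minus. exact H2.
Qed.

Lemma traj_h_pos t u r : traj t u -> 0 < r < t -> 0 < Cmod (u r - RtoC (lam r)).
Proof. intros [_ H] Hr. apply Cmod_gt_0, neq_minus, H, Hr. Qed.

Lemma is_derive_sq (f : R -> R) (x l : R) :
  is_derive f x l -> is_derive (fun s => f s ^ 2) x (2 * f x * l).
Proof.
intros H. apply (is_derive_ext (fun s => f s * f s)).
{ intros s. simpl. ring. }
replace (2 * f x * l) with (l * f x + f x * l) by ring.
now apply is_derive_mult_R.
Qed.

Lemma continuous_sq (f : R -> R) (x : R) : continuous f x -> continuous (fun s => f s ^ 2) x.
Proof.
intros H. apply (continuous_ext (fun s => f s * f s)).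
{ intros s. simpl. ring. }
now apply continuous_mult_R.
Qed.

Lemma traj_im_decreasing t u a b :
  traj t u -> 0 <= a <= b -> b <= t -> (forall r, a < r < b -> 0 <= Im (u r)) ->
  Im (u b) <= Im (u a).
Proof.
intros H Hab Hb Hp.
apply (decreasing_on (fun s => Im (u s))
  (fun r => - 2 * Im (u r) / Cmod (u r - RtoC (lam r)) ^ 2)); [lra| |].
- intros r _. apply H.
- intros r Hr. split; [apply traj_im_derive with t; auto; lra|].
  specialize (Hp r Hr). pose proof (traj_h_pos t u r H ltac:(lra)) as Hh.
  assert (0 < / Cmod (u r - RtoC (lam r)) ^ 2) by now apply Rinv_0_lt_compat, pow_lt.
  unfold Rdiv. nra.
Qed.

Lemma traj_im_lower t u a b c :
  traj t u -> 0 <= a <= b -> b <= t -> 0 < c ->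
  (forall r, a < r < b -> c <= Cmod (u r - RtoC (lam r))) ->
  Im (u a) ^ 2 <= Im (u b) ^ 2 * exp (4 / c ^ 2 * (b - a)).
Proof.
intros H Hab Hb Hc Hh.
set (k := 4 / c ^ 2).
assert (HI : Im (u a) ^ 2 * exp (k * a) <= Im (u b) ^ 2 * exp (k * b)).
{ apply (increasing_on (fun s => Im (u s) ^ 2 * exp (k * s))
    (fun r => 2 * Im (u r) * (- 2 * Im (u r) / Cmod (u r - RtoC (lam r)) ^ 2) * exp (k * r)
       + Im (u r) ^ 2 * (k * exp (k * r)))); [lra| |].
  - intros r _. apply (continuous_mult_R (fun s => Im (u s) ^ 2) (fun s => exp (k * s))).
    + apply (continuous_sq (fun s => Im (u s))), H.
    + apply (ex_derive_continuous (K := R_AbsRing) (V := R_NormedModule)). auto_derive; auto.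
  - intros r Hr. split.
    + apply (is_derive_mult_R (fun s => Im (u s) ^ 2) (fun s => exp (k * s))).
      * apply (is_derive_sq (fun s => Im (u s))), traj_im_derive with t; auto; lra.
      * auto_derive; auto; ring.
    + specialize (Hh r Hr).
      assert (Hi : / Cmod (u r - RtoC (lam r)) ^ 2 <= / c ^ 2).
      { apply Rinv_le_contravar; [now apply pow_lt|]. apply pow_incr; lra. }
      pose proof (exp_pos (k * r)). pose proof (pow2_ge_0 (Im (u r))).
      unfold k, Rdiv in *.
      replace (2 * Im (u r) * (-2 * Im (u r) * / Cmod (u r - RtoC (lam r)) ^ 2) * exp (4 * / c ^ 2 * r) +
         Im (u r) ^ 2 * (4 * / c ^ 2 * exp (4 * / c ^ 2 * r)))
        with (4 * (Im (u r) ^ 2 * exp (4 * / c ^ 2 * r)) *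
               (/ c ^ 2 - / Cmod (u r - RtoC (lam r)) ^ 2)) by ring.
      assert (0 <= Im (u r) ^ 2 * exp (4 * / c ^ 2 * r)) by (apply Rmult_le_pos; lra).
      nra. }
apply Rmult_le_compat_r with (r := exp (- (k * a))) in HI; [|apply Rlt_le, exp_pos].
rewrite !Rmult_assoc, <- !exp_plus in HI.
replace (k * a + - (k * a)) with 0 in HI by ring. rewrite exp_0 in HI.
replace (k * b + - (k * a)) with (k * (b - a)) in HI by ring. lra.
Qed.

Lemma solution_im_pos z t u :
  0 <= t -> 0 < Im z -> loewner_solution lam z t u ->
  forall r, 0 <= r <= t -> 0 < Im (u r).
Proof.
intros Ht Hz H.
destruct (solution_away z t u Ht H) as [c [Hc Hh]].
pose proof (solution_traj z t u Ht H) as HT.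
assert (Hsq : forall r, 0 <= r <= t -> Im (u r) <> 0).
{ intros r Hr E.
  pose proof (traj_im_lower t _ 0 r c HT ltac:(lra) ltac:(lra) Hc) as HL.
  cbv beta in HL. rewrite !clamp_id in HL by lra. rewrite E, (proj1 H) in HL.
  assert (Hx : Im z ^ 2 <= 0 ^ 2 * exp (4 / c ^ 2 * (r - 0))).
  { apply HL. intros s Hs. rewrite clamp_id by lra. apply Hh; lra. }
  pose proof (pow_lt _ 2 Hz). lra. }
intros r Hr. destruct (Rlt_le_dec 0 (Im (u r))) as [|Hn]; [assumption|exfalso].
destruct (IVT_gen (fun s => Im (u (clamp 0 t s))) 0 r 0) as [x [Hx Ex]].
- intros s. apply continuity_pt_filterlim, HT.
- rewrite !clamp_id by lra. rewrite (proj1 H).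
  rewrite Rmin_right, Rmax_left by lra. lra.
- rewrite Rmin_left, Rmax_right in Hx by lra.
  rewrite clamp_id in Ex by lra. apply (Hsq x); [lra|assumption].
Qed.

Lemma solution_im_lower z t u :
  0 <= t -> 0 < Im z -> loewner_solution lam z t u ->
  forall r, 0 <= r <= t -> Im (u t) <= Im (u r).
Proof.
intros Ht Hz H r Hr.
pose proof (traj_im_decreasing t _ r t (solution_traj z t u Ht H) ltac:(lra) ltac:(lra)) as HD.
cbv beta in HD. rewrite !clamp_id in HD by lra. apply HD.
intros s Hs. rewrite clamp_id by lra. apply Rlt_le.
apply (solution_im_pos z t u); auto; lra.
Qed.

Lemma cut_compare eta u1 u2 a b :
  0 < eta -> a <= b ->
  (forall r, a <= r <= b -> contC u1 r /\ contC u2 r) ->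
  (forall r, a < r < b -> derC u1 r (cut_field eta (u1 r - RtoC (lam r))%C) /\
                          derC u2 r (cut_field eta (u2 r - RtoC (lam r))%C)) ->
  Cmod (u1 b - u2 b) <= exp (2 / eta ^ 2 * (b - a)) * Cmod (u1 a - u2 a).
Proof.
intros He Hab Hc Hd.
replace (2 / eta ^ 2 * (b - a)) with (2 / eta ^ 2 * b - 2 / eta ^ 2 * a) by ring.
apply (gronwall_forward (fun r => (u1 r - u2 r)%C)
  (fun r => (cut_field eta (u1 r - RtoC (lam r)) - cut_field eta (u2 r - RtoC (lam r)))%C)
  (fun r => 2 / eta ^ 2 * r) (fun _ => 2 / eta ^ 2)); [assumption| |].
- intros r Hr. destruct (Hc r Hr). split; [now apply contC_minus|apply continuous_linear].
- intros r Hr. destruct (Hd r Hr). split; [now apply derC_minus|].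
  split; [apply is_derive_linear|].
  apply Rle_trans with (1 := cut_field_lipschitz eta _ _ He).
  right. do 2 f_equal. ring.
Qed.

Lemma traj_compare t u1 u2 a b c :
  traj t u1 -> traj t u2 -> 0 <= a <= b -> b <= t -> 0 < c ->
  (forall r, a < r < b -> c <= Cmod (u1 r - RtoC (lam r)) /\ c <= Cmod (u2 r - RtoC (lam r))) ->
  Cmod (u1 b - u2 b) <= exp (2 / c ^ 2 * (b - a)) * Cmod (u1 a - u2 a) /\
  Cmod (u1 a - u2 a) <= exp (2 / c ^ 2 * (b - a)) * Cmod (u1 b - u2 b).
Proof.
intros [C1 D1] [C2 D2] Hab Hb Hc Hh.
replace (2 / c ^ 2 * (b - a)) with (2 / c ^ 2 * b - 2 / c ^ 2 * a) by ring.
pose (du := fun r => (RtoC 2 / (u1 r - RtoC (lam r)) - RtoC 2 / (u2 r - RtoC (lam r)))%C).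
assert (Hcc : forall r, a <= r <= b ->
  contC (fun r => (u1 r - u2 r)%C) r /\ continuous (fun r => 2 / c ^ 2 * r) r).
{ intros r Hr. split; [now apply contC_minus|apply continuous_linear]. }
assert (Hdd : forall r, a < r < b -> derC (fun r => (u1 r - u2 r)%C) r (du r) /\
  is_derive (fun r => 2 / c ^ 2 * r) r (2 / c ^ 2) /\
  Cmod (du r) <= 2 / c ^ 2 * Cmod (u1 r - u2 r)).
{ intros r Hr. destruct (D1 r ltac:(lra)), (D2 r ltac:(lra)).
  split; [now apply derC_minus|]. split; [apply is_derive_linear|].
  destruct (Hh r Hr) as [h1 h2]. unfold du.
  apply Rle_trans with (1 := div2_lipschitz _ _ c Hc h1 h2).
  right. do 2 f_equal. ring. }
split.
- exact (gronwall_forward _ du _ (fun _ => 2 / c ^ 2) a b (proj2 Hab) Hcc Hdd).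
- exact (gronwall_backward _ du _ (fun _ => 2 / c ^ 2) a b (proj2 Hab) Hcc Hdd).
Qed.

Lemma Cmod_le_0_eq (a b : C) : Cmod (a - b) <= 0 -> a = b.
Proof. intros H. apply Cmod_small_eq. intros; lra. Qed.

Lemma solution_unique z z' t u u' r0 :
  0 <= r0 <= t -> loewner_solution lam z t u -> loewner_solution lam z' t u' ->
  u r0 = u' r0 -> forall r, 0 <= r <= t -> u r = u' r.
Proof.
intros Hr0 H H' E r Hr.
assert (Ht : 0 <= t) by lra.
destruct (solution_away z t u Ht H) as [c [Hc Hh]].
destruct (solution_away z' t u' Ht H') as [c' [Hc' Hh']].
pose proof (solution_traj z t u Ht H) as HT.
pose proof (solution_traj z' t u' Ht H') as HT'.
assert (Hm : 0 < Rmin c c') by now apply Rmin_glb_lt.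
assert (Hmin : forall a b, 0 <= a <= b -> b <= t -> forall s, a < s < b ->
   Rmin c c' <= Cmod (u (clamp 0 t s) - RtoC (lam s)) /\
   Rmin c c' <= Cmod (u' (clamp 0 t s) - RtoC (lam s))).
{ intros a b Hab Hb s Hs. rewrite clamp_id by lra. split.
  - apply Rle_trans with (1 := Rmin_l _ _), Hh; lra.
  - apply Rle_trans with (1 := Rmin_r _ _), Hh'; lra. }
assert (Ez : Cmod (u r0 - u' r0) = 0).
{ rewrite E. replace (u' r0 - u' r0)%C with (RtoC 0) by ring. apply Cmod_0. }
apply Cmod_le_0_eq.
destruct (Rle_lt_dec r r0) as [Hle|Hlt].
- destruct (traj_compare t _ _ r r0 _ HT HT' ltac:(lra) ltac:(lra) Hm) as [_ HC].
  { apply Hmin; lra. }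
  cbv beta in HC. rewrite !clamp_id in HC by lra. rewrite Ez in HC. lra.
- destruct (traj_compare t _ _ r0 r _ HT HT' ltac:(lra) ltac:(lra) Hm) as [HC _].
  { apply Hmin; lra. }
  cbv beta in HC. rewrite !clamp_id in HC by lra. rewrite Ez in HC. lra.
Qed.

Lemma cut_flow eta z : 0 < eta -> exists u : R -> C,
  u 0 = z /\ (forall r, 0 <= r -> derC u r (cut_field eta (u r - RtoC (lam r))%C)).
Proof.
intros He. apply (picard (cut_field eta) lam (2 / eta ^ 2) (2 / eta) z); auto.
- apply Rdiv_lt_0_compat; [lra|now apply pow_lt].
- intros a b. now apply cut_field_lipschitz.
- intros a. now apply cut_field_bounded.
Qed.

Lemma cut_flow_solution eta z t u :
  0 < eta -> u 0 = z ->
  (forall r, 0 <= r -> derC u r (cut_field eta (u r - RtoC (lam r))%C)) ->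
  (forall r, 0 <= r <= t -> eta <= Im (u r)) ->
  loewner_solution lam z t u.
Proof.
intros He H0 Hd Hi. split; [assumption|]. intros s Hs.
specialize (Hi s Hs).
assert (Hi' : eta <= Im (u s - RtoC (lam s))%C) by (unfold Im in *; simpl; lra).
split.
- apply Im_pos_neq_R. lra.
- apply derC_is_derive_on; [assumption|].
  specialize (Hd s ltac:(lra)). unfold cut_field in Hd. now rewrite cut_id in Hd.
Qed.

Lemma cut_flow_eq_traj eta t u U r :
  0 < eta -> traj t u ->
  (forall r, 0 <= r -> derC U r (cut_field eta (U r - RtoC (lam r))%C)) ->
  U 0 = u 0 -> 0 <= r <= t -> (forall s, 0 <= s < r -> eta <= Im (u s)) -> U r = u r.
Proof.
intros He HT HU E Hr Hi. apply Cmod_le_0_eq.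
assert (HC := cut_compare eta U u 0 r He ltac:(lra)).
rewrite E in HC. replace (u 0 - u 0)%C with (RtoC 0) in HC by ring.
rewrite Cmod_0, Rmult_0_r in HC. apply HC.
- intros s Hs. split; [|apply HT].
  apply derC_contC with (1 := HU s ltac:(lra)).
- intros s Hs. split; [apply HU; lra|].
  apply traj_cut_derC with t; auto; try lra. apply Hi; lra.
Qed.

Lemma traj_solution t u eta :
  0 < eta -> 0 <= t -> traj t u -> (forall r, 0 <= r <= t -> eta <= Im (u r)) ->
  exists v, loewner_solution lam (u 0) t v /\ forall r, 0 <= r <= t -> v r = u r.
Proof.
intros He Ht HT Hi.
destruct (cut_flow eta (u 0) He) as [U [U0 HU]].
assert (HE : forall r, 0 <= r <= t -> U r = u r).
{ intros r Hr. apply (cut_flow_eq_traj eta t); auto. intros s Hs. apply Hi; lra. }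
exists U. split; [|assumption].
apply (cut_flow_solution eta); auto.
intros r Hr. rewrite HE by assumption. now apply Hi.
Qed.

Lemma alive_le z t t' :
  0 < Im z -> 0 <= t' <= t -> loewner_alive lam z t -> loewner_alive lam z t'.
Proof.
intros Hz Ht [u H].
assert (Ht0 : 0 <= t) by lra.
destruct (traj_solution t' (fun r => u (clamp 0 t r)) (Im (u t))) as [v [Hv _]].
- apply (solution_im_pos z t u); auto; lra.
- lra.
- apply traj_weaken with t; [lra|]. now apply solution_traj with z.
- intros r Hr. rewrite clamp_id by lra. apply (solution_im_lower z t u); auto; lra.
- rewrite clamp_id in Hv by lra. rewrite (proj1 H) in Hv. now exists v.
Qed.

Lemma alive_stable z t u :
  0 < Im z -> 0 <= t -> loewner_solution lam z t u ->
  exists rho eta, 0 < rho /\ 0 < eta /\ forall z', Cmod (z' - z) < rho ->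
    exists v, loewner_solution lam z' t v /\ forall r, 0 <= r <= t -> eta <= Im (v r).
Proof.
intros Hz Ht H.
pose proof (solution_im_pos z t u Ht Hz H t ltac:(lra)) as Hp.
pose proof (solution_im_lower z t u Ht Hz H) as Hl.
pose proof (solution_traj z t u Ht H) as HT.
set (eta := Im (u t) / 2). assert (He : 0 < eta) by (unfold eta; lra).
set (k := 2 / eta ^ 2).
assert (Hk : 0 < k) by (apply Rdiv_lt_0_compat; [lra|now apply pow_lt]).
exists (eta * exp (- (k * t))), eta.
split; [apply Rmult_lt_0_compat; [assumption|apply exp_pos]|].
split; [assumption|]. intros z' Hz'.
destruct (cut_flow eta z' He) as [V [V0 HV]].
assert (HVi : forall r, 0 <= r <= t -> eta <= Im (V r)).
{ intros r Hr.
  assert (HC : Cmod (V r - u r) <= eta).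
  { assert (HC := cut_compare eta V (fun r => u (clamp 0 t r)) 0 r He ltac:(lra)).
    cbv beta in HC. rewrite !clamp_id in HC by lra.
    rewrite V0, (proj1 H) in HC. fold k in HC.
    apply Rle_trans with (exp (k * (r - 0)) * Cmod (z' - z)).
    - apply HC.
      + intros s Hs. split; [apply derC_contC with (1 := HV s ltac:(lra))|apply HT].
      + intros s Hs. split; [apply HV; lra|].
        apply (traj_cut_derC t (fun r => u (clamp 0 t r))); auto; try lra.
        rewrite clamp_id by lra. specialize (Hl s ltac:(lra)). unfold eta. lra.
    - apply Rle_trans with (exp (k * t) * (eta * exp (- (k * t)))).
      + apply Rmult_le_compat; [apply Rlt_le, exp_pos|apply Cmod_ge_0| |lra].
        apply exp_le_mono. nra.
      + rewrite Rmult_comm, Rmult_assoc, <- exp_plus.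
        replace (- (k * t) + k * t) with 0 by ring. rewrite exp_0. lra. }
  pose proof (im_le_Cmod (V r - u r)%C) as HI.
  change (Im (V r - u r)%C) with (Im (V r) - Im (u r)) in HI.
  specialize (Hl r Hr). pose proof (Rabs_le_between' (Im (V r)) (Im (u r)) eta) as [HB _].
  unfold eta in *. lra. }
exists V. split; [|assumption]. now apply (cut_flow_solution eta).
Qed.

Lemma alive_extend z s :
  0 < Im z -> 0 <= s -> loewner_alive lam z s -> exists s', s < s' /\ loewner_alive lam z s'.
Proof.
intros Hz Hs [u H].
pose proof (solution_im_pos z s u Hs Hz H s ltac:(lra)) as Hp.
pose proof (solution_im_lower z s u Hs Hz H) as Hl.
set (eta := Im (u s) / 2). assert (He : 0 < eta) by (unfold eta; lra).
destruct (cut_flow eta z He) as [U [U0 HU]].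
assert (HE : forall r, 0 <= r <= s -> U r = u r).
{ intros r Hr.
  assert (HX := cut_flow_eq_traj eta s _ U r He (solution_traj z s u Hs H) HU).
  cbv beta in HX. rewrite !clamp_id in HX by lra.
  apply HX; auto.
  - now rewrite (proj1 H).
  - intros x Hx. rewrite clamp_id by lra. specialize (Hl x ltac:(lra)). unfold eta. lra. }
destruct (proj1 (contC_iff U s) (derC_contC _ _ _ (HU s Hs)) eta He) as [d [Hd D]].
exists (s + d / 2). split; [lra|]. exists U.
apply (cut_flow_solution eta); auto.
intros r Hr. destruct (Rle_lt_dec r s) as [Hle|Hlt].
- rewrite HE by lra. specialize (Hl r ltac:(lra)). unfold eta. lra.
- specialize (D r). rewrite Rabs_pos_eq in D by lra. specialize (D ltac:(lra)).
  pose proof (im_le_Cmod (U r - U s)%C) as HI.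
  change (Im (U r - U s)%C) with (Im (U r) - Im (U s)) in HI.
  rewrite (HE s) in * by lra. apply Rle_lt_trans with (2 := D) in HI.
  apply Rabs_def2 in HI. unfold eta in *. lra.
Qed.

Lemma alive_0 z : 0 < Im z -> loewner_alive lam z 0.
Proof.
intros Hz. destruct (cut_flow (Im z) z Hz) as [U [U0 HU]].
exists U. apply (cut_flow_solution (Im z)); auto.
intros r Hr. replace r with 0 by lra. rewrite U0. lra.
Qed.

Lemma alive_limit z s u eta :
  0 < s -> 0 < eta ->
  (forall r, 0 <= r < s -> loewner_solution lam z r u) ->
  (forall r, 0 <= r < s -> eta <= Im (u r)) ->
  loewner_alive lam z s.
Proof.
intros Hs He H Hi.
destruct (cut_flow eta z He) as [U [U0 HU]].
assert (HE : forall r, 0 <= r < s -> U r = u r).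
{ intros r Hr. specialize (H r Hr).
  assert (HX := cut_flow_eq_traj eta r _ U r He (solution_traj z r u (proj1 Hr) H) HU).
  cbv beta in HX. rewrite !clamp_id in HX by lra.
  apply HX; auto; try lra.
  - now rewrite (proj1 H).
  - intros x Hx. rewrite clamp_id by lra. apply Hi; lra. }
exists U. apply (cut_flow_solution eta); auto.
intros r Hr. destruct (Rlt_le_dec r s) as [Hlt|Hle].
- rewrite HE by lra. apply Hi; lra.
- replace r with s by lra. apply Rnot_lt_le. intros Hn.
  destruct (proj1 (contC_iff U s) (derC_contC _ _ _ (HU s ltac:(lra))) (eta - Im (U s)))
    as [d [Hd D]]; [lra|].
  set (x := Rmax 0 (s - d / 2)).
  assert (Hx : 0 <= x < s /\ s - x < d).
  { unfold x, Rmax. destruct Rle_dec; lra. }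
  specialize (D x). rewrite Rabs_minus_sym, Rabs_pos_eq in D by lra.
  specialize (D ltac:(lra)).
  pose proof (im_le_Cmod (U x - U s)%C) as HI.
  change (Im (U x - U s)%C) with (Im (U x) - Im (U s)) in HI.
  apply Rle_lt_trans with (2 := D) in HI. apply Rabs_def2 in HI.
  rewrite HE in HI by lra. specialize (Hi x ltac:(lra)). lra.
Qed.

End Loewner.

Lemma backward_solution (lam : R -> R) (t : R) (w : C) :
  (forall r, continuous lam r) -> 0 <= t -> 0 < Im w ->
  exists u, loewner_solution lam (u 0) t u /\ u t = w /\
    forall r, 0 <= r <= t -> Im w <= Im (u r).
Proof.
intros Hlam Ht Hw. set (eta := Im w) in *.
destruct (picard (fun h => - cut_field eta h)%C (fun s => lam (t - s))
  (2 / eta ^ 2) (2 / eta) w) as [V [V0 HV]].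
- apply Rdiv_lt_0_compat; [lra|now apply pow_lt].
- intros a b. replace (- cut_field eta a - - cut_field eta b)%C
    with (- (cut_field eta a - cut_field eta b))%C by ring.
  rewrite Cmod_opp. now apply cut_field_lipschitz.
- intros a. rewrite Cmod_opp. now apply cut_field_bounded.
- intros r. now apply continuous_reverse.
- assert (HVi : forall s, 0 <= s -> eta <= Im (V s)).
  { intros s Hs. replace eta with (Im (V 0)) by (now rewrite V0).
    apply (increasing_on (fun s => Im (V s))
      (fun s => Im (- cut_field eta (V s - RtoC (lam (t - s)%R)))%C)); auto.
    - intros r Hr. apply (derC_contC _ _ _ (HV r ltac:(lra))).
    - intros r Hr. split; [apply (HV r ltac:(lra))|].
      set (h := (V r - RtoC (lam (t - r)%R))%C).
      change (Im (- cut_field eta h)%C) with (- Im (RtoC 2 / cut eta h)%C).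
      rewrite Im_div2 by now apply cut_neq0.
      assert (0 < Im (cut eta h)).
      { simpl. apply Rlt_le_trans with (1 := Hw), Rmax_l. }
      assert (0 < / Cmod (cut eta h) ^ 2).
      { apply Rinv_0_lt_compat, pow_lt, Cmod_gt_0. now apply cut_neq0. }
      unfold Rdiv. nra. }
  exists (fun r => V (t - r)). split; [|split].
  + split; [reflexivity|]. intros s Hs.
    specialize (HVi (t - s) ltac:(lra)).
    assert (HI : eta <= Im (V (t - s)%R - RtoC (lam s))%C) by (unfold Im in *; simpl; lra).
    split; [apply Im_pos_neq_R; lra|].
    apply derC_is_derive_on; [assumption|].
    apply derC_eq with (- - cut_field eta (V (t - s)%R - RtoC (lam s)))%C.
    * apply derC_reverse. specialize (HV (t - s) ltac:(lra)).
      cbv beta in HV. now replace (t - (t - s)) with s in HV by ring.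
    * unfold cut_field. rewrite cut_id by assumption. ring.
  + now replace (t - t) with 0 by ring.
  + intros r Hr. apply HVi; lra.
Qed.

(** * Trajectories running into the singularity of the cube-root flow *)

Definition dcbrt (t : R) : R := / (3 * cbrt t ^ 2).

Lemma cbrt_0 : cbrt 0 = 0.
Proof. unfold cbrt. destruct (Rlt_dec 0 0); lra. Qed.

Lemma cbrt_pos t : 0 < t -> 0 < cbrt t.
Proof. intros H. unfold cbrt. destruct (Rlt_dec 0 t); [apply exp_pos|lra]. Qed.

Lemma cbrt_nonneg t : 0 <= cbrt t.
Proof. unfold cbrt. destruct (Rlt_dec 0 t); [apply Rlt_le, exp_pos|lra]. Qed.

Lemma cbrt_le a b : a <= b -> cbrt a <= cbrt b.
Proof.
intros H. destruct (Rlt_le_dec 0 a) as [Ha|Ha].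
- destruct (cbrt_spec a ltac:(lra)) as [A1 A2]. destruct (cbrt_spec b ltac:(lra)) as [B1 B2].
  apply Rnot_lt_le. intros Hn.
  assert (cbrt b ^ 3 < cbrt a ^ 3); [|lra].
  simpl. rewrite !Rmult_1_r. apply Rmult_le_0_lt_compat; auto.
  + now apply Rmult_le_pos.
  + apply Rmult_le_0_lt_compat; auto.
- replace (cbrt a) with 0; [apply cbrt_nonneg|].
  unfold cbrt. destruct (Rlt_dec 0 a); lra.
Qed.

Lemma dcbrt_pos t : 0 < t -> 0 < dcbrt t.
Proof.
intros H. apply Rinv_0_lt_compat. pose proof (cbrt_pos t H) as Hp.
pose proof (pow_lt _ 2 Hp). lra.
Qed.

Lemma dcbrt_le a r : 0 < a -> a <= r -> dcbrt r <= dcbrt a.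
Proof.
intros Ha Hr. pose proof (cbrt_pos a Ha). pose proof (cbrt_le a r Hr).
apply Rinv_le_contravar.
- assert (0 < cbrt a ^ 2) by (apply pow_lt; lra). lra.
- apply Rmult_le_compat_l; [lra|]. apply pow_incr; lra.
Qed.

Lemma is_derive_cbrt t : 0 < t -> is_derive cbrt t (dcbrt t).
Proof.
intros Ht.
apply (is_derive_ext_loc (fun r => Rpower r (/ 3))).
{ exists (mkposreal t Ht). intros r Hr. change (Rabs (r - t) < t) in Hr.
  apply Rabs_def2 in Hr. unfold cbrt. destruct (Rlt_dec 0 r); [reflexivity|lra]. }
replace (dcbrt t) with (/ 3 * Rpower t (/ 3 - 1)).
{ apply is_derive_Reals. now apply derivable_pt_lim_power. }
unfold dcbrt, cbrt. destruct (Rlt_dec 0 t); [|lra].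
rewrite <- Rpower_pow by apply exp_pos. rewrite Rpower_mult.
rewrite Rinv_mult, <- Rpower_Ropp. f_equal. f_equal. simpl. field.
Qed.

Lemma continuous_cbrt t : continuous cbrt t.
Proof.
destruct (Rtotal_order t 0) as [Ht|[->|Ht]].
- apply (continuous_ext_loc _ (fun _ => 0)); [|apply continuous_const].
  assert (Ht' : 0 < - t) by lra.
  exists (mkposreal _ Ht'). intros r Hr. change (Rabs (r - t) < - t) in Hr.
  apply Rabs_def2 in Hr. unfold cbrt. destruct (Rlt_dec 0 r); lra.
- apply filterlim_locally. intros [eps He].
  assert (H3 : 0 < eps ^ 3) by now apply pow_lt.
  exists (mkposreal _ H3). intros r Hr. change (Rabs (r - 0) < eps ^ 3) in Hr.
  change (Rabs (cbrt r - cbrt 0) < eps).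
  rewrite cbrt_0, Rminus_0_r, Rabs_pos_eq by apply cbrt_nonneg.
  rewrite Rminus_0_r in Hr.
  destruct (Rlt_le_dec 0 r) as [Hp|Hn].
  + destruct (cbrt_spec r ltac:(lra)) as [B1 B2].
    rewrite Rabs_pos_eq in Hr by lra.
    apply Rnot_le_lt. intros Hle. assert (eps ^ 3 <= cbrt r ^ 3); [|lra].
    apply pow_incr; lra.
  + unfold cbrt. destruct (Rlt_dec 0 r); lra.
- apply (ex_derive_continuous (K := R_AbsRing) (V := R_NormedModule)).
  exists (dcbrt t). now apply is_derive_cbrt.
Qed.

Lemma cbrt_increment a r s : 0 < a -> a <= r <= s -> cbrt s - cbrt r <= dcbrt a * (s - r).
Proof.
intros Ha Hr.
assert (H : cbrt s - dcbrt a * s <= cbrt r - dcbrt a * r); [|lra].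
apply (decreasing_on (fun r => cbrt r - dcbrt a * r) (fun r => dcbrt r - dcbrt a)); [lra| |].
- intros x _. apply continuous_minus_R; [apply continuous_cbrt|apply continuous_linear].
- intros x Hx. split.
  + apply (is_derive_minus cbrt); [apply is_derive_cbrt; lra|apply is_derive_linear].
  + pose proof (dcbrt_le a x Ha ltac:(lra)). lra.
Qed.

Definition shift (u : R -> C) (r : R) : C := (u r - RtoC (cbrt r))%C.

(* With [e > 0] this is an approximation from inside the half-plane of the
   trajectory [e = 0] that runs into the singularity at time [s]. *)
Definition tip (s e : R) (u : R -> C) : Prop :=
  traj cbrt s u /\ (forall r, 0 < r < s -> 0 < Im (u r)) /\ u s = (cbrt s, e).

Lemma shift_continuous u r : contC u r -> contC (shift u) r.
Proof. apply (h_continuous cbrt continuous_cbrt). Qed.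

Lemma Im_shift u r : Im (shift u r) = Im (u r).
Proof. unfold shift, Im; simpl. ring. Qed.

Lemma Re_shift u r : Re (shift u r) = Re (u r) - cbrt r.
Proof. reflexivity. Qed.

Lemma traj_shift_derC t u r :
  traj cbrt t u -> 0 < r < t -> derC (shift u) r (RtoC 2 / shift u r - RtoC (dcbrt r))%C.
Proof.
intros [_ H] Hr. apply derC_minus; [now apply H|].
apply derC_RtoC, is_derive_cbrt. lra.
Qed.

Lemma traj_sq_derC t u r :
  traj cbrt t u -> 0 < r < t ->
  derC (fun r => shift u r * shift u r)%C r (RtoC 4 - RtoC (2 * dcbrt r) * shift u r)%C.
Proof.
intros H Hr. pose proof (traj_shift_derC t u r H Hr) as D.
apply derC_eq with (1 := derC_mult _ _ _ _ _ D D).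
assert (shift u r <> RtoC 0) by (apply neq_minus, H, Hr).
rewrite RtoC_mult. replace (RtoC 4) with (RtoC 2 + RtoC 2)%C by (rewrite <- RtoC_plus; f_equal; ring).
field. assumption.
Qed.

Section Tip.

Variables (s e : R) (u : R -> C).
Hypothesis Htip : tip s e u.

Lemma tip_Re_lower r : 0 <= r <= s -> cbrt r <= Re (u r).
Proof.
destruct Htip as [HT [Hi Hs]]. intros Hr.
enough (cbrt r - Re (u r) <= 0) by lra.
apply (nonpos_backward (fun x => cbrt x - Re (u x))
  (fun x => dcbrt x - 2 * (Re (u x) - cbrt x) / Cmod (u x - RtoC (cbrt x)) ^ 2) r s); [lra| | |].
- intros x _. apply continuous_minus_R; [apply continuous_cbrt|exact (proj1 (proj1 HT x))].
- intros x Hx. split.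
  + apply (is_derive_minus cbrt (fun x => Re (u x))).
    * apply is_derive_cbrt; lra.
    * apply traj_re_derive with s; auto; lra.
  + intros Hp. pose proof (dcbrt_pos x ltac:(lra)).
    pose proof (traj_h_pos cbrt s u x HT ltac:(lra)) as Hh.
    assert (0 < / Cmod (u x - RtoC (cbrt x)) ^ 2) by now apply Rinv_0_lt_compat, pow_lt.
    unfold Rdiv. nra.
- rewrite Hs. simpl. lra.
Qed.

Lemma tip_Re_upper r : 0 <= r <= s -> Re (u r) <= cbrt s.
Proof.
intros Hr. assert (HR := tip_Re_lower). destruct Htip as [HT [Hi Hs]].
replace (cbrt s) with (Re (u s)) by now rewrite Hs.
apply (increasing_on (fun x => Re (u x))
  (fun x => 2 * (Re (u x) - cbrt x) / Cmod (u x - RtoC (cbrt x)) ^ 2)); [lra| |].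
- intros x _. exact (proj1 (proj1 HT x)).
- intros x Hx. split; [apply traj_re_derive with s; auto; lra|].
  pose proof (traj_h_pos cbrt s u x HT ltac:(lra)) as Hh.
  specialize (HR x ltac:(lra)).
  assert (0 < / Cmod (u x - RtoC (cbrt x)) ^ 2) by now apply Rinv_0_lt_compat, pow_lt.
  unfold Rdiv. nra.
Qed.

Lemma tip_Im_upper r : 0 <= r <= s -> Im (u r) ^ 2 <= e ^ 2 + 4 * (s - r).
Proof.
destruct Htip as [HT [Hi Hs]]. intros Hr.
assert (H : Im (u r) ^ 2 + 4 * r <= Im (u s) ^ 2 + 4 * s).
{ apply (increasing_on (fun x => Im (u x) ^ 2 + 4 * x)
    (fun x => 2 * Im (u x) * (- 2 * Im (u x) / Cmod (u x - RtoC (cbrt x)) ^ 2) + 4)); [lra| |].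
  - intros x _. apply (continuous_plus_R (fun x => Im (u x) ^ 2)); [|apply continuous_linear].
    apply (continuous_sq (fun x => Im (u x))). exact (proj2 (proj1 HT x)).
  - intros x Hx. split.
    + apply (is_derive_plus (fun x => Im (u x) ^ 2)); [|apply is_derive_linear].
      apply (is_derive_sq (fun x => Im (u x))). apply traj_im_derive with s; auto; lra.
    + pose proof (traj_h_pos cbrt s u x HT ltac:(lra)) as Hh.
      assert (Hq : 0 < Cmod (u x - RtoC (cbrt x)) ^ 2) by now apply pow_lt.
      assert (Hy : Im (u x) ^ 2 <= Cmod (u x - RtoC (cbrt x)) ^ 2).
      { rewrite Cmod_sq. change (u x - RtoC (cbrt x))%C with (shift u x).
        rewrite Im_shift. pose proof (pow2_ge_0 (Re (shift u x))). lra. }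
      apply Rmult_le_compat_r with (r := / Cmod (u x - RtoC (cbrt x)) ^ 2) in Hy;
        [|now apply Rlt_le, Rinv_0_lt_compat].
      rewrite Rinv_r in Hy by lra. unfold Rdiv. nra. }
rewrite Hs in H. simpl in *. lra.
Qed.

Lemma tip_Im_0_pos : 0 < s -> 0 < Im (u 0).
Proof.
destruct Htip as [HT [Hi Hs]]. intros Hp.
apply Rlt_le_trans with (Im (u (s / 2))); [apply Hi; lra|].
apply (traj_im_decreasing cbrt s); auto; try lra.
intros r Hr. apply Rlt_le, Hi; lra.
Qed.

Section Window.

Variable a : R.
Hypothesis Ha : 0 < a.
Hypothesis Hwin : dcbrt a ^ 2 * (s - a) <= 1.

Lemma tip_Re_window r : a <= r <= s -> 0 <= Re (shift u r) <= dcbrt a * (s - r).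
Proof.
intros Hr. rewrite Re_shift.
pose proof (tip_Re_lower r ltac:(lra)). pose proof (tip_Re_upper r ltac:(lra)).
pose proof (cbrt_increment a r s Ha Hr). lra.
Qed.

Lemma tip_Im_window r : a <= r <= s -> e ^ 2 + 2 * (s - r) <= Im (u r) ^ 2.
Proof.
intros Hr. assert (HR := tip_Re_window). destruct Htip as [HT [Hi Hs]].
assert (H : Re (shift u r) ^ 2 - Im (shift u r) ^ 2 - 2 * r
            <= Re (shift u s) ^ 2 - Im (shift u s) ^ 2 - 2 * s).
{ apply (increasing_on (fun x => Re (shift u x) ^ 2 - Im (shift u x) ^ 2 - 2 * x)
    (fun x => 2 * Re (shift u x) * (2 * Re (shift u x) / Cmod (shift u x) ^ 2 - dcbrt x)
       - 2 * Im (shift u x) * (- 2 * Im (shift u x) / Cmod (shift u x) ^ 2) - 2)); [lra| |].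
  - intros x _. destruct (shift_continuous u x (proj1 HT x)) as [C1 C2].
    apply (continuous_minus_R (fun x => Re (shift u x) ^ 2 - Im (shift u x) ^ 2));
      [|apply continuous_linear].
    apply (continuous_minus_R (fun x => Re (shift u x) ^ 2)).
    + now apply (continuous_sq (fun x => Re (shift u x))).
    + now apply (continuous_sq (fun x => Im (shift u x))).
  - intros x Hx. assert (Hx0 : 0 < x < s) by lra.
    destruct (traj_shift_derC s u x HT Hx0) as [D1 D2].
    pose proof (traj_h_pos cbrt s u x HT Hx0) as Hh. fold (shift u x) in Hh.
    assert (Hne : shift u x <> RtoC 0) by now apply Cmod_gt_0.
    replace (Re (RtoC 2 / shift u x - RtoC (dcbrt x))%C)
      with (Re (RtoC 2 / shift u x)%C - dcbrt x) in D1 by reflexivity.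
    replace (Im (RtoC 2 / shift u x - RtoC (dcbrt x))%C)
      with (Im (RtoC 2 / shift u x)%C) in D2 by (unfold Im; simpl; ring).
    rewrite Re_div2 in D1 by assumption. rewrite Im_div2 in D2 by assumption.
    split.
    + apply (is_derive_minus (fun x => Re (shift u x) ^ 2 - Im (shift u x) ^ 2));
        [|apply is_derive_linear].
      apply (is_derive_minus (fun x => Re (shift u x) ^ 2)).
      * now apply (is_derive_sq (fun x => Re (shift u x))).
      * now apply (is_derive_sq (fun x => Im (shift u x))).
    + assert (Hq : 0 < Cmod (shift u x) ^ 2) by now apply pow_lt.
      replace (2 * Re (shift u x) * (2 * Re (shift u x) / Cmod (shift u x) ^ 2 - dcbrt x)
        - 2 * Im (shift u x) * (- 2 * Im (shift u x) / Cmod (shift u x) ^ 2) - 2)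
        with (4 * (Re (shift u x) ^ 2 + Im (shift u x) ^ 2) / Cmod (shift u x) ^ 2
              - 2 * Re (shift u x) * dcbrt x - 2) by (field; lra).
      rewrite <- Cmod_sq.
      replace (4 * Cmod (shift u x) ^ 2 / Cmod (shift u x) ^ 2) with 4 by (field; lra).
      destruct (HR x ltac:(lra)) as [X1 X2].
      pose proof (dcbrt_le a x Ha ltac:(lra)). pose proof (dcbrt_pos x ltac:(lra)).
      assert (Re (shift u x) * dcbrt x <= dcbrt a * (s - x) * dcbrt a).
      { apply Rmult_le_compat; lra. }
      assert (0 <= dcbrt a ^ 2) by apply pow2_ge_0.
      nra. }
destruct (HR r Hr) as [X1 _]. rewrite Re_shift in X1.
rewrite !Im_shift, !Re_shift, Hs in H. simpl in *. nra.
Qed.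

Lemma tip_Im_sqrt r : a <= r < s -> sqrt (s - r) <= Im (u r).
Proof.
intros Hr. pose proof (tip_Im_window r ltac:(lra)) as H.
pose proof (proj1 (proj2 Htip) r ltac:(lra)) as Hp.
rewrite <- (sqrt_pow2 (Im (u r))) by lra. apply sqrt_le_1_alt.
pose proof (pow2_ge_0 e). lra.
Qed.

End Window.

End Tip.

Definition gap (u1 u2 : R -> C) (r : R) : C :=
  (shift u2 r * shift u2 r - shift u1 r * shift u1 r)%C.

Lemma gap_factor u1 u2 r :
  gap u1 u2 r = ((shift u1 r + shift u2 r) * (u2 r - u1 r))%C.
Proof. unfold gap, shift. ring. Qed.

Lemma gap_continuous u1 u2 r : contC u1 r -> contC u2 r -> contC (gap u1 u2) r.
Proof.
intros H1 H2. apply contC_minus; apply contC_mult; now apply shift_continuous.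
Qed.

Definition dgap (u1 u2 : R -> C) (r : R) : C := (RtoC (- 2 * dcbrt r) * (u2 r - u1 r))%C.

Lemma gap_derC t u1 u2 r :
  traj cbrt t u1 -> traj cbrt t u2 -> 0 < r < t -> derC (gap u1 u2) r (dgap u1 u2 r).
Proof.
intros H1 H2 Hr.
apply derC_eq with (1 := derC_minus _ _ _ _ _ (traj_sq_derC t u2 r H2 Hr) (traj_sq_derC t u1 r H1 Hr)).
unfold dgap, shift.
replace (RtoC (- 2 * dcbrt r)) with (- RtoC (2 * dcbrt r))%C; [ring|].
rewrite <- RtoC_opp. f_equal. ring.
Qed.

Section Gap.

Variables (a s1 s2 e1 e2 : R) (u1 u2 : R -> C).
Hypothesis Htip1 : tip s1 e1 u1.
Hypothesis Htip2 : tip s2 e2 u2.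
Hypothesis Ha : 0 < a.
Hypothesis Hs : s1 <= s2.
Hypothesis Hwin : dcbrt a ^ 2 * (s2 - a) <= 1.

Let L := dcbrt a.

Lemma tip_sum_lower r : a <= r < s1 -> 2 * sqrt (s1 - r) <= Cmod (shift u1 r + shift u2 r).
Proof.
intros Hr.
assert (Hw1 : dcbrt a ^ 2 * (s1 - a) <= 1).
{ apply Rle_trans with (2 := Hwin). apply Rmult_le_compat_l; [apply pow2_ge_0|lra]. }
pose proof (tip_Im_sqrt s1 e1 u1 Htip1 a Ha Hw1 r Hr).
pose proof (tip_Im_sqrt s2 e2 u2 Htip2 a Ha Hwin r ltac:(lra)).
assert (sqrt (s1 - r) <= sqrt (s2 - r)) by (apply sqrt_le_1_alt; lra).
apply Rle_trans with (2 := im_le_Cmod _).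
replace (Im (shift u1 r + shift u2 r)%C) with (Im (u1 r) + Im (u2 r))
  by (unfold shift, Im; simpl; ring).
apply Rle_trans with (2 := Rle_abs _). lra.
Qed.

Lemma dgap_bound r :
  a <= r < s1 -> Cmod (dgap u1 u2 r) <= L / sqrt (s1 - r) * Cmod (gap u1 u2 r).
Proof.
intros Hr. pose proof (tip_sum_lower r Hr) as HS.
assert (Hq : 0 < sqrt (s1 - r)) by (apply sqrt_lt_R0; lra).
rewrite gap_factor, Cmod_mult. unfold dgap. rewrite Cmod_mult, Cmod_R.
pose proof (dcbrt_le a r Ha ltac:(lra)) as Hd. pose proof (dcbrt_pos r ltac:(lra)).
rewrite Rabs_left by lra. fold L in Hd.
pose proof (Cmod_ge_0 (u2 r - u1 r)) as Hc.
apply Rle_trans with (L / sqrt (s1 - r) * (2 * sqrt (s1 - r) * Cmod (u2 r - u1 r))).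
- replace (L / sqrt (s1 - r) * (2 * sqrt (s1 - r) * Cmod (u2 r - u1 r)))
    with (2 * L * Cmod (u2 r - u1 r)) by (field; lra). nra.
- apply Rmult_le_compat_l.
  + apply Rlt_le, Rdiv_lt_0_compat; [now apply dcbrt_pos|assumption].
  + now apply Rmult_le_compat_r.
Qed.

Lemma sqrt_reverse_derive k r :
  r < s1 -> is_derive (fun r => - 2 * k * sqrt (s1 - r)) r (k / sqrt (s1 - r)).
Proof.
intros Hr. assert (Hq : 0 < sqrt (s1 - r)) by (apply sqrt_lt_R0; lra).
auto_derive; [lra|]. unfold Rminus in *. field. lra.
Qed.

Lemma sqrt_reverse_continuous k r : continuous (fun r => - 2 * k * sqrt (s1 - r)) r.
Proof.
apply (continuous_mult_R (fun _ => - 2 * k)); [apply continuous_const|].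
apply (continuous_reverse sqrt), continuous_sqrt.
Qed.

Lemma gap_traj_l : traj cbrt s1 u1.
Proof. apply Htip1. Qed.

Lemma gap_traj_r : traj cbrt s1 u2.
Proof. apply traj_weaken with s2; [assumption|apply Htip2]. Qed.

Lemma gap_bound r :
  a <= r <= s1 -> Cmod (gap u1 u2 r) <= exp (2 * L * sqrt (s1 - r)) * Cmod (gap u1 u2 s1).
Proof.
intros Hr.
replace (2 * L * sqrt (s1 - r)) with (- 2 * L * sqrt (s1 - s1) - - 2 * L * sqrt (s1 - r)).
2:{ replace (s1 - s1) with 0 by ring. rewrite sqrt_0. ring. }
apply (gronwall_backward (gap u1 u2) (dgap u1 u2) (fun r => - 2 * L * sqrt (s1 - r))
  (fun r => L / sqrt (s1 - r))); [lra| |].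
- intros x Hx. split.
  + apply gap_continuous; [apply gap_traj_l|apply gap_traj_r].
  + apply sqrt_reverse_continuous.
- intros x Hx. split; [|split].
  + apply gap_derC with s1; [apply gap_traj_l|apply gap_traj_r|lra].
  + apply sqrt_reverse_derive; lra.
  + apply dgap_bound; lra.
Qed.

Lemma gap_variation r :
  a <= r <= s1 ->
  Cmod (gap u1 u2 s1 - gap u1 u2 r)
    <= 2 * L * sqrt (s1 - r) * exp (2 * L * sqrt (s1 - r)) * Cmod (gap u1 u2 s1).
Proof.
intros Hr.
set (k := L * exp (2 * L * sqrt (s1 - r)) * Cmod (gap u1 u2 s1)).
replace (2 * L * sqrt (s1 - r) * exp (2 * L * sqrt (s1 - r)) * Cmod (gap u1 u2 s1))
  with (- 2 * k * sqrt (s1 - s1) - - 2 * k * sqrt (s1 - r)).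
2:{ replace (s1 - s1) with 0 by ring. rewrite sqrt_0. unfold k. ring. }
apply (mean_value_C (gap u1 u2) (dgap u1 u2) (fun r => - 2 * k * sqrt (s1 - r))
  (fun r => k / sqrt (s1 - r))); [lra| |].
- intros x Hx. split.
  + apply gap_continuous; [apply gap_traj_l|apply gap_traj_r].
  + apply sqrt_reverse_continuous.
- intros x Hx. split; [|split].
  + apply gap_derC with s1; [apply gap_traj_l|apply gap_traj_r|lra].
  + apply sqrt_reverse_derive; lra.
  + apply Rle_trans with (1 := dgap_bound x ltac:(lra)).
    assert (Hq : 0 < sqrt (s1 - x)) by (apply sqrt_lt_R0; lra).
    assert (HL : 0 < L) by now apply dcbrt_pos.
    replace (k / sqrt (s1 - x))
      with (L / sqrt (s1 - x) * (exp (2 * L * sqrt (s1 - r)) * Cmod (gap u1 u2 s1)))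
      by (unfold k; field; lra).
    apply Rmult_le_compat_l; [apply Rlt_le; now apply Rdiv_lt_0_compat|].
    apply Rle_trans with (1 := gap_bound x ltac:(lra)).
    apply Rmult_le_compat_r; [apply Cmod_ge_0|].
    assert (Hs' : sqrt (s1 - x) <= sqrt (s1 - r)) by (apply sqrt_le_1_alt; lra).
    apply exp_le_mono. nra.
Qed.

End Gap.

Section Death.

Variables (a s : R) (u : R -> C).
Hypothesis Htip : tip s 0 u.
Hypothesis Ha : 0 < a.
Hypothesis Hwin : dcbrt a ^ 2 * (s - a) <= 1.

Lemma tip_shift_upper r : a <= r <= s -> Cmod (shift u r) <= 3 * sqrt (s - r).
Proof.
intros Hr.
pose proof (tip_Re_window s 0 u Htip a Ha r Hr) as HX.
pose proof (tip_Im_upper s 0 u Htip r ltac:(lra)) as HY.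
assert (HL : 0 < dcbrt a) by now apply dcbrt_pos.
assert (Hq : 0 <= sqrt (s - r)) by apply sqrt_pos.
assert (Hqq : sqrt (s - r) ^ 2 = s - r) by (apply pow2_sqrt; lra).
apply Rsqr_incr_0_var; [|lra].
rewrite !Rsqr_pow2, Cmod_sq, Im_shift.
assert (Re (shift u r) ^ 2 <= (dcbrt a * (s - r)) ^ 2) by (apply pow_incr; lra).
assert ((dcbrt a * (s - r)) ^ 2 <= s - r).
{ replace ((dcbrt a * (s - r)) ^ 2) with (dcbrt a ^ 2 * (s - r) * (s - r)) by ring.
  assert (dcbrt a ^ 2 * (s - r) <= 1).
  { apply Rle_trans with (2 := Hwin). apply Rmult_le_compat_l; [apply pow2_ge_0|lra]. }
  nra. }
rewrite Rpow_mult_distr, Hqq. nra.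
Qed.

Lemma tip_sq_asymptotic r :
  a <= r <= s ->
  Cmod (shift u r * shift u r + RtoC (4 * (s - r))) <= 6 * dcbrt a * sqrt (s - r) * (s - r).
Proof.
intros Hr.
assert (HE : shift u s = RtoC 0).
{ unfold shift. rewrite (proj2 (proj2 Htip)). unfold RtoC, Cminus, Cplus, Copp; simpl. f_equal; ring. }
set (k := 6 * dcbrt a * sqrt (s - r)).
assert (H : Cmod ((shift u s * shift u s - RtoC (4 * s)) - (shift u r * shift u r - RtoC (4 * r)))
            <= k * s - k * r).
{ apply (mean_value_C (fun r => shift u r * shift u r - RtoC (4 * r))%C
    (fun r => (RtoC 4 - RtoC (2 * dcbrt r) * shift u r - RtoC 4)%C)
    (fun r => k * r) (fun _ => k)); [lra| |].
  - intros x Hx. split; [|apply continuous_linear].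
    pose proof (shift_continuous u x (proj1 (proj1 Htip) x)).
    apply contC_minus; [now apply contC_mult|]. apply contC_RtoC, continuous_linear.
  - intros x Hx. split; [|split].
    + apply derC_minus.
      * apply traj_sq_derC with s; [apply Htip|lra].
      * apply derC_RtoC, is_derive_linear.
    + apply is_derive_linear.
    + replace (RtoC 4 - RtoC (2 * dcbrt x) * shift u x - RtoC 4)%C
        with (- (RtoC (2 * dcbrt x) * shift u x))%C by ring.
      pose proof (dcbrt_pos x ltac:(lra)). pose proof (dcbrt_le a x Ha ltac:(lra)).
      rewrite Cmod_opp, Cmod_mult, Cmod_R, Rabs_pos_eq by lra.
      pose proof (tip_shift_upper x ltac:(lra)).
      assert (sqrt (s - x) <= sqrt (s - r)) by (apply sqrt_le_1_alt; lra).
      pose proof (Cmod_ge_0 (shift u x)). unfold k.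
      apply Rle_trans with (2 * dcbrt a * (3 * sqrt (s - r))); [|lra].
      apply Rmult_le_compat; lra. }
replace (k * (s - r)) with (k * s - k * r) by ring.
apply Rle_trans with (2 := H). right.
rewrite HE, <- Cmod_opp. f_equal.
rewrite !RtoC_mult, RtoC_minus. ring.
Qed.

End Death.

(** * Existence and uniqueness of the point swallowed at a given time *)

Lemma window_le A a s :
  0 < A <= a -> a <= s -> dcbrt A ^ 2 * (s - a) <= 1 -> dcbrt a ^ 2 * (s - a) <= 1.
Proof.
intros HA Has H. apply Rle_trans with (2 := H). apply Rmult_le_compat_r; [lra|].
apply pow_incr. split; [apply Rlt_le, dcbrt_pos; lra|]. apply dcbrt_le; lra.
Qed.

Lemma window_exists s : 0 < s -> exists a, 0 < a < s /\ dcbrt a ^ 2 * (s - a) <= 1.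
Proof.
intros Hs. set (A := s / 2). assert (HA : 0 < A) by (unfold A; lra).
set (k := dcbrt A ^ 2).
assert (Hk : 0 < k) by (apply pow_lt; now apply dcbrt_pos).
exists (Rmax A (s - / k)).
assert (Hi : 0 < / k) by now apply Rinv_0_lt_compat.
assert (Hm : A <= Rmax A (s - / k) < s).
{ split; [apply Rmax_l|]. apply Rmax_lub_lt; unfold A in *; lra. }
split; [lra|]. apply (window_le A); [lra|lra|]. fold k.
apply Rle_trans with (k * / k); [|right; field; lra].
apply Rmult_le_compat_l; [lra|]. pose proof (Rmax_r A (s - / k)). lra.
Qed.

Lemma traj_Cmod_lower (lam : R -> R) (u : R -> C) (r : R) : Im (u r) <= Cmod (u r - RtoC (lam r)).
Proof.
apply Rle_trans with (2 := im_le_Cmod _).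
replace (Im (u r - RtoC (lam r))%C) with (Im (u r)) by (unfold Im; simpl; ring).
apply Rle_abs.
Qed.

Lemma tip_Im_lower s e u r x :
  tip s e u -> 0 <= x <= r -> r < s -> Im (u r) <= Im (u x).
Proof.
intros [HT [Hi _]] Hx Hr. apply (traj_im_decreasing cbrt s); auto; try lra.
intros y Hy. apply Rlt_le, Hi; lra.
Qed.

Lemma tip_Im_pos s e u r : tip s e u -> 0 <= r < s -> 0 < Im (u r).
Proof.
intros H Hr. destruct (Rle_lt_or_eq_dec 0 r (proj1 Hr)) as [Hp|E].
- apply H. lra.
- rewrite <- E. apply (tip_Im_0_pos s e u H). lra.
Qed.

Lemma Im_compare t u1 u2 r c :
  traj cbrt t u1 -> traj cbrt t u2 -> 0 <= r <= t -> 0 < c ->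
  (forall x, 0 < x < r -> c <= Im (u1 x) /\ c <= Im (u2 x)) ->
  Cmod (u1 r - u2 r) <= exp (2 / c ^ 2 * r) * Cmod (u1 0 - u2 0) /\
  Cmod (u1 0 - u2 0) <= exp (2 / c ^ 2 * r) * Cmod (u1 r - u2 r).
Proof.
intros H1 H2 Hr Hc Hi.
assert (HC := traj_compare cbrt t u1 u2 0 r c H1 H2 ltac:(lra) ltac:(lra) Hc).
rewrite Rminus_0_r in HC. apply HC.
intros x Hx. destruct (Hi x Hx) as [I1 I2].
split; [apply Rle_trans with (1 := I1)|apply Rle_trans with (1 := I2)]; apply traj_Cmod_lower.
Qed.

Lemma tip_unique s u1 u2 : 0 < s -> tip s 0 u1 -> tip s 0 u2 -> u1 0 = u2 0.
Proof.
intros Hs H1 H2.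
destruct (window_exists s Hs) as [a [Ha Hw]].
assert (E0 : forall u, tip s 0 u -> shift u s = RtoC 0).
{ intros u Hu. unfold shift. rewrite (proj2 (proj2 Hu)).
  unfold RtoC, Cminus, Cplus, Copp; simpl. f_equal; ring. }
assert (Hg : Cmod (gap u1 u2 a) <= 0).
{ pose proof (gap_bound a s s 0 0 u1 u2 H1 H2 ltac:(lra) ltac:(lra) Hw a ltac:(lra)) as HG.
  unfold gap at 2 in HG. rewrite (E0 u1 H1), (E0 u2 H2) in HG.
  replace (RtoC 0 * RtoC 0 - RtoC 0 * RtoC 0)%C with (RtoC 0) in HG by ring.
  rewrite Cmod_0 in HG. lra. }
pose proof (tip_sum_lower a s s 0 0 u1 u2 H1 H2 ltac:(lra) ltac:(lra) Hw a ltac:(lra)) as HS.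
assert (Hq : 0 < sqrt (s - a)) by (apply sqrt_lt_R0; lra).
rewrite gap_factor, Cmod_mult in Hg.
assert (Ed : Cmod (u1 a - u2 a) = 0).
{ rewrite Cmod_minus_sym. pose proof (Cmod_ge_0 (u2 a - u1 a)). nra. }
set (c := Rmin (Im (u1 a)) (Im (u2 a))).
assert (Hc : 0 < c).
{ apply Rmin_glb_lt; [apply (tip_Im_pos s 0 u1)|apply (tip_Im_pos s 0 u2)]; auto; lra. }
destruct (Im_compare s u1 u2 a c) as [_ HC]; auto; try lra; try apply H1; try apply H2.
- intros x Hx. split.
  + apply Rle_trans with (1 := Rmin_l _ _). apply (tip_Im_lower s 0); auto; lra.
  + apply Rle_trans with (1 := Rmin_r _ _). apply (tip_Im_lower s 0); auto; lra.
- apply Cmod_le_0_eq. rewrite Ed in HC. lra.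
Qed.

Lemma tip_alive s u r : tip s 0 u -> 0 <= r < s -> loewner_alive cbrt (u 0) r.
Proof.
intros H Hr.
destruct (traj_solution cbrt continuous_cbrt r u (Im (u r))) as [v [Hv _]].
- now apply (tip_Im_pos s 0).
- lra.
- apply traj_weaken with s; [lra|apply H].
- intros x Hx. apply (tip_Im_lower s 0); auto; lra.
- now exists v.
Qed.

Lemma shift_tip s u : tip s 0 u -> shift u s = RtoC 0.
Proof.
intros H. unfold shift. rewrite (proj2 (proj2 H)).
unfold RtoC, Cminus, Cplus, Copp; simpl. f_equal; ring.
Qed.

Lemma tip_dead s u : 0 < s -> tip s 0 u -> ~ loewner_alive cbrt (u 0) s.
Proof.
intros Hs H [v Hv].
pose proof (solution_traj cbrt _ s v (Rlt_le _ _ Hs) Hv) as HT.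
destruct (solution_away cbrt continuous_cbrt _ s v (Rlt_le _ _ Hs) Hv) as [c [Hc Hh]].
assert (Hu0 : 0 < Im (u 0)) by (apply (tip_Im_pos s 0 u _ H); lra).
pose proof (solution_im_pos cbrt continuous_cbrt _ s v (Rlt_le _ _ Hs) Hu0 Hv s ltac:(lra)) as Hvs.
pose proof (solution_im_lower cbrt continuous_cbrt _ s v (Rlt_le _ _ Hs) Hu0 Hv) as Hvl.
destruct (proj1 (contC_iff _ _) (shift_continuous u s (proj1 (proj1 H) s)) c Hc) as [d [Hd D]].
set (r := Rmax (s / 2) (s - d / 2)).
assert (Hr : 0 < r < s /\ s - r < d).
{ unfold r, Rmax. destruct Rle_dec; lra. }
specialize (D r). rewrite Rabs_minus_sym, Rabs_pos_eq in D by lra. specialize (D (proj2 Hr)).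
rewrite (shift_tip s u H) in D.
set (m := Rmin (Im (u r)) (Im (v s))).
assert (Hm : 0 < m).
{ apply Rmin_glb_lt; [apply (tip_Im_pos s 0 u _ H); lra|assumption]. }
destruct (Im_compare s u (fun x => v (clamp 0 s x)) r m (proj1 H) HT ltac:(lra) Hm) as [HC _].
{ intros x Hx. rewrite clamp_id by lra. split.
  - apply Rle_trans with (1 := Rmin_l _ _). apply (tip_Im_lower s 0); auto; lra.
  - apply Rle_trans with (1 := Rmin_r _ _). apply Hvl; lra. }
rewrite !clamp_id in HC by lra. rewrite (proj1 Hv) in HC.
replace (u 0 - u 0)%C with (RtoC 0) in HC by ring. rewrite Cmod_0, Rmult_0_r in HC.
apply Cmod_le_0_eq in HC. specialize (Hh r ltac:(lra)). rewrite <- HC in Hh.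
replace (shift u r - RtoC 0)%C with (u r - RtoC (cbrt r))%C in D by (unfold shift; ring).
lra.
Qed.

Lemma contC_ext_loc u v r : locally r (fun x => u x = v x) -> contC u r -> contC v r.
Proof.
intros H [C1 C2]. split.
- apply (continuous_ext_loc _ (fun x => Re (u x))); [|assumption].
  revert H. apply filter_imp. intros x ->. reflexivity.
- apply (continuous_ext_loc _ (fun x => Im (u x))); [|assumption].
  revert H. apply filter_imp. intros x ->. reflexivity.
Qed.

Lemma locally_lt (x y : R) : x < y -> locally x (fun r => r < y).
Proof.
intros H. assert (Hd : 0 < y - x) by lra. exists (mkposreal _ Hd). intros r Hr.
change (Rabs (r - x) < y - x) in Hr. apply Rabs_def2 in Hr. lra.
Qed.

Section Dying.

Variables (z : C) (s : R) (u : R -> C).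
Hypothesis Hs : 0 < s.
Hypothesis Hz : 0 < Im z.
Hypothesis Hu : forall r, 0 <= r < s -> loewner_solution cbrt z r u.
Hypothesis Hdead : ~ loewner_alive cbrt z s.

Let L := dcbrt (s / 2).

(* If h stayed away from 0, the decay rate 2 / |h|^2 of log (Im u) would be
   bounded, and the solution could be continued past s. *)
Lemma dying_liminf c r0 : 0 < c -> 0 <= r0 < s -> exists r, r0 < r < s /\ Cmod (shift u r) < c.
Proof.
intros Hc Hr0. apply NNPP. intros Hn.
assert (Hlow : forall r, r0 < r < s -> c <= Cmod (shift u r)).
{ intros r Hr. apply Rnot_lt_le. intros Hlt. apply Hn. now exists r. }
apply Hdead.
assert (Hp0 : 0 < Im (u r0)).
{ apply (solution_im_pos cbrt continuous_cbrt z r0 u); auto; lra. }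
set (k := 2 / c ^ 2 * s).
assert (Hk : 0 <= k).
{ apply Rmult_le_pos; [|lra]. apply Rlt_le, Rdiv_lt_0_compat; [lra|now apply pow_lt]. }
assert (He : 0 < Im (u r0) * exp (- k)) by (apply Rmult_lt_0_compat; [assumption|apply exp_pos]).
apply (alive_limit cbrt continuous_cbrt z s u (Im (u r0) * exp (- k)) Hs He Hu).
intros r Hr.
assert (Hle1 : Im (u r0) * exp (- k) <= Im (u r0)).
{ rewrite <- (Rmult_1_r (Im (u r0))) at 2. apply Rmult_le_compat_l; [lra|].
  rewrite <- exp_0. apply exp_le_mono. lra. }
destruct (Rle_lt_dec r r0) as [Hle|Hlt].
- apply Rle_trans with (1 := Hle1).
  apply (solution_im_lower cbrt continuous_cbrt z r0 u); auto; lra.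
- pose proof (solution_traj cbrt z r u (proj1 Hr) (Hu r Hr)) as HT.
  pose proof (traj_im_lower cbrt r _ r0 r c HT ltac:(lra) ltac:(lra) Hc) as HL.
  cbv beta in HL. rewrite !clamp_id in HL by lra.
  assert (Hpr : 0 < Im (u r)).
  { apply (solution_im_pos cbrt continuous_cbrt z r u); auto; lra. }
  assert (HX : Im (u r0) ^ 2 <= Im (u r) ^ 2 * exp (2 * k)).
  { apply Rle_trans with (Im (u r) ^ 2 * exp (4 / c ^ 2 * (r - r0))).
    - apply HL. intros x Hx. rewrite clamp_id by lra. apply Hlow; lra.
    - apply Rmult_le_compat_l; [apply pow2_ge_0|]. apply exp_le_mono.
      unfold k. assert (0 < / c ^ 2) by now apply Rinv_0_lt_compat, pow_lt.
      unfold Rdiv. nra. }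
  apply Rsqr_incr_0_var; [|lra]. rewrite !Rsqr_pow2, Rpow_mult_distr.
  apply Rmult_le_compat_r with (r := exp (- (2 * k))) in HX; [|apply Rlt_le, exp_pos].
  rewrite Rmult_assoc, <- exp_plus in HX.
  replace (2 * k + - (2 * k)) with 0 in HX by ring. rewrite exp_0 in HX.
  replace (exp (- k) ^ 2) with (exp (- (2 * k))).
  2:{ simpl. rewrite Rmult_1_r, <- exp_plus. f_equal. ring. }
  lra.
Qed.

Lemma dying_sq_derivative_bound r h :
  s / 2 <= r ->
  Cmod (RtoC 4 - RtoC (2 * dcbrt r) * h) <= L * Cmod (h * h) + (4 + L).
Proof.
intros Hr.
assert (HL : dcbrt r <= L) by (apply dcbrt_le; lra).
assert (Hp : 0 < dcbrt r) by (apply dcbrt_pos; lra).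
unfold Cminus. apply Rle_trans with (1 := Cmod_triangle _ _).
rewrite Cmod_opp, !Cmod_mult, !Cmod_R, !Rabs_pos_eq by lra.
pose proof (Cmod_ge_0 h).
assert (0 <= (Cmod h - 1) ^ 2) by apply pow2_ge_0.
nra.
Qed.

Lemma dying_sq_bounded :
  exists M, 0 < M /\ forall r, s / 2 <= r < s -> Cmod (shift u r * shift u r) <= M.
Proof.
assert (HL : 0 < L) by (apply dcbrt_pos; lra).
set (Q := (Cmod (shift u (s / 2) * shift u (s / 2)) ^ 2 + (4 + L) ^ 2) * exp ((2 * L + 1) * s)).
assert (HQ : 0 < Q).
{ apply Rmult_lt_0_compat; [|apply exp_pos].
  pose proof (pow2_ge_0 (Cmod (shift u (s / 2) * shift u (s / 2)))).
  assert (0 < (4 + L) ^ 2) by (apply pow_lt; lra). lra. }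
exists (sqrt Q). split; [now apply sqrt_lt_R0|]. intros r Hr.
rewrite <- (sqrt_pow2 (Cmod _)) by apply Cmod_ge_0. apply sqrt_le_1_alt.
assert (HT := solution_traj cbrt z r u ltac:(lra) (Hu r ltac:(lra))).
set (w := fun x => u (clamp 0 r x)) in HT.
assert (Ew : forall x, 0 <= x <= r -> shift w x = shift u x).
{ intros x Hx. unfold shift, w. now rewrite clamp_id. }
rewrite <- !Ew by lra.
apply Rle_trans with ((Cmod (shift w (s / 2) * shift w (s / 2)) ^ 2 + (4 + L) ^ 2)
  * exp ((2 * L + 1) * (r - s / 2))).
- apply (gronwall_affine (fun x => shift w x * shift w x)%C
    (fun x => RtoC 4 - RtoC (2 * dcbrt x) * shift w x)%C); try lra.
  + intros x _. apply contC_mult; apply shift_continuous, HT.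
  + intros x Hx. split; [apply traj_sq_derC with r; auto; lra|]. apply dying_sq_derivative_bound; lra.
- unfold Q. rewrite !Ew by lra. apply Rmult_le_compat_l.
  + pose proof (pow2_ge_0 (Cmod (shift u (s / 2) * shift u (s / 2)))).
    pose proof (pow2_ge_0 (4 + L)). lra.
  + apply exp_le_mono. nra.
Qed.

(* h^2 is Lipschitz up to time s and comes arbitrarily close to 0, so it tends
   to 0. *)
Lemma dying_sq_small :
  exists k, 0 < k /\ forall r, s / 2 <= r < s -> Cmod (shift u r) ^ 2 <= k * (s - r).
Proof.
destruct dying_sq_bounded as [M [HM HB]].
assert (HL : 0 < L) by (apply dcbrt_pos; lra).
set (k := L * M + (4 + L)). assert (Hk : 0 < k) by (unfold k; nra).
exists k. split; [assumption|]. intros r Hr.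
apply Rnot_lt_le. intros Hn.
set (c := Rmin 1 (Cmod (shift u r) ^ 2 - k * (s - r))).
assert (Hc : 0 < c) by (apply Rmin_glb_lt; lra).
destruct (dying_liminf c r Hc ltac:(lra)) as [r' [Hr' Hr'c]].
assert (HT := solution_traj cbrt z r' u ltac:(lra) (Hu r' ltac:(lra))).
set (w := fun x => u (clamp 0 r' x)) in HT.
assert (Ew : forall x, 0 <= x <= r' -> shift w x = shift u x).
{ intros x Hx. unfold shift, w. now rewrite clamp_id. }
assert (HV : Cmod (shift w r' * shift w r' - shift w r * shift w r) <= k * r' - k * r).
{ apply (mean_value_C (fun x => shift w x * shift w x)%C
    (fun x => RtoC 4 - RtoC (2 * dcbrt x) * shift w x)%C (fun x => k * x) (fun _ => k)); [lra| |].
  - intros x _. split; [|apply continuous_linear].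
    apply contC_mult; apply shift_continuous, HT.
  - intros x Hx. split; [apply traj_sq_derC with r'; auto; lra|].
    split; [apply is_derive_linear|].
    apply Rle_trans with (1 := dying_sq_derivative_bound x (shift w x) ltac:(lra)).
    rewrite Ew by lra. specialize (HB x ltac:(lra)). unfold k. nra. }
rewrite !Ew in HV by lra.
pose proof (Cmod_minus_le (shift u r * shift u r) (shift u r' * shift u r')) as HD.
rewrite Cmod_minus_sym in HD. rewrite !Cmod_mult in HD.
assert (Cmod (shift u r') * Cmod (shift u r') < c).
{ pose proof (Rmin_l 1 (Cmod (shift u r) ^ 2 - k * (s - r))) as H1. fold c in H1.
  pose proof (Cmod_ge_0 (shift u r')). nra. }
pose proof (Rmin_r 1 (Cmod (shift u r) ^ 2 - k * (s - r))) as H2. fold c in H2.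
simpl in *. nra.
Qed.

Lemma dying_tip : exists v, tip s 0 v /\ v 0 = z.
Proof.
pose (v := fun r => if Rlt_dec r s then u (Rmax 0 r) else RtoC (cbrt r)).
assert (Hv : forall r, r < s -> v r = u (Rmax 0 r)).
{ intros r Hr. unfold v. destruct (Rlt_dec r s); [reflexivity|lra]. }
assert (Hloc : forall r, r < s -> let t := (Rmax 0 r + s) / 2 in
   0 <= t < s /\ r < t /\ locally r (fun x => u (clamp 0 t x) = v x)).
{ intros r Hr t.
  assert (Hm : 0 <= Rmax 0 r < s /\ r <= Rmax 0 r).
  { split; [split; [apply Rmax_l|now apply Rmax_lub_lt]|apply Rmax_r]. }
  assert (Ht : 0 <= t < s /\ r < t) by (unfold t; lra).
  split; [apply Ht|]. split; [apply Ht|].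
  generalize (locally_lt r t (proj2 Ht)). apply filter_imp. intros x Hx.
  rewrite Hv by lra. unfold clamp. rewrite Rmin_right by lra. reflexivity. }
assert (Hcs : forall r, s <= r -> contC v r).
{ destruct dying_sq_small as [k [Hk Hsm]]. intros r Hr.
  apply (contC_ext_loc (fun x => (v x - RtoC (cbrt x)) + RtoC (cbrt x))%C).
  { apply filter_forall. intros x. ring. }
  apply contC_plus; [|apply contC_RtoC, continuous_cbrt].
  assert (E : forall x, s <= x -> (v x - RtoC (cbrt x))%C = RtoC 0).
  { intros x Hx. unfold v. destruct (Rlt_dec x s); [lra|]. ring. }
  apply contC_iff. intros eps He. rewrite (E r) by assumption.
  exists (Rmin (s / 2) (eps ^ 2 / k)).
  split; [apply Rmin_glb_lt; [lra|apply Rdiv_lt_0_compat; [now apply pow_lt|assumption]]|].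
  intros x Hx. pose proof (Rmin_l (s / 2) (eps ^ 2 / k)). pose proof (Rmin_r (s / 2) (eps ^ 2 / k)).
  replace (v x - RtoC (cbrt x) - RtoC 0)%C with (v x - RtoC (cbrt x))%C by ring.
  destruct (Rlt_le_dec x s) as [Hlt|Hle]; [|rewrite E, Cmod_0 by assumption; assumption].
  rewrite Rabs_left in Hx by lra.
  rewrite Hv by lra. rewrite Rmax_right by lra.
  apply Rsqr_incrst_0; [|apply Cmod_ge_0|lra]. rewrite !Rsqr_pow2.
  apply Rle_lt_trans with (1 := Hsm x ltac:(lra)).
  apply Rlt_le_trans with (k * (eps ^ 2 / k)); [|right; field; lra].
  apply Rmult_lt_compat_l; lra. }
exists v. split; [split; [split|split]|].
- intros r. destruct (Rlt_le_dec r s) as [Hlt|Hle]; [|now apply Hcs].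
  destruct (Hloc r Hlt) as [H1 [H2 H3]]. revert H3. set (t := (Rmax 0 r + s) / 2) in *. intros H3.
  apply contC_ext_loc with (1 := H3).
  apply (solution_traj cbrt z t u (proj1 H1) (Hu t H1)).
- intros r Hr. rewrite Hv, Rmax_right by lra.
  destruct (Hloc r (proj2 Hr)) as [H1 [H2 H3]]. revert H3. set (t := (Rmax 0 r + s) / 2) in *. intros H3.
  destruct (proj2 (solution_traj cbrt z t u (proj1 H1) (Hu t H1)) r ltac:(lra)) as [D1 D2].
  rewrite clamp_id in D1, D2 by lra. split; [assumption|].
  now apply derC_ext with (1 := H3).
- intros r Hr. rewrite Hv, Rmax_right by lra.
  apply (solution_im_pos cbrt continuous_cbrt z r u); auto; try lra. apply Hu; lra.
- unfold v. destruct (Rlt_dec s s); [lra|reflexivity].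
- rewrite Hv, Rmax_left by lra. apply (Hu 0); lra.
Qed.

End Dying.

Lemma limC_Im_ge (v : nat -> C) (l : C) (c : R) :
  limC v l -> (forall n, c <= Im (v n)) -> c <= Im l.
Proof.
intros Hl Hc. apply Rnot_lt_le. intros Hn.
destruct (Hl (c - Im l) ltac:(lra)) as [N HN]. specialize (HN N (le_n N)). specialize (Hc N).
pose proof (im_le_Cmod (v N - l)%C) as HI.
change (Im (v N - l)%C) with (Im (v N) - Im l) in HI.
pose proof (Rle_abs (Im (v N) - Im l)). lra.
Qed.

Lemma limC_of_bound (v : nat -> C) (l : C) (w : nat -> C) (m : C) (B : R) :
  limC w m -> (forall n, Cmod (v n - l) <= B * Cmod (w n - m)) -> limC v l.
Proof.
intros Hw Hb eps He.
assert (HB : 0 < Rabs B + 1) by (pose proof (Rabs_pos B); lra).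
destruct (Hw (eps / (Rabs B + 1))) as [N HN]; [now apply Rdiv_lt_0_compat|].
exists N. intros n Hn. specialize (HN n Hn). apply Rle_lt_trans with (1 := Hb n).
apply Rmult_lt_compat_r with (r := Rabs B + 1) in HN; [|assumption].
unfold Rdiv in HN. rewrite Rmult_assoc, Rinv_l in HN by lra.
pose proof (Rle_abs B). pose proof (Cmod_ge_0 (w n - m)). nra.
Qed.

Lemma inv_INR_small eps : 0 < eps -> exists N, forall n, (N <= n)%nat -> / (INR n + 1) < eps.
Proof.
intros He. destruct (archimed_cor1 eps He) as [N [HN Hp]]. exists N. intros n Hn.
apply Rle_lt_trans with (2 := HN). apply Rinv_le_contravar; [now apply lt_0_INR|].
apply le_INR in Hn. lra.
Qed.

Section Existence.

Variable s : R.
Hypothesis Hs : 0 < s.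
Variable U : nat -> R -> C.

Let e (n : nat) : R := / (INR n + 1).

Hypothesis HU : forall n, loewner_solution cbrt (U n 0) s (U n).
Hypothesis HUs : forall n, U n s = (cbrt s, e n).
Hypothesis HUi : forall n r, 0 <= r <= s -> e n <= Im (U n r).

Let approx (n : nat) : R -> C := fun r => U n (clamp 0 s r).

Lemma approx_height_pos n : 0 < e n.
Proof. apply Rinv_0_lt_compat. pose proof (pos_INR n). lra. Qed.

Lemma approx_tip n : tip s (e n) (approx n).
Proof.
split; [|split].
- apply (solution_traj cbrt (U n 0)); [lra|apply HU].
- intros r Hr. unfold approx. rewrite clamp_id by lra.
  pose proof (HUi n r ltac:(lra)). pose proof (approx_height_pos n). lra.
- unfold approx. rewrite clamp_id by lra. apply HUs.
Qed.

Variable a : R.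
Hypothesis Ha : 0 < a < s.
Hypothesis Hwin : dcbrt a ^ 2 * (s - a) <= 1.

Lemma approx_cauchy r : a <= r < s -> exists w, limC (fun n => approx n r) w.
Proof.
intros Hr. apply limC_cauchy. intros eps He.
assert (Hq : 0 < sqrt (s - r)) by (apply sqrt_lt_R0; lra).
set (E := exp (2 * dcbrt a * sqrt (s - r))). assert (HE : 0 < E) by apply exp_pos.
assert (Hd : forall n m, Cmod (approx n r - approx m r) <= E / (2 * sqrt (s - r)) * Rabs (e n ^ 2 - e m ^ 2)).
{ intros n m.
  pose proof (gap_bound a s s _ _ _ _ (approx_tip m) (approx_tip n) (proj1 Ha) ltac:(lra) Hwin r ltac:(lra)) as HG.
  pose proof (tip_sum_lower a s s _ _ _ _ (approx_tip m) (approx_tip n) (proj1 Ha) ltac:(lra) Hwin r ltac:(lra)) as HS.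
  fold E in HG. rewrite gap_factor, Cmod_mult in HG.
  assert (Eg : gap (approx m) (approx n) s = RtoC (e m ^ 2 - e n ^ 2)).
  { unfold gap, shift. rewrite (proj2 (proj2 (approx_tip n))), (proj2 (proj2 (approx_tip m))).
    unfold RtoC, Cminus, Cplus, Copp, Cmult; simpl. f_equal; ring. }
  rewrite Eg, Cmod_R in HG. rewrite Rabs_minus_sym in HG.
  pose proof (Cmod_ge_0 (approx n r - approx m r)) as Hc.
  apply Rmult_le_reg_l with (2 * sqrt (s - r)); [lra|].
  replace (2 * sqrt (s - r) * (E / (2 * sqrt (s - r)) * Rabs (e n ^ 2 - e m ^ 2)))
    with (E * Rabs (e n ^ 2 - e m ^ 2)) by (field; lra).
  apply Rle_trans with (2 := HG). now apply Rmult_le_compat_r. }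
set (B := E / (2 * sqrt (s - r))) in *.
assert (HB : 0 < B) by (apply Rdiv_lt_0_compat; lra).
destruct (inv_INR_small (Rmin 1 (eps / B))) as [N HN].
{ apply Rmin_glb_lt; [lra|]. now apply Rdiv_lt_0_compat. }
exists N. intros n m Hn Hm. apply Rle_lt_trans with (1 := Hd n m).
assert (Hsmall : forall n, (N <= n)%nat -> 0 < e n ^ 2 < eps / B).
{ intros k Hk. specialize (HN k Hk). fold (e k) in HN. pose proof (approx_height_pos k).
  pose proof (Rmin_l 1 (eps / B)). pose proof (Rmin_r 1 (eps / B)).
  split; [now apply pow_lt|]. simpl. nra. }
apply Rlt_le_trans with (B * (eps / B)); [|right; field; lra].
apply Rmult_lt_compat_l; [assumption|].
pose proof (Hsmall n Hn). pose proof (Hsmall m Hm). apply Rabs_def1; lra.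
Qed.

Lemma approx_limit_alive r : a <= r < s ->
  exists z, limC (fun n => approx n 0) z /\ 0 < Im z /\ loewner_alive cbrt z r.
Proof.
intros Hr. destruct (approx_cauchy r Hr) as [w Hw].
set (c := sqrt (s - r)). assert (Hc : 0 < c) by (apply sqrt_lt_R0; lra).
assert (HVi : forall n, c <= Im (approx n r)).
{ intros n. apply (tip_Im_sqrt s (e n) (approx n) (approx_tip n) a (proj1 Ha) Hwin r). lra. }
assert (Hwi : c <= Im w) by (apply (limC_Im_ge (fun n => approx n r)); auto).
destruct (backward_solution cbrt r w continuous_cbrt) as [B [HB1 [HB2 HB3]]]; [lra|lra|].
exists (B 0). split; [|split; [specialize (HB3 0 ltac:(lra)); lra|now exists B]].
apply limC_of_bound with (w := fun n => approx n r) (m := w) (B := exp (2 / c ^ 2 * r)); [assumption|].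
intros n.
destruct (Im_compare r (approx n) (fun x => B (clamp 0 r x)) r c) as [_ HC]; try lra.
- apply traj_weaken with s; [lra|apply approx_tip].
- apply (solution_traj cbrt (B 0)); [lra|assumption].
- intros x Hx. rewrite clamp_id by lra. split.
  + apply Rle_trans with (1 := HVi n). apply (tip_Im_lower s (e n)); [apply approx_tip|lra|lra].
  + apply Rle_trans with (1 := Hwi), HB3; lra.
- rewrite !clamp_id in HC by lra. now rewrite HB2 in HC.
Qed.

Lemma approx_limit_dead z : limC (fun n => approx n 0) z -> 0 < Im z -> ~ loewner_alive cbrt z s.
Proof.
intros Hz Hzi [u Hu].
destruct (alive_stable cbrt continuous_cbrt z s u Hzi ltac:(lra) Hu)
  as [rho [eta [Hrho [Heta H]]]].
destruct (Hz rho Hrho) as [N1 HN1].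
destruct (inv_INR_small eta Heta) as [N2 HN2].
set (n := max N1 N2).
specialize (HN1 n ltac:(unfold n; lia)). specialize (HN2 n ltac:(unfold n; lia)).
fold (e n) in HN2. unfold approx in HN1. rewrite clamp_id in HN1 by lra.
destruct (H _ HN1) as [v [Hv Hvi]].
assert (E := solution_unique cbrt continuous_cbrt _ _ s v (U n) 0 ltac:(lra) Hv (HU n)).
rewrite (proj1 Hv) in E. specialize (E eq_refl s ltac:(lra)).
specialize (Hvi s ltac:(lra)). rewrite E, HUs in Hvi. simpl in Hvi. lra.
Qed.

End Existence.

Lemma dying_point_exists s : 0 < s ->
  exists z, 0 < Im z /\ (forall r, 0 <= r < s -> loewner_alive cbrt z r) /\
    ~ loewner_alive cbrt z s.
Proof.
intros Hs.
assert (HB : forall n, exists u, loewner_solution cbrt (u 0) s u /\ u s = (cbrt s, / (INR n + 1)) /\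
    forall r, 0 <= r <= s -> / (INR n + 1) <= Im (u r)).
{ intros n. apply (backward_solution cbrt s (cbrt s, / (INR n + 1)) continuous_cbrt); [lra|].
  simpl. apply Rinv_0_lt_compat. pose proof (pos_INR n). lra. }
pose (U := fun n => proj1_sig (constructive_indefinite_description _ (HB n))).
assert (HU : forall n, loewner_solution cbrt (U n 0) s (U n) /\ U n s = (cbrt s, / (INR n + 1)) /\
    forall r, 0 <= r <= s -> / (INR n + 1) <= Im (U n r)).
{ intros n. unfold U. destruct constructive_indefinite_description as [u Hu]. exact Hu. }
assert (H1 := fun n => proj1 (HU n)). assert (H2 := fun n => proj1 (proj2 (HU n))).
assert (H3 := fun n => proj2 (proj2 (HU n))).
destruct (window_exists s Hs) as [a [Ha Hw]].
destruct (approx_limit_alive s Hs U H1 H2 H3 a Ha Hw a ltac:(lra)) as [z [Hz [Hzi Hza]]].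
exists z. split; [assumption|]. split.
- intros r Hr. destruct (Rle_lt_dec r a) as [Hle|Hlt].
  + apply (alive_le cbrt continuous_cbrt z a r); auto; lra.
  + destruct (approx_limit_alive s Hs U H1 H2 H3 a Ha Hw r ltac:(lra)) as [z' [Hz' [_ Hza']]].
    now rewrite (limC_unique _ _ _ Hz Hz').
- exact (approx_limit_dead s Hs U H1 H2 z Hz Hzi).
Qed.

Section Flow.

Variable f : C -> R -> C.
Hypothesis hf : loewner_flow cbrt f.

Lemma tip_exists s : 0 < s -> exists v, tip s 0 v.
Proof.
intros Hs. destruct (dying_point_exists s Hs) as [z [Hz [Ha Hd]]].
destruct (dying_tip z s (f z) Hs Hz) as [v [Hv _]]; auto.
- intros r Hr. apply hf; try lra. now apply Ha.
- now exists v.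
Qed.

Lemma dead_tip z t :
  0 < t -> 0 < Im z -> ~ loewner_alive cbrt z t ->
  exists s v, 0 < s <= t /\ tip s 0 v /\ v 0 = z.
Proof.
intros Ht Hz Hd.
pose (E := fun r => 0 <= r <= t /\ loewner_alive cbrt z r).
assert (HE0 : E 0) by (split; [lra|now apply alive_0; [apply continuous_cbrt|]]).
destruct (completeness E) as [s [Hub Hlub]].
{ exists t. intros r [Hr _]. lra. }
{ now exists 0. }
assert (Hst : s <= t) by (apply Hlub; intros r [Hr _]; lra).
assert (Hs0 : 0 <= s) by now apply Hub.
assert (Hlt : forall r, 0 <= r < s -> loewner_alive cbrt z r).
{ intros r Hr. apply NNPP. intros Hn. assert (s <= r); [|lra].
  apply Hlub. intros x [Hx Hax]. apply Rnot_lt_le. intros Hlt. apply Hn.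
  apply (alive_le cbrt continuous_cbrt z x); auto; lra. }
assert (Hds : ~ loewner_alive cbrt z s).
{ intros Ha. destruct (alive_extend cbrt continuous_cbrt z s Hz Hs0 Ha) as [s' [Hs' Ha']].
  destruct (Rle_lt_dec t s') as [Hle|Hlt'].
  - apply Hd. apply (alive_le cbrt continuous_cbrt z s'); auto; lra.
  - assert (s' <= s); [|lra]. apply Hub. split; [lra|assumption]. }
assert (Hsp : 0 < s).
{ destruct (Rle_lt_or_eq_dec 0 s Hs0) as [|E0]; [assumption|].
  exfalso. apply Hds. rewrite <- E0. apply HE0. }
destruct (dying_tip z s (f z) Hsp Hz) as [v [Hv Hv0]]; auto.
- intros r Hr. apply hf; try lra. now apply Hlt.
- exists s, v. auto.
Qed.

End Flow.

(** * Difference quotients of the flow *)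

Lemma Cmod_inv_le (h : C) (c : R) : 0 < c -> c <= Cmod h -> Cmod (/ h) <= / c.
Proof.
intros Hc Hh. rewrite Cmod_inv by (apply Cmod_gt_0; lra). now apply Rinv_le_contravar.
Qed.

Lemma Cmod_distinct (a b : C) : a <> b -> 0 < Cmod (b - a).
Proof. intros H. apply Cmod_gt_0, neq_minus. congruence. Qed.

Section Ratio.

Variables (b eta : R).
Hypothesis Hb : 0 <= b.
Hypothesis Heta : 0 < eta.

Let high (u : R -> C) : Prop := traj cbrt b u /\ forall r, 0 < r < b -> eta <= Im (u r).
Let ratio (u1 u2 : R -> C) (r : R) : C := ((u2 r - u1 r) / (u2 0 - u1 0))%C.
Let E := exp (2 / eta ^ 2 * b).

Lemma high_compare u1 u2 r :
  high u1 -> high u2 -> 0 <= r <= b ->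
  Cmod (u1 r - u2 r) <= E * Cmod (u1 0 - u2 0) /\ Cmod (u1 0 - u2 0) <= E * Cmod (u1 r - u2 r).
Proof.
intros [T1 I1] [T2 I2] Hr.
destruct (Im_compare b u1 u2 r eta T1 T2 Hr Heta) as [H1 H2].
{ intros x Hx. split; [apply I1|apply I2]; lra. }
assert (He : exp (2 / eta ^ 2 * r) <= E).
{ apply exp_le_mono. apply Rmult_le_compat_l; [|lra].
  apply Rlt_le, Rdiv_lt_0_compat; [lra|now apply pow_lt]. }
split; [apply Rle_trans with (1 := H1)|apply Rle_trans with (1 := H2)];
  apply Rmult_le_compat_r; auto; apply Cmod_ge_0.
Qed.

Lemma ratio_bounds u1 u2 r :
  high u1 -> high u2 -> u1 0 <> u2 0 -> 0 <= r <= b ->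
  / E <= Cmod (ratio u1 u2 r) <= E.
Proof.
intros H1 H2 Hne Hr. destruct (high_compare u1 u2 r H1 H2 Hr) as [C1 C2].
rewrite (Cmod_minus_sym (u1 0)) in C1, C2. rewrite (Cmod_minus_sym (u1 r)) in C1, C2.
pose proof (Cmod_distinct _ _ Hne) as Hp. assert (HE : 0 < E) by apply exp_pos.
unfold ratio. rewrite Cmod_div by (apply Cmod_gt_0; assumption). split.
- apply Rmult_le_reg_l with (E * Cmod (u2 0 - u1 0)); [now apply Rmult_lt_0_compat|].
  replace (E * Cmod (u2 0 - u1 0) * / E) with (Cmod (u2 0 - u1 0)) by (field; lra).
  replace (E * Cmod (u2 0 - u1 0) * (Cmod (u2 r - u1 r) / Cmod (u2 0 - u1 0)))
    with (E * Cmod (u2 r - u1 r)) by (field; lra). assumption.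
- apply Rmult_le_reg_r with (Cmod (u2 0 - u1 0)); [assumption|].
  unfold Rdiv. rewrite Rmult_assoc, Rinv_l by lra. lra.
Qed.

Lemma high_shift u r : high u -> 0 < r < b -> eta <= Cmod (shift u r).
Proof.
intros [_ Hi] Hr. apply Rle_trans with (1 := Hi r Hr). apply traj_Cmod_lower.
Qed.

Lemma derC_div u c r l : c <> RtoC 0 -> derC u r l -> derC (fun s => (u s / c)%C) r (l / c)%C.
Proof.
intros Hc H. apply derC_eq with (l * / c + u r * 0)%C; [|field; assumption].
apply (derC_mult u (fun _ => / c)%C); [assumption|apply derC_const].
Qed.

Lemma ratio_derC u1 u2 r :
  high u1 -> high u2 -> u1 0 <> u2 0 -> 0 < r < b ->
  derC (ratio u1 u2) r (- (RtoC 2 / (shift u1 r * shift u2 r)) * ratio u1 u2 r)%C.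
Proof.
intros H1 H2 Hne Hr.
assert (Hc : (u2 0 - u1 0)%C <> RtoC 0) by (apply Cmod_gt_0, Cmod_distinct, Hne).
apply derC_eq with ((RtoC 2 / shift u2 r - RtoC 2 / shift u1 r) / (u2 0 - u1 0))%C.
- apply (derC_div (fun r => (u2 r - u1 r)%C)); [assumption|].
  apply derC_minus;
    [exact (proj2 (proj2 (proj1 H2) r Hr))|exact (proj2 (proj2 (proj1 H1) r Hr))].
- pose proof (high_shift u1 r H1 Hr). pose proof (high_shift u2 r H2 Hr).
  assert (h1 : shift u1 r <> RtoC 0) by (apply Cmod_gt_0; lra).
  assert (h2 : shift u2 r <> RtoC 0) by (apply Cmod_gt_0; lra).
  unfold ratio.
  replace (u2 r - u1 r)%C with (shift u2 r - shift u1 r)%C by (unfold shift; ring).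
  field. auto.
Qed.

Lemma ratio_lipschitz :
  exists k, 0 < k /\ forall u1 u2 u3 u4 mu,
    high u1 -> high u2 -> high u3 -> high u4 -> u1 0 <> u2 0 -> u3 0 <> u4 0 ->
    Cmod (u1 0 - u3 0) <= mu -> Cmod (u2 0 - u4 0) <= mu ->
    Cmod (ratio u1 u2 b - ratio u3 u4 b) <= k * mu.
Proof.
set (X := (2 * (2 / eta ^ 2) + 1) * b).
set (A := E * (4 / eta ^ 3 * E)).
assert (HE : 0 < E) by apply exp_pos.
assert (He2 : 0 < 2 / eta ^ 2) by (apply Rdiv_lt_0_compat; [lra|now apply pow_lt]).
assert (He3 : 0 < 4 / eta ^ 3) by (apply Rdiv_lt_0_compat; [lra|now apply pow_lt]).
assert (HA : 0 < A) by (unfold A; apply Rmult_lt_0_compat; [|apply Rmult_lt_0_compat]; assumption).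
assert (HX : 1 <= exp X) by (apply exp_ge_1; unfold X; apply Rmult_le_pos; lra).
exists (A * exp X). split; [apply Rmult_lt_0_compat; [assumption|apply exp_pos]|].
intros u1 u2 u3 u4 mu H1 H2 H3 H4 N12 N34 M13 M24.
assert (Hmu : 0 <= mu) by (apply Rle_trans with (2 := M13), Cmod_ge_0).
assert (HG : Cmod (ratio u1 u2 b - ratio u3 u4 b) ^ 2 <=
  (Cmod (ratio u1 u2 0 - ratio u3 u4 0) ^ 2 + (A * mu) ^ 2) * exp ((2 * (2 / eta ^ 2) + 1) * (b - 0))).
{ apply (gronwall_affine (fun r => ratio u1 u2 r - ratio u3 u4 r)%C
    (fun r => - (RtoC 2 / (shift u1 r * shift u2 r)) * ratio u1 u2 r
      - - (RtoC 2 / (shift u3 r * shift u4 r)) * ratio u3 u4 r)%C); [lra|lra| |].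
  - intros r _. unfold ratio, Cdiv.
    apply contC_minus; apply contC_mult; try apply contC_const;
      apply contC_minus;
      [exact (proj1 (proj1 H2) r)|exact (proj1 (proj1 H1) r)|
       exact (proj1 (proj1 H4) r)|exact (proj1 (proj1 H3) r)].
  - intros r Hr. split; [apply derC_minus; now apply ratio_derC|].
    pose proof (high_shift u1 r H1 Hr) as I1. pose proof (high_shift u2 r H2 Hr) as I2.
    pose proof (high_shift u3 r H3 Hr) as I3. pose proof (high_shift u4 r H4 Hr) as I4.
    assert (h1 : shift u1 r <> RtoC 0) by (apply Cmod_gt_0; lra).
    assert (h2 : shift u2 r <> RtoC 0) by (apply Cmod_gt_0; lra).
    assert (h3 : shift u3 r <> RtoC 0) by (apply Cmod_gt_0; lra).
    assert (h4 : shift u4 r <> RtoC 0) by (apply Cmod_gt_0; lra).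
    replace (- (RtoC 2 / (shift u1 r * shift u2 r)) * ratio u1 u2 r
      - - (RtoC 2 / (shift u3 r * shift u4 r)) * ratio u3 u4 r)%C
      with (- (RtoC 2 * / shift u1 r * / shift u2 r * (ratio u1 u2 r - ratio u3 u4 r)
        + ratio u3 u4 r * (/ shift u1 r * (RtoC 2 / shift u2 r - RtoC 2 / shift u4 r)
                       + / shift u4 r * (RtoC 2 / shift u1 r - RtoC 2 / shift u3 r))))%C
      by (field; auto).
    rewrite Cmod_opp. apply Rle_trans with (1 := Cmod_triangle _ _).
    pose proof (Cmod_inv_le _ _ Heta I1) as J1. pose proof (Cmod_inv_le _ _ Heta I2) as J2.
    pose proof (Cmod_inv_le _ _ Heta I4) as J4.
    assert (Hie : 0 < / eta) by now apply Rinv_0_lt_compat.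
    apply Rplus_le_compat.
    + rewrite !Cmod_mult, Cmod_R, Rabs_pos_eq by lra.
      apply Rmult_le_compat_r; [apply Cmod_ge_0|].
      replace (2 / eta ^ 2) with (2 * / eta * / eta) by (field; lra).
      apply Rmult_le_compat; try apply Cmod_ge_0; auto.
      * apply Rmult_le_pos; [lra|apply Cmod_ge_0].
      * apply Rmult_le_compat_l; lra.
    + rewrite Cmod_mult. unfold A. rewrite Rmult_assoc.
      apply Rmult_le_compat; try apply Cmod_ge_0.
      { apply ratio_bounds; auto; lra. }
      apply Rle_trans with (1 := Cmod_triangle _ _). rewrite !Cmod_mult.
      assert (D24 : Cmod (RtoC 2 / shift u2 r - RtoC 2 / shift u4 r) <= 2 / eta ^ 2 * (E * mu)).
      { apply Rle_trans with (1 := div2_lipschitz _ _ eta Heta I2 I4).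
        apply Rmult_le_compat_l; [lra|].
        replace (shift u2 r - shift u4 r)%C with (u2 r - u4 r)%C by (unfold shift; ring).
        apply Rle_trans with (1 := proj1 (high_compare u2 u4 r H2 H4 ltac:(lra))).
        apply Rmult_le_compat_l; lra. }
      assert (D13 : Cmod (RtoC 2 / shift u1 r - RtoC 2 / shift u3 r) <= 2 / eta ^ 2 * (E * mu)).
      { apply Rle_trans with (1 := div2_lipschitz _ _ eta Heta I1 I3).
        apply Rmult_le_compat_l; [lra|].
        replace (shift u1 r - shift u3 r)%C with (u1 r - u3 r)%C by (unfold shift; ring).
        apply Rle_trans with (1 := proj1 (high_compare u1 u3 r H1 H3 ltac:(lra))).
        apply Rmult_le_compat_l; lra. }
      replace (4 / eta ^ 3 * E * mu)
        with (/ eta * (2 / eta ^ 2 * (E * mu)) + / eta * (2 / eta ^ 2 * (E * mu))) by (field; lra).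
      apply Rplus_le_compat; apply Rmult_le_compat; auto; apply Cmod_ge_0. }
assert (E1 : forall v w : R -> C, v 0 <> w 0 -> ratio v w 0 = RtoC 1).
{ intros v w Hne. unfold ratio. field. apply Cmod_gt_0, Cmod_distinct, Hne. }
rewrite !E1 in HG by assumption.
replace (RtoC 1 - RtoC 1)%C with (RtoC 0) in HG by ring. rewrite Cmod_0, Rminus_0_r in HG.
fold X in HG. apply Rsqr_incr_0_var; [|apply Rmult_le_pos; [apply Rmult_le_pos|]; lra].
rewrite !Rsqr_pow2. apply Rle_trans with (1 := HG).
replace ((A * exp X * mu) ^ 2) with ((A * mu) ^ 2 * (exp X * exp X)) by ring.
replace (0 ^ 2 + (A * mu) ^ 2) with ((A * mu) ^ 2) by ring.
apply Rmult_le_compat_l; [apply pow2_ge_0|]. nra.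
Qed.

End Ratio.

Section Conformal.

Variable f : C -> R -> C.
Hypothesis hf : loewner_flow cbrt f.
Variables (t : R) (z0 : C).
Hypothesis Ht : 0 <= t.
Hypothesis Hz0 : 0 < Im z0.
Hypothesis Halive : loewner_alive cbrt z0 t.

Lemma flow_derivable :
  ex_derive (K := C_AbsRing) (V := C_NormedModule) (fun z => f z t) z0.
Proof.
assert (H0 : loewner_solution cbrt z0 t (f z0)) by (apply hf; auto; lra).
destruct (alive_stable cbrt continuous_cbrt z0 t _ Hz0 Ht H0) as [rho [eta [Hrho [Heta Hst]]]].
pose (w := fun z r => f z (clamp 0 t r)).
assert (Hw : forall z, Cmod (z - z0) < rho ->
  (traj cbrt t (w z) /\ forall r, 0 < r < t -> eta <= Im (w z r)) /\ w z 0 = z /\ w z t = f z t).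
{ intros z Hz. destruct (Hst z Hz) as [v [Hv Hvi]].
  assert (Hiz : 0 < Im z).
  { specialize (Hvi 0 ltac:(lra)). rewrite (proj1 Hv) in Hvi. lra. }
  assert (Hfz : loewner_solution cbrt z t (f z)).
  { apply hf; auto; [lra|now exists v]. }
  unfold w. split; [split|split].
  - now apply (solution_traj cbrt z).
  - intros r Hr. rewrite clamp_id by lra.
    rewrite (solution_unique cbrt continuous_cbrt z z t (f z) v 0); auto; try lra.
    + apply Hvi; lra.
    + now rewrite (proj1 Hfz), (proj1 Hv).
  - rewrite clamp_id by lra. apply Hfz.
  - now rewrite clamp_id by lra. }
destruct (ratio_lipschitz t eta Ht Heta) as [k [Hk HR]].
pose (q := fun z => ((f z t - f z0 t) / (z - z0))%C).
assert (Hz00 : Cmod (z0 - z0) < rho).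
{ replace (z0 - z0)%C with (RtoC 0) by ring. now rewrite Cmod_0. }
assert (Hq : forall z z', Cmod (z - z0) < rho -> Cmod (z' - z0) < rho -> z <> z0 -> z' <> z0 ->
  Cmod (q z - q z') <= k * Cmod (z - z')).
{ intros z z' Hz Hz' Hn Hn'.
  destruct (Hw z0 Hz00) as [A0 [B0 C0]]. destruct (Hw z Hz) as [A1 [B1 C1]].
  destruct (Hw z' Hz') as [A2 [B2 C2]].
  specialize (HR (w z0) (w z) (w z0) (w z') (Cmod (z - z')) A0 A1 A0 A2).
  rewrite B0, B1, B2, C0, C1, C2 in HR. apply HR; try congruence; try lra.
  replace (z0 - z0)%C with (RtoC 0) by ring. rewrite Cmod_0. apply Cmod_ge_0. }
pose (p := fun n : nat => (z0 + RtoC (Rmin 1 (rho / 2) / (INR n + 1)))%C).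
set (m := Rmin 1 (rho / 2)) in p.
assert (Hm : 0 < m <= rho / 2) by (split; [apply Rmin_glb_lt; lra|apply Rmin_r]).
assert (Hp : forall n, p n <> z0 /\ Cmod (p n - z0) <= m / (INR n + 1) /\ Cmod (p n - z0) < rho).
{ intros n. pose proof (pos_INR n).
  assert (Hi : 0 < / (INR n + 1) <= 1).
  { split; [apply Rinv_0_lt_compat; lra|]. rewrite <- Rinv_1. apply Rinv_le_contravar; lra. }
  assert (E : (p n - z0)%C = RtoC (m / (INR n + 1))) by (unfold p; ring).
  assert (0 < m / (INR n + 1)) by (apply Rdiv_lt_0_compat; lra).
  rewrite E, Cmod_R, Rabs_pos_eq by lra. split; [|split; [lra|unfold Rdiv; nra]].
  intros Hn. rewrite Hn in E. replace (z0 - z0)%C with (RtoC 0) in E by ring.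
  apply RtoC_inj in E. lra. }
assert (Hpl : limC p z0).
{ intros eps He. destruct (inv_INR_small (eps / m)) as [N HN]; [apply Rdiv_lt_0_compat; lra|].
  exists N. intros n Hn. destruct (Hp n) as [_ [Hpn _]]. apply Rle_lt_trans with (1 := Hpn).
  specialize (HN n Hn). unfold Rdiv.
  apply Rlt_le_trans with (m * (eps / m)); [apply Rmult_lt_compat_l; lra|right; field; lra]. }
destruct (limC_cauchy (fun n => q (p n))) as [l Hl].
{ intros eps He. destruct (Hpl (eps / (2 * k))) as [N HN]; [apply Rdiv_lt_0_compat; lra|].
  exists N. intros n n' Hn Hn'.
  destruct (Hp n) as [P1 [_ P2]]. destruct (Hp n') as [P1' [_ P2']].
  apply Rle_lt_trans with (1 := Hq _ _ P2 P2' P1 P1').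
  pose proof (HN n Hn). pose proof (HN n' Hn').
  pose proof (Cmod_triangle_minus (p n) z0 (p n')) as HT.
  rewrite (Cmod_minus_sym z0 (p n')) in HT.
  apply Rlt_le_trans with (k * (2 * (eps / (2 * k)))); [apply Rmult_lt_compat_l; lra|right; field; lra]. }
assert (Hlq : forall z, Cmod (z - z0) < rho -> z <> z0 -> Cmod (q z - l) <= k * Cmod (z - z0)).
{ intros z Hz Hn. apply Rnot_lt_le. intros Hlt.
  set (d := Cmod (q z - l) - k * Cmod (z - z0)) in *. assert (Hd : 0 < d) by (unfold d; lra).
  destruct (Hl (d / 2) ltac:(lra)) as [N1 HN1].
  destruct (Hpl (d / (2 * k))) as [N2 HN2]; [apply Rdiv_lt_0_compat; lra|].
  set (n := max N1 N2). specialize (HN1 n ltac:(unfold n; lia)).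
  specialize (HN2 n ltac:(unfold n; lia)). cbv beta in HN1.
  destruct (Hp n) as [P1 [_ P2]]. pose proof (Hq z (p n) Hz P2 Hn P1) as HQ.
  pose proof (Cmod_triangle_minus (q z) (q (p n)) l) as T1.
  pose proof (Cmod_triangle_minus z z0 (p n)) as T2. rewrite (Cmod_minus_sym z0 (p n)) in T2.
  assert (k * Cmod (z - p n) < k * Cmod (z - z0) + d / 2).
  { apply Rle_lt_trans with (k * (Cmod (z - z0) + Cmod (p n - z0))); [apply Rmult_le_compat_l; lra|].
    rewrite Rmult_plus_distr_l. apply Rplus_lt_compat_l.
    apply Rlt_le_trans with (k * (d / (2 * k))); [apply Rmult_lt_compat_l; lra|right; field; lra]. }
  unfold d in *. lra. }
exists l. split; [apply (is_linear_scal_l (K := C_AbsRing) (V := C_NormedModule) l)|].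
intros x Hx. apply (is_filter_lim_locally_unique (K := C_AbsRing) (V := AbsRing_NormedModule C_AbsRing)) in Hx.
subst x. intros eps.
assert (Hd : 0 < Rmin rho (eps / k) / 2).
{ apply Rdiv_lt_0_compat; [|lra]. apply Rmin_glb_lt; [assumption|].
  apply Rdiv_lt_0_compat; [apply eps|assumption]. }
exists (mkposreal _ Hd). intros z Hz.
assert (Hz' : Cmod (z - z0) < Rmin rho (eps / k)).
{ assert (Hz2 : Cmod (z - z0) < Rmin rho (eps / k) / 2) by exact Hz. lra. }
change (Cmod (f z t - f z0 t - (z - z0) * l) <= eps * Cmod (z - z0)).
pose proof (Rmin_l rho (eps / k)). pose proof (Rmin_r rho (eps / k)).
destruct (excluded_middle_informative (z = z0)) as [E|Hn].
- rewrite E. replace (f z0 t - f z0 t - (z0 - z0) * l)%C with (RtoC 0) by ring.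
  replace (z0 - z0)%C with (RtoC 0) by ring. rewrite Cmod_0. lra.
- specialize (Hlq z ltac:(lra) Hn).
  assert (Hzz : (z - z0)%C <> RtoC 0) by now apply neq_minus.
  replace (f z t - f z0 t - (z - z0) * l)%C with ((q z - l) * (z - z0))%C
    by (unfold q; field; assumption).
  rewrite Cmod_mult. apply Rmult_le_compat_r; [apply Cmod_ge_0|].
  apply Rle_trans with (1 := Hlq).
  apply Rle_trans with (k * (eps / k)); [apply Rmult_le_compat_l; lra|right; field; lra].
Qed.

End Conformal.

(** * Strict differentiability of the trace *)

Definition quotient (g : R -> C) (s1 s2 : R) : C := ((g s2 - g s1) / RtoC (s2 - s1))%C.

Lemma quotient_limit (g : R -> C) (s0 : R) :
  (forall eps, 0 < eps -> exists rho, 0 < rho /\ forall s1 s2 s3 s4,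
     s1 < s2 -> s3 < s4 -> Rabs (s1 - s0) < rho -> Rabs (s2 - s0) < rho ->
     Rabs (s3 - s0) < rho -> Rabs (s4 - s0) < rho ->
     Cmod (quotient g s1 s2 - quotient g s3 s4) <= eps) ->
  exists l, forall eps, 0 < eps -> exists rho, 0 < rho /\ forall s1 s2,
     s1 < s2 -> Rabs (s1 - s0) < rho -> Rabs (s2 - s0) < rho ->
     Cmod (quotient g s1 s2 - l) <= eps.
Proof.
intros H.
pose (v := fun n : nat => quotient g s0 (s0 + / (INR n + 1))).
assert (Hv : forall rho, 0 < rho -> exists N, forall n, (N <= n)%nat ->
  s0 < s0 + / (INR n + 1) /\ Rabs (s0 + / (INR n + 1) - s0) < rho).
{ intros rho Hrho. destruct (inv_INR_small rho Hrho) as [N HN]. exists N. intros n Hn.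
  specialize (HN n Hn). assert (0 < / (INR n + 1)).
  { apply Rinv_0_lt_compat. pose proof (pos_INR n). lra. }
  split; [lra|]. rewrite Rabs_pos_eq; lra. }
assert (Hs0 : forall rho, 0 < rho -> Rabs (s0 - s0) < rho).
{ intros rho Hrho. now rewrite Rminus_diag, Rabs_R0. }
destruct (limC_cauchy v) as [l Hl].
{ intros eps He. destruct (H (eps / 2) ltac:(lra)) as [rho [Hrho HR]].
  destruct (Hv rho Hrho) as [N HN]. exists N. intros n m Hn Hm.
  destruct (HN n Hn). destruct (HN m Hm).
  apply Rle_lt_trans with (eps / 2); [apply HR; auto|lra]. }
exists l. intros eps He. destruct (H eps He) as [rho [Hrho HR]].
exists rho. split; [assumption|]. intros s1 s2 H12 H1 H2.
rewrite Cmod_minus_sym. destruct (Hv rho Hrho) as [N HN].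
apply (limC_le v l _ eps N Hl). intros n Hn. destruct (HN n Hn). apply HR; auto.
Qed.

Section Trace.

Variable W : R -> R -> C.
Hypothesis HW : forall s, 0 < s -> tip s 0 (W s).

Let g (s : R) : C := W s 0.

Section Localised.

Variable s0 : R.
Hypothesis Hs0 : 0 < s0.

Let L := dcbrt (s0 / 2).

Section Fixed.

Variable delta : R.
Hypothesis Hdelta : 0 < delta <= s0 / 2.

Let y := L * sqrt (2 * delta).
Hypothesis Hy : 200 * y <= 1.

Let r0 := s0 - delta.
Let near (s : R) : Prop := s0 - delta / 2 <= s <= s0 + delta.

Lemma local_slope_pos : 0 < L.
Proof. apply dcbrt_pos. lra. Qed.

Lemma sqrt_delta_pos : 0 < sqrt (2 * delta).
Proof. apply sqrt_lt_R0. lra. Qed.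

Lemma local_error_pos : 0 < y.
Proof. apply Rmult_lt_0_compat; [apply local_slope_pos|apply sqrt_delta_pos]. Qed.

Lemma near_window s : near s -> dcbrt r0 ^ 2 * (s - r0) <= 1.
Proof.
intros Hs. unfold near, r0 in *.
apply (window_le (s0 / 2)); [lra|lra|]. fold L.
apply Rle_trans with (L ^ 2 * (2 * delta)).
- apply Rmult_le_compat_l; [apply pow2_ge_0|lra].
- replace (L ^ 2 * (2 * delta)) with (y ^ 2).
  + pose proof local_error_pos. simpl. nra.
  + unfold y. rewrite Rpow_mult_distr, pow2_sqrt by lra. reflexivity.
Qed.

Lemma dcbrt_base_bounds : 0 < dcbrt r0 <= L.
Proof.
split; [apply dcbrt_pos|apply dcbrt_le]; unfold r0; lra.
Qed.

Lemma gap_asymptotic s1 s2 :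
  s1 < s2 -> near s1 -> near s2 ->
  Cmod (gap (W s1) (W s2) r0 + RtoC (4 * (s2 - s1))) <= 200 * y * (s2 - s1).
Proof.
intros H12 H1 H2. pose proof (near_window s2 H2) as Hwin. unfold near in *.
assert (Hr0 : 0 < r0) by (unfold r0; lra).
assert (T1 : tip s1 0 (W s1)) by (apply HW; lra).
assert (T2 : tip s2 0 (W s2)) by (apply HW; lra).
pose proof local_error_pos as Hyp. pose proof dcbrt_base_bounds as Hd. pose proof sqrt_delta_pos as Hq.
assert (Hsq : forall x, x <= 2 * delta -> 0 <= dcbrt r0 * sqrt x <= y).
{ intros x Hx. assert (0 <= sqrt x) by apply sqrt_pos.
  assert (sqrt x <= sqrt (2 * delta)) by now apply sqrt_le_1_alt.
  unfold y. split; [apply Rmult_le_pos; lra|apply Rmult_le_compat; lra]. }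
assert (A1 : Cmod (gap (W s1) (W s2) s1 + RtoC (4 * (s2 - s1))) <= 6 * y * (s2 - s1)).
{ unfold gap. rewrite (shift_tip s1 (W s1) T1).
  replace (shift (W s2) s1 * shift (W s2) s1 - RtoC 0 * RtoC 0)%C
    with (shift (W s2) s1 * shift (W s2) s1)%C by ring.
  apply Rle_trans with (1 := tip_sq_asymptotic r0 s2 (W s2) T2 Hr0 Hwin s1 ltac:(unfold r0; lra)).
  apply Rmult_le_compat_r; [lra|].
  destruct (Hsq (s2 - s1) ltac:(lra)). lra. }
assert (A2 : Cmod (gap (W s1) (W s2) s1) <= 10 * (s2 - s1)).
{ replace (gap (W s1) (W s2) s1) with
    ((gap (W s1) (W s2) s1 + RtoC (4 * (s2 - s1))) - RtoC (4 * (s2 - s1)))%C by ring.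
  unfold Cminus. apply Rle_trans with (1 := Cmod_triangle _ _).
  rewrite Cmod_opp, Cmod_R, Rabs_pos_eq by lra. nra. }
assert (A3 : Cmod (gap (W s1) (W s2) s1 - gap (W s1) (W s2) r0) <= 180 * y * (s2 - s1)).
{ pose proof (gap_variation r0 s1 s2 0 0 (W s1) (W s2) T1 T2 Hr0 ltac:(lra) Hwin r0
    ltac:(unfold r0; lra)) as HV.
  apply Rle_trans with (1 := HV).
  destruct (Hsq (s1 - r0) ltac:(unfold r0; lra)) as [B1 B2].
  set (x := dcbrt r0 * sqrt (s1 - r0)) in *.
  replace (2 * dcbrt r0 * sqrt (s1 - r0)) with (2 * x) by (unfold x; ring).
  assert (He : exp (2 * x) <= 9).
  { apply Rle_trans with (exp (1 + 1)); [apply exp_le_mono; lra|].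
    rewrite exp_plus. pose proof exp_le_3. pose proof (exp_pos 1). nra. }
  apply Rle_trans with (2 * y * 9 * (10 * (s2 - s1))); [|lra].
  apply Rmult_le_compat; [|apply Cmod_ge_0| |assumption].
  - apply Rmult_le_pos; [lra|apply Rlt_le, exp_pos].
  - apply Rmult_le_compat; [lra|apply Rlt_le, exp_pos|lra|assumption]. }
replace (gap (W s1) (W s2) r0 + RtoC (4 * (s2 - s1)))%C
  with ((gap (W s1) (W s2) s1 + RtoC (4 * (s2 - s1)))
        - (gap (W s1) (W s2) s1 - gap (W s1) (W s2) r0))%C by ring.
unfold Cminus at 1. apply Rle_trans with (1 := Cmod_triangle _ _). rewrite Cmod_opp. nra.
Qed.

Lemma gap_size s1 s2 :
  s1 < s2 -> near s1 -> near s2 ->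
  3 * (s2 - s1) <= Cmod (gap (W s1) (W s2) r0) <= 5 * (s2 - s1).
Proof.
intros H12 H1 H2. pose proof (gap_asymptotic s1 s2 H12 H1 H2) as HA.
assert (HB : 200 * y * (s2 - s1) <= s2 - s1) by nra.
set (G := gap (W s1) (W s2) r0) in *.
pose proof (Cmod_triangle (G + RtoC (4 * (s2 - s1))) (- RtoC (4 * (s2 - s1)))) as T1.
pose proof (Cmod_triangle (G + RtoC (4 * (s2 - s1))) (- G)) as T2.
replace (G + RtoC (4 * (s2 - s1)) + - RtoC (4 * (s2 - s1)))%C with G in T1 by ring.
replace (G + RtoC (4 * (s2 - s1)) + - G)%C with (RtoC (4 * (s2 - s1))) in T2 by ring.
rewrite Cmod_opp, Cmod_R, Rabs_pos_eq in T1, T2 by lra. lra.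
Qed.

Let eta := sqrt (delta / 2).

Lemma eta_pos : 0 < eta.
Proof. apply sqrt_lt_R0. lra. Qed.

Lemma near_Im s : near s -> eta <= Im (W s r0).
Proof.
intros H. pose proof (near_window s H) as Hw. unfold near in *.
apply Rle_trans with (sqrt (s - r0)); [apply sqrt_le_1_alt; unfold r0; lra|].
apply (tip_Im_sqrt s 0 (W s)) with (a := r0); auto; try (unfold r0; lra).
apply HW. lra.
Qed.

Lemma near_high s : near s -> traj cbrt r0 (W s) /\ forall r, 0 < r < r0 -> eta <= Im (W s r).
Proof.
intros H. pose proof (near_Im s H) as HI. unfold near, r0 in *.
assert (T : tip s 0 (W s)) by (apply HW; lra). split.
- apply traj_weaken with s; [lra|apply T].
- intros r Hr. apply Rle_trans with (1 := HI). apply (tip_Im_lower s 0); auto; lra.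
Qed.

Lemma near_shift_sum s s' :
  near s -> near s' -> 2 * eta <= Cmod (shift (W s) r0 + shift (W s') r0) <= 6 * sqrt (2 * delta).
Proof.
intros H H'. split.
- apply Rle_trans with (2 := im_le_Cmod _).
  replace (Im (shift (W s) r0 + shift (W s') r0)%C) with (Im (W s r0) + Im (W s' r0))
    by (unfold shift, Im; simpl; ring).
  apply Rle_trans with (2 := Rle_abs _).
  pose proof (near_Im s H). pose proof (near_Im s' H'). lra.
- assert (Hb : forall x, near x -> Cmod (shift (W x) r0) <= 3 * sqrt (2 * delta)).
  { intros x Hx. pose proof (near_window x Hx) as Hw. unfold near in *.
    apply Rle_trans with (3 * sqrt (x - r0)).
    - apply (tip_shift_upper r0 x (W x)); auto; try (unfold r0; lra). apply HW; lra.
    - apply Rmult_le_compat_l; [lra|]. apply sqrt_le_1_alt. unfold r0; lra. }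
  apply Rle_trans with (1 := Cmod_triangle _ _). pose proof (Hb s H). pose proof (Hb s' H'). lra.
Qed.

Lemma near_lipschitz s s' :
  near s -> near s' -> Cmod (W s r0 - W s' r0) <= 5 / (2 * eta) * Rabs (s - s').
Proof.
pose proof eta_pos as He.
assert (Hlt : forall s s', s < s' -> near s -> near s' ->
  Cmod (W s r0 - W s' r0) <= 5 / (2 * eta) * (s' - s)).
{ intros x x' Hxx H H'. destruct (gap_size x x' Hxx H H') as [_ HG].
  rewrite gap_factor, Cmod_mult in HG. destruct (near_shift_sum x x' H H') as [HS _].
  rewrite Cmod_minus_sym. pose proof (Cmod_ge_0 (W x' r0 - W x r0)).
  apply Rmult_le_reg_l with (2 * eta); [lra|].
  replace (2 * eta * (5 / (2 * eta) * (x' - x))) with (5 * (x' - x)) by (field; lra).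
  apply Rle_trans with (2 := HG). now apply Rmult_le_compat_r. }
intros H H'. destruct (Rtotal_order s s') as [Hl|[->|Hl]].
- rewrite Rabs_minus_sym, Rabs_pos_eq by lra. now apply Hlt.
- replace (W s' r0 - W s' r0)%C with (RtoC 0) by ring. rewrite Cmod_0, Rminus_diag, Rabs_R0. lra.
- rewrite Cmod_minus_sym, Rabs_pos_eq by lra. now apply Hlt.
Qed.

Lemma gap_quotient :
  exists p H k, 0 < p /\ 0 < H /\ 0 < k /\
  forall s1 s2, s1 < s2 -> near s1 -> near s2 ->
    let P s1 s2 := (gap (W s1) (W s2) r0 / (g s2 - g s1))%C in
    g s1 <> g s2 /\ p <= Cmod (P s1 s2) <= H /\
    forall s3 s4 rho, s3 < s4 -> near s3 -> near s4 ->
      Rabs (s1 - s3) <= rho -> Rabs (s2 - s4) <= rho ->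
      Cmod (P s1 s2 - P s3 s4) <= k * rho.
Proof.
assert (Hr0 : 0 <= r0) by (unfold r0; lra).
pose proof eta_pos as He.
destruct (ratio_lipschitz r0 eta Hr0 He) as [kr [Hkr HR]].
set (E := exp (2 / eta ^ 2 * r0)) in *. assert (HE : 0 < E) by apply exp_pos.
set (H := 6 * sqrt (2 * delta)).
assert (HH : 0 < H) by (unfold H; pose proof sqrt_delta_pos; lra).
set (l := 5 / (2 * eta)). assert (Hl : 0 < l) by (apply Rdiv_lt_0_compat; lra).
exists (2 * eta * / E), (H * E), (H * (kr * (E * l)) + E * (l + l)).
assert (HiE : 0 < / E) by now apply Rinv_0_lt_compat.
assert (Hkl : 0 < kr * (E * l)) by (apply Rmult_lt_0_compat; [|apply Rmult_lt_0_compat]; assumption).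
split; [apply Rmult_lt_0_compat; lra|].
split; [now apply Rmult_lt_0_compat|].
split; [apply Rplus_lt_0_compat; apply Rmult_lt_0_compat; lra|].
assert (Hg : forall s s', near s -> near s' ->
  Cmod (g s - g s') <= E * Cmod (W s r0 - W s' r0) /\
  Cmod (W s r0 - W s' r0) <= E * Cmod (g s - g s')).
{ intros s s' Hs Hs'. unfold g.
  destruct (high_compare r0 eta He (W s) (W s') r0 (near_high s Hs) (near_high s' Hs') ltac:(lra)).
  split; assumption. }
assert (Hne : forall s1 s2, s1 < s2 -> near s1 -> near s2 -> g s1 <> g s2).
{ intros s1 s2 H12 H1 H2 Eg.
  destruct (Hg s1 s2 H1 H2) as [_ HG]. rewrite Eg in HG.
  replace (g s2 - g s2)%C with (RtoC 0) in HG by ring.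
  rewrite Cmod_0, Rmult_0_r in HG.
  destruct (gap_size s1 s2 H12 H1 H2) as [HS _].
  rewrite gap_factor, Cmod_mult, (Cmod_minus_sym (W s2 r0)) in HS.
  pose proof (Cmod_ge_0 (W s1 r0 - W s2 r0)).
  replace (Cmod (W s1 r0 - W s2 r0)) with 0 in HS by lra. lra. }
pose (ratio := fun s1 s2 => ((W s2 r0 - W s1 r0) / (W s2 0 - W s1 0))%C).
assert (HP : forall s1 s2, s1 < s2 -> near s1 -> near s2 ->
  (gap (W s1) (W s2) r0 / (g s2 - g s1))%C
    = ((shift (W s1) r0 + shift (W s2) r0) * ratio s1 s2)%C).
{ intros s1 s2 H12 H1 H2. rewrite gap_factor. unfold ratio. fold (g s1) (g s2).
  field. apply Cmod_gt_0, Cmod_distinct. now apply Hne. }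
assert (HRb : forall s1 s2, s1 < s2 -> near s1 -> near s2 -> / E <= Cmod (ratio s1 s2) <= E).
{ intros s1 s2 H12 H1 H2.
  apply (ratio_bounds r0 eta He (W s1) (W s2) r0 (near_high s1 H1) (near_high s2 H2)); [|lra].
  now apply Hne. }
intros s1 s2 H12 H1 H2 P.
split; [now apply Hne|]. split.
- unfold P. rewrite HP by assumption. rewrite Cmod_mult.
  destruct (near_shift_sum s1 s2 H1 H2) as [S1 S2]. destruct (HRb s1 s2 H12 H1 H2) as [R1 R2].
  split; apply Rmult_le_compat; auto; try lra; apply Cmod_ge_0.
- intros s3 s4 rho H34 H3 H4 H13 H24. unfold P. rewrite !HP by assumption.
  replace ((shift (W s1) r0 + shift (W s2) r0) * ratio s1 s2
    - (shift (W s3) r0 + shift (W s4) r0) * ratio s3 s4)%C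
    with ((shift (W s1) r0 + shift (W s2) r0) * (ratio s1 s2 - ratio s3 s4)
      + ratio s3 s4 * ((W s1 r0 - W s3 r0) + (W s2 r0 - W s4 r0)))%C by (unfold shift; ring).
  pose proof (near_lipschitz s1 s3 H1 H3) as D13. pose proof (near_lipschitz s2 s4 H2 H4) as D24.
  fold l in D13, D24.
  assert (E13 : Cmod (W s1 r0 - W s3 r0) <= l * rho).
  { apply Rle_trans with (1 := D13). apply Rmult_le_compat_l; lra. }
  assert (E24 : Cmod (W s2 r0 - W s4 r0) <= l * rho).
  { apply Rle_trans with (1 := D24). apply Rmult_le_compat_l; lra. }
  apply Rle_trans with (1 := Cmod_triangle _ _). rewrite !Cmod_mult.
  replace ((H * (kr * (E * l)) + E * (l + l)) * rho)
    with (H * (kr * (E * (l * rho))) + E * (l * rho + l * rho)) by ring.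
  apply Rplus_le_compat; apply Rmult_le_compat; try apply Cmod_ge_0.
  + apply near_shift_sum; assumption.
  + apply (HR (W s1) (W s2) (W s3) (W s4)); try (now apply near_high); try (now apply Hne).
    * apply Rle_trans with (1 := proj1 (Hg s1 s3 H1 H3)). apply Rmult_le_compat_l; lra.
    * apply Rle_trans with (1 := proj1 (Hg s2 s4 H2 H4)). apply Rmult_le_compat_l; lra.
  + now apply HRb.
  + apply Rle_trans with (1 := Cmod_triangle _ _). lra.
Qed.

Lemma quotient_estimate :
  exists m M K, 0 < m /\ 0 < M /\ 0 < K /\
  forall s1 s2, s1 < s2 -> near s1 -> near s2 ->
    m <= Cmod (quotient g s1 s2) <= M /\
    forall s3 s4 rho, s3 < s4 -> near s3 -> near s4 ->
      Rabs (s1 - s3) <= rho -> Rabs (s2 - s4) <= rho ->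
      Cmod (quotient g s1 s2 - quotient g s3 s4) <= 200 * y * Cmod (quotient g s1 s2) + K * rho.
Proof.
destruct gap_quotient as [p [H [k [Hp [HH [Hk HG]]]]]].
exists (3 / H), (5 / p), (5 * k / (p * p)).
assert (Hpp : 0 < p * p) by now apply Rmult_lt_0_compat.
split; [apply Rdiv_lt_0_compat; lra|]. split; [apply Rdiv_lt_0_compat; lra|].
split; [apply Rdiv_lt_0_compat; lra|].
pose (P := fun s1 s2 => (gap (W s1) (W s2) r0 / (g s2 - g s1))%C).
pose (N := fun s1 s2 => (gap (W s1) (W s2) r0 / RtoC (s2 - s1))%C).
assert (HN : forall s1 s2, s1 < s2 -> near s1 -> near s2 ->
  3 <= Cmod (N s1 s2) <= 5 /\ Cmod (N s1 s2 - RtoC (-4)) <= 200 * y).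
{ intros s1 s2 H12 H1 H2. destruct (gap_size s1 s2 H12 H1 H2) as [G1 G2].
  assert (Hc : RtoC (s2 - s1) <> RtoC 0) by (intros Ec; apply RtoC_inj in Ec; lra).
  split.
  - unfold N. rewrite Cmod_div, Cmod_R, Rabs_pos_eq by (auto; lra).
    split; apply Rmult_le_reg_r with (s2 - s1); try lra;
      unfold Rdiv; rewrite Rmult_assoc, Rinv_l; lra.
  - replace (N s1 s2 - RtoC (-4))%C
      with ((gap (W s1) (W s2) r0 + RtoC (4 * (s2 - s1))) / RtoC (s2 - s1))%C.
    + rewrite Cmod_div, Cmod_R, Rabs_pos_eq by (auto; lra).
      apply Rmult_le_reg_r with (s2 - s1); [lra|].
      unfold Rdiv; rewrite Rmult_assoc, Rinv_l, Rmult_1_r by lra. now apply gap_asymptotic.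
    + unfold N. rewrite RtoC_mult. replace (RtoC (-4)) with (- RtoC 4)%C.
      * field. assumption.
      * rewrite <- RtoC_opp. f_equal. }
assert (HQ : forall s1 s2, s1 < s2 -> near s1 -> near s2 ->
  P s1 s2 <> RtoC 0 /\ quotient g s1 s2 = (N s1 s2 / P s1 s2)%C).
{ intros s1 s2 H12 H1 H2. destruct (HG s1 s2 H12 H1 H2) as [Hne [[HP1 HP2] _]].
  assert (HP0 : P s1 s2 <> RtoC 0) by (apply Cmod_gt_0; unfold P; lra).
  split; [assumption|].
  assert (Hc : RtoC (s2 - s1) <> RtoC 0) by (intros Ec; apply RtoC_inj in Ec; lra).
  assert (Hgg : (g s2 - g s1)%C <> RtoC 0) by (apply Cmod_gt_0, Cmod_distinct, Hne).
  assert (Hga : gap (W s1) (W s2) r0 <> RtoC 0).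
  { apply Cmod_gt_0. pose proof (gap_size s1 s2 H12 H1 H2). lra. }
  unfold quotient, N, P. field. auto. }
intros s1 s2 H12 H1 H2.
destruct (HG s1 s2 H12 H1 H2) as [_ [[HP1 HP2] HPd]]. fold (P s1 s2) in HP1, HP2.
destruct (HN s1 s2 H12 H1 H2) as [[N1 N2] N4]. destruct (HQ s1 s2 H12 H1 H2) as [HP0 HQ12].
assert (EQ : Cmod (quotient g s1 s2) = Cmod (N s1 s2) * / Cmod (P s1 s2)).
{ rewrite HQ12. now apply Cmod_div. }
assert (HiP : / H <= / Cmod (P s1 s2) <= / p).
{ split; apply Rinv_le_contravar; lra. }
assert (HiH : 0 < / H) by now apply Rinv_0_lt_compat.
split.
- rewrite EQ. split; apply Rmult_le_compat; lra.
- intros s3 s4 rho H34 H3 H4 H13 H24.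
  specialize (HPd s3 s4 rho H34 H3 H4 H13 H24). fold (P s1 s2) (P s3 s4) in HPd.
  destruct (HG s3 s4 H34 H3 H4) as [_ [[HP3 HP4] _]]. fold (P s3 s4) in HP3, HP4.
  destruct (HN s3 s4 H34 H3 H4) as [[N3' N4'] N4'']. destruct (HQ s3 s4 H34 H3 H4) as [HP0' HQ34].
  assert (EQ34 : (quotient g s1 s2 - quotient g s3 s4
     = (N s1 s2 - N s3 s4) / P s1 s2 - N s3 s4 * (P s1 s2 - P s3 s4) / (P s1 s2 * P s3 s4))%C).
  { rewrite HQ12, HQ34. field. auto. }
  rewrite EQ34. unfold Cminus at 1. apply Rle_trans with (1 := Cmod_triangle _ _).
  rewrite Cmod_opp, !Cmod_div, !Cmod_mult by (auto; now apply Cmult_neq_0).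
  assert (HNN : Cmod (N s1 s2 - N s3 s4) <= 400 * y).
  { pose proof (Cmod_triangle_minus (N s1 s2) (RtoC (-4)) (N s3 s4)) as HT.
    rewrite (Cmod_minus_sym (RtoC (-4)) (N s3 s4)) in HT. lra. }
  pose proof local_error_pos as Hyp.
  apply Rplus_le_compat.
  + rewrite EQ. unfold Rdiv. rewrite <- Rmult_assoc. apply Rmult_le_compat_r; [lra|]. nra.
  + assert (Hr : 0 <= rho) by (apply Rle_trans with (2 := H13), Rabs_pos).
    replace (5 * k / (p * p) * rho) with (5 * (k * rho) * / (p * p)) by (field; lra).
    apply Rmult_le_compat.
    * apply Rmult_le_pos; apply Cmod_ge_0.
    * apply Rlt_le, Rinv_0_lt_compat. apply Rmult_lt_0_compat; lra.
    * apply Rmult_le_compat; auto; apply Cmod_ge_0.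
    * apply Rinv_le_contravar; [assumption|]. apply Rmult_le_compat; lra.
Qed.

End Fixed.

Lemma delta_exists (kappa d : R) :
  0 < kappa -> 0 < d ->
  exists delta, 0 < delta <= s0 / 2 /\ delta <= d /\ 200 * (L * sqrt (2 * delta)) <= kappa.
Proof.
intros Hk Hd. assert (HL : 0 < L) by apply local_slope_pos.
set (x := kappa / (200 * L)). assert (Hx : 0 < x) by (apply Rdiv_lt_0_compat; lra).
exists (Rmin (Rmin (s0 / 2) d) (x ^ 2 / 2)).
pose proof (Rmin_l (Rmin (s0 / 2) d) (x ^ 2 / 2)). pose proof (Rmin_r (Rmin (s0 / 2) d) (x ^ 2 / 2)).
pose proof (Rmin_l (s0 / 2) d). pose proof (Rmin_r (s0 / 2) d).
assert (Hx2 : 0 < x ^ 2) by now apply pow_lt.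
split; [split; [repeat apply Rmin_glb_lt; lra|lra]|]. split; [lra|].
apply Rle_trans with (200 * (L * x)); [|right; unfold x; field; lra].
apply Rmult_le_compat_l; [lra|]. apply Rmult_le_compat_l; [lra|].
apply Rle_trans with (sqrt (x ^ 2)); [apply sqrt_le_1_alt; lra|].
rewrite sqrt_pow2; lra.
Qed.

(* [delta] controls the relative error of the quotients, uniformly, and is fixed
   before the radius around [s0] is shrunk. *)
Lemma trace_strict_derivative :
  exists l, l <> RtoC 0 /\ forall eps, 0 < eps -> exists rho, 0 < rho /\ forall s1 s2,
    s1 < s2 -> Rabs (s1 - s0) < rho -> Rabs (s2 - s0) < rho ->
    Cmod (quotient g s1 s2 - l) <= eps.
Proof.
destruct (delta_exists 1 1 Rlt_0_1 Rlt_0_1) as [d1 [Hd1 [_ Hy1]]].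
destruct (quotient_estimate d1 Hd1 Hy1) as [m [M [K1 [Hm [HM [_ HQ1]]]]]].
destruct (quotient_limit g s0) as [l Hl].
{ intros eps He.
  destruct (delta_exists (Rmin 1 (eps / (2 * M))) (d1 / 2)) as [d [Hd [Hdd Hy]]].
  { apply Rmin_glb_lt; [lra|apply Rdiv_lt_0_compat; lra]. }
  { lra. }
  pose proof (Rmin_l 1 (eps / (2 * M))). pose proof (Rmin_r 1 (eps / (2 * M))).
  destruct (quotient_estimate d Hd ltac:(lra)) as [m' [M' [K [_ [_ [HK HQ]]]]]].
  set (rho := Rmin (d / 2) (eps / (4 * K))).
  assert (Hrho : 0 < rho).
  { apply Rmin_glb_lt; [lra|apply Rdiv_lt_0_compat; lra]. }
  assert (R1 : rho <= d / 2) by apply Rmin_l.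
  assert (R2 : K * (2 * rho) <= eps / 2).
  { apply Rle_trans with (K * (2 * (eps / (4 * K)))); [|right; field; lra].
    apply Rmult_le_compat_l; [lra|]. apply Rmult_le_compat_l; [lra|apply Rmin_r]. }
  exists rho. split; [assumption|]. intros s1 s2 s3 s4 H12 H34 A1 A2 A3 A4.
  apply Rabs_def2 in A1, A2, A3, A4.
  destruct (HQ1 s1 s2 H12 ltac:(lra) ltac:(lra)) as [[_ HB] _].
  destruct (HQ s1 s2 H12 ltac:(lra) ltac:(lra)) as [_ HC].
  assert (B13 : Rabs (s1 - s3) <= 2 * rho) by (apply Rabs_le; lra).
  assert (B24 : Rabs (s2 - s4) <= 2 * rho) by (apply Rabs_le; lra).
  apply Rle_trans with (1 := HC s3 s4 (2 * rho) H34 ltac:(lra) ltac:(lra) B13 B24).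
  assert (200 * (L * sqrt (2 * d)) * Cmod (quotient g s1 s2) <= eps / (2 * M) * M).
  { apply Rmult_le_compat; [|apply Cmod_ge_0|lra|assumption].
    pose proof (local_error_pos d Hd). lra. }
  replace (eps / (2 * M) * M) with (eps / 2) in * by (field; lra). lra. }
exists l. split; [|assumption].
destruct (Hl (m / 2) ltac:(lra)) as [rho [Hrho HR]].
set (x := Rmin (rho / 2) d1). assert (Hx : 0 < x) by (apply Rmin_glb_lt; lra).
assert (X1 : x <= rho / 2) by apply Rmin_l. assert (X2 : x <= d1) by apply Rmin_r.
specialize (HR s0 (s0 + x) ltac:(lra)).
rewrite Rminus_diag, Rabs_R0 in HR. specialize (HR Hrho).
replace (s0 + x - s0) with x in HR by ring. rewrite Rabs_pos_eq in HR by lra.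
specialize (HR ltac:(lra)).
destruct (HQ1 s0 (s0 + x) ltac:(lra) ltac:(lra) ltac:(lra)) as [[HB _] _].
intros E. rewrite E in HR.
replace (quotient g s0 (s0 + x) - RtoC 0)%C with (quotient g s0 (s0 + x)) in HR by ring. lra.
Qed.

End Localised.

End Trace.

Lemma continuous_on_set_intro (D : R -> Prop) (u : R -> C) :
  (forall s eps, D s -> 0 < eps -> exists d, 0 < d /\
     forall r, D r -> Rabs (r - s) < d -> Cmod (u r - u s) < eps) ->
  continuous_on_set D u.
Proof.
intros H s Hs. apply filterlim_locally. intros eps.
destruct (H s eps Hs (cond_pos eps)) as [d [Hd D1]].
exists (mkposreal d Hd). intros r Hr HDr. specialize (D1 r HDr Hr). split.
- apply Rle_lt_trans with (2 := D1). apply (re_le_Cmod (u r - u s)%C).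
- apply Rle_lt_trans with (2 := D1). apply (im_le_Cmod (u r - u s)%C).
Qed.

Lemma is_derive_on_intro (D : R -> Prop) (u : R -> C) (s : R) (l : C) :
  D s ->
  (forall eps, 0 < eps -> exists d, 0 < d /\ forall r, D r -> Rabs (r - s) < d ->
     Cmod (u r - u s - RtoC (r - s) * l) <= eps * Rabs (r - s)) ->
  is_derive_on D u s l.
Proof.
intros HD H. split.
- apply (is_linear_scal_l (K := R_AbsRing) (V := C_R_NormedModule) l).
- intros x Hx. apply (is_filter_lim_within D s x HD) in Hx. subst x.
  intros eps. destruct (H eps (cond_pos eps)) as [d [Hd D1]].
  exists (mkposreal d Hd). intros r Hr HDr. rewrite scalC, <- Cmod_norm.
  exact (D1 r HDr Hr).
Qed.

Lemma quotient_expand (g : R -> C) (l : C) (s r eps : R) :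
  (s < r -> Cmod (quotient g s r - l) <= eps) ->
  (r < s -> Cmod (quotient g r s - l) <= eps) ->
  Cmod (g r - g s - RtoC (r - s) * l) <= eps * Rabs (r - s).
Proof.
intros H1 H2. destruct (Rtotal_order s r) as [Hl|[->|Hl]].
- specialize (H1 Hl).
  assert (Hc : RtoC (r - s) <> RtoC 0) by (intros Ec; apply RtoC_inj in Ec; lra).
  replace (g r - g s - RtoC (r - s) * l)%C with ((quotient g s r - l) * RtoC (r - s))%C
    by (unfold quotient; field; assumption).
  rewrite Cmod_mult, Cmod_R. apply Rmult_le_compat_r; [apply Rabs_pos|assumption].
- replace (g r - g r - RtoC (r - r) * l)%C with (RtoC 0).
  + rewrite Cmod_0, Rminus_diag, Rabs_R0. lra.
  + rewrite Rminus_diag. ring.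
- specialize (H2 Hl).
  assert (Hc : RtoC (s - r) <> RtoC 0) by (intros Ec; apply RtoC_inj in Ec; lra).
  replace (g r - g s - RtoC (r - s) * l)%C with (- ((quotient g r s - l) * RtoC (s - r)))%C.
  + rewrite Cmod_opp, Cmod_mult, Cmod_R, (Rabs_minus_sym s).
    apply Rmult_le_compat_r; [apply Rabs_pos|assumption].
  + unfold quotient. rewrite !RtoC_minus in *. field. assumption.
Qed.

Theorem theorem1 (f : C -> R -> C) (hf : loewner_flow cbrt f) :
  exists (T : R) (gamma : R -> C),
    0 < T /\
    gamma 0 = RtoC 0 /\
    forall t : R, 0 < t < T ->
      jordan_arc_from_real_axis gamma t /\
      (forall z : C,
         loewner_hull cbrt t z <-> upper_half_plane z /\ arc gamma t z) /\
      conformal_map_onto (slit_domain gamma t) upper_half_plane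
        (fun z => f z t) /\
      regular_C1_curve_on (fun s => 0 < s <= t) gamma.
Proof.
assert (HWex : forall s, exists v, 0 < s -> tip s 0 v).
{ intros s. destruct (Rlt_le_dec 0 s) as [Hs|Hs].
  - destruct (tip_exists f hf s Hs) as [v Hv]. now exists v.
  - exists (fun _ => RtoC 0). intros; lra. }
pose (W := fun s => proj1_sig (constructive_indefinite_description _ (HWex s))).
assert (HW : forall s, 0 < s -> tip s 0 (W s)).
{ intros s. unfold W. destruct constructive_indefinite_description as [v Hv]. exact Hv. }
assert (HLex : forall s, exists l, 0 < s -> l <> RtoC 0 /\
  forall eps, 0 < eps -> exists rho, 0 < rho /\ forall s1 s2,
    s1 < s2 -> Rabs (s1 - s) < rho -> Rabs (s2 - s) < rho ->
    Cmod (quotient (fun s => W s 0) s1 s2 - l) <= eps).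
{ intros s. destruct (Rlt_le_dec 0 s) as [Hs|Hs].
  - destruct (trace_strict_derivative W HW s Hs) as [l Hl]. now exists l.
  - exists (RtoC 0). intros; lra. }
pose (dW := fun s => proj1_sig (constructive_indefinite_description _ (HLex s))).
assert (HdW : forall s, 0 < s -> dW s <> RtoC 0 /\
  forall eps, 0 < eps -> exists rho, 0 < rho /\ forall s1 s2,
    s1 < s2 -> Rabs (s1 - s) < rho -> Rabs (s2 - s) < rho ->
    Cmod (quotient (fun s => W s 0) s1 s2 - dW s) <= eps).
{ intros s. unfold dW. destruct constructive_indefinite_description as [l Hl]. exact Hl. }
pose (gamma := fun s => if Rlt_dec 0 s then W s 0 else RtoC 0).
assert (G0 : gamma 0 = RtoC 0).
{ unfold gamma. destruct (Rlt_dec 0 0); [lra|reflexivity]. }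
assert (GW : forall s, 0 < s -> gamma s = W s 0).
{ intros s Hs. unfold gamma. destruct (Rlt_dec 0 s); [reflexivity|lra]. }
assert (Hder : forall s eps, 0 < s -> 0 < eps -> exists d, 0 < d /\ forall r, 0 < r -> Rabs (r - s) < d ->
   Cmod (gamma r - gamma s - RtoC (r - s) * dW s) <= eps * Rabs (r - s)).
{ intros s eps Hs He. destruct (proj2 (HdW s Hs) eps He) as [d [Hd D]].
  exists d. split; [assumption|]. intros r Hr Hrs.
  assert (Hss : Rabs (s - s) < d) by now rewrite Rminus_diag, Rabs_R0.
  rewrite !GW by assumption.
  apply (quotient_expand (fun s => W s 0)); intros; apply D; assumption. }
assert (Hup : forall s, 0 < s -> 0 < Im (gamma s)).
{ intros s Hs. rewrite GW by assumption. apply (tip_Im_0_pos s 0 (W s)); auto. }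
assert (Hhull : forall t, 0 < t -> forall z,
  loewner_hull cbrt t z <-> upper_half_plane z /\ arc gamma t z).
{ intros t Ht z. split.
  - intros [Hz Hd]. split; [assumption|].
    destruct (dead_tip f hf z t Ht Hz Hd) as [s [v [Hs [Hv Hv0]]]].
    exists s. split; [lra|]. rewrite GW by lra. rewrite <- Hv0.
    apply (tip_unique s); auto; try lra. apply HW; lra.
  - intros [Hz [s [Hs E]]]. split; [assumption|]. unfold upper_half_plane in Hz.
    assert (Hsp : 0 < s).
    { destruct (Rle_lt_or_eq_dec 0 s (proj1 Hs)) as [|E0]; [assumption|].
      rewrite <- E, <- E0, G0 in Hz. simpl in Hz. lra. }
    intros Ha. apply (tip_dead s (W s) Hsp (HW s Hsp)).
    rewrite <- GW, E by assumption. apply (alive_le cbrt continuous_cbrt z t); auto; lra. }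
exists 1, gamma. split; [lra|]. split; [assumption|]. intros t Ht.
assert (Halive : forall z, slit_domain gamma t z -> 0 < Im z /\ loewner_alive cbrt z t).
{ intros z [Hz Ha]. split; [assumption|]. apply NNPP. intros Hn.
  apply Ha. now apply (proj1 (Hhull t (proj1 Ht) z)). }
assert (Hsol : forall z, slit_domain gamma t z -> loewner_solution cbrt z t (f z)).
{ intros z Hz. destruct (Halive z Hz). apply hf; auto; lra. }
split; [|split; [|split]].
- split; [|split; [|split]].
  + apply continuous_on_set_intro. intros s eps Hs He.
    destruct (Rle_lt_or_eq_dec 0 s (proj1 Hs)) as [Hsp|E0].
    * destruct (Hder s 1 Hsp Rlt_0_1) as [d [Hd D]].
      set (M := 1 + Cmod (dW s)).
      assert (HM : 0 < M) by (unfold M; pose proof (Cmod_ge_0 (dW s)); lra).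
      exists (Rmin (Rmin d s) (eps / M)).
      split; [repeat apply Rmin_glb_lt; auto; now apply Rdiv_lt_0_compat|].
      intros r Hr Hrs.
      pose proof (Rmin_l (Rmin d s) (eps / M)). pose proof (Rmin_r (Rmin d s) (eps / M)).
      pose proof (Rmin_l d s). pose proof (Rmin_r d s).
      assert (Hrp : 0 < r).
      { assert (Hx : Rabs (r - s) < s) by lra. apply Rabs_def2 in Hx. lra. }
      specialize (D r Hrp ltac:(lra)).
      replace (gamma r - gamma s)%C
        with ((gamma r - gamma s - RtoC (r - s) * dW s) + RtoC (r - s) * dW s)%C by ring.
      apply Rle_lt_trans with (1 := Cmod_triangle _ _). rewrite Cmod_mult, Cmod_R.
      apply Rle_lt_trans with (M * Rabs (r - s)); [unfold M; lra|].
      apply Rlt_le_trans with (M * (eps / M)); [apply Rmult_lt_compat_l; lra|right; field; lra].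
    * subst s. rewrite G0.
      assert (He2 : 0 < eps / 2) by lra.
      destruct (proj1 (filterlim_locally _ _) (continuous_cbrt 0) (mkposreal _ He2)) as [d Hd].
      assert (He4 : 0 < (eps / 4) ^ 2) by (apply pow_lt; lra).
      exists (Rmin d ((eps / 4) ^ 2)). split; [apply Rmin_glb_lt; [apply d|assumption]|].
      intros r Hr Hrs. replace (gamma r - RtoC 0)%C with (gamma r) by ring.
      pose proof (Rmin_l d ((eps / 4) ^ 2)). pose proof (Rmin_r d ((eps / 4) ^ 2)).
      specialize (Hd r ltac:(change (Rabs (r - 0) < d); lra)).
      change (Rabs (cbrt r - cbrt 0) < eps / 2) in Hd.
      rewrite cbrt_0, Rminus_0_r, Rabs_pos_eq in Hd by apply cbrt_nonneg.
      rewrite Rminus_0_r, Rabs_pos_eq in Hrs by lra.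
      destruct (Rle_lt_or_eq_dec 0 r (proj1 Hr)) as [Hrp|E0].
      2:{ rewrite <- E0, G0, Cmod_0. assumption. }
      rewrite GW by assumption.
      apply Rle_lt_trans with (1 := Cmod_Re_Im _).
      pose proof (tip_Re_lower r 0 (W r) (HW r Hrp) 0 ltac:(lra)) as X1.
      pose proof (tip_Re_upper r 0 (W r) (HW r Hrp) 0 ltac:(lra)) as X2.
      pose proof (tip_Im_upper r 0 (W r) (HW r Hrp) 0 ltac:(lra)) as Y2.
      pose proof (tip_Im_0_pos r 0 (W r) (HW r Hrp) Hrp) as Y1.
      rewrite cbrt_0 in X1. rewrite !Rabs_pos_eq by lra.
      assert (Im (W r 0) < eps / 2); [|lra].
      apply Rsqr_incrst_0; [|lra|lra]. rewrite !Rsqr_pow2.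
      apply Rle_lt_trans with (1 := Y2). lra.
  + assert (Hlt : forall r s, 0 <= r -> r < s -> gamma r <> gamma s).
    { intros r s Hr Hrs E.
      pose proof (Hup s ltac:(lra)) as HI.
      destruct (Rle_lt_or_eq_dec 0 r Hr) as [Hrp|E0].
      - rewrite !GW in E by lra. apply (tip_dead r (W r) Hrp (HW r Hrp)). rewrite E.
        apply (tip_alive s); [apply HW; lra|lra].
      - rewrite <- E, <- E0, G0 in HI. simpl in HI. lra. }
    intros r s Hr Hs E. destruct (Rtotal_order r s) as [Hl|[|Hl]]; [|assumption|]; exfalso.
    * apply (Hlt r s); auto; lra.
    * apply (Hlt s r); auto; lra.
  + rewrite G0. reflexivity.
  + intros s Hs. apply Hup. lra.
- intros z. apply Hhull. lra.
- split; [|split].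
  + intros z Hz. destruct (Halive z Hz). apply flow_derivable; auto; lra.
  + intros z w Hz Hw E.
    pose proof (solution_unique cbrt continuous_cbrt z w t (f z) (f w) t ltac:(lra)
      (Hsol z Hz) (Hsol w Hw) E 0 ltac:(lra)) as E0.
    now rewrite (proj1 (Hsol z Hz)), (proj1 (Hsol w Hw)) in E0.
  + intros w. split.
    * intros Hw. destruct (backward_solution cbrt t w continuous_cbrt) as [u [Hu [Hut Hui]]];
        [lra|assumption|].
      unfold upper_half_plane in Hw.
      assert (Hz : upper_half_plane (u 0)).
      { unfold upper_half_plane. specialize (Hui 0 ltac:(lra)). lra. }
      assert (Hs : slit_domain gamma t (u 0)).
      { split; [assumption|]. intros Ha.
        destruct (proj2 (Hhull t (proj1 Ht) (u 0)) (conj Hz Ha)) as [_ Hn].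
        apply Hn. now exists u. }
      exists (u 0). split; [assumption|]. rewrite <- Hut.
      apply (solution_unique cbrt continuous_cbrt (u 0) (u 0) t (f (u 0)) u 0); auto; try lra.
      apply (Hsol _ Hs).
    * intros [z [Hz <-]]. destruct (Halive z Hz) as [Hzi _].
      apply (solution_im_pos cbrt continuous_cbrt z t (f z)); auto; lra.
- exists dW. split.
  + intros s Hs. split; [|apply HdW; lra].
    apply is_derive_on_intro; [assumption|]. intros eps He.
    destruct (Hder s eps ltac:(lra) He) as [d [Hd D]].
    exists d. split; [assumption|]. intros r Hr. apply D. lra.
  + apply continuous_on_set_intro. intros s eps Hs He.
    destruct (proj2 (HdW s ltac:(lra)) (eps / 3) ltac:(lra)) as [d [Hd D]].
    exists d. split; [assumption|]. intros r Hr Hrs.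
    destruct (proj2 (HdW r ltac:(lra)) (eps / 3) ltac:(lra)) as [d' [Hd' D']].
    set (x := Rmin (d' / 2) ((d - Rabs (r - s)) / 2)).
    assert (Hx : 0 < x) by (apply Rmin_glb_lt; lra).
    assert (X1 : x <= d' / 2) by apply Rmin_l.
    assert (X2 : x <= (d - Rabs (r - s)) / 2) by apply Rmin_r.
    assert (A1 : Rabs (r + x - s) < d).
    { replace (r + x - s) with ((r - s) + x) by ring.
      apply Rle_lt_trans with (1 := Rabs_triang _ _). rewrite (Rabs_pos_eq x) by lra. lra. }
    assert (A2 : Rabs (r + x - r) < d').
    { replace (r + x - r) with x by ring. rewrite Rabs_pos_eq; lra. }
    assert (A3 : Rabs (r - r) < d') by now rewrite Rminus_diag, Rabs_R0.
    specialize (D r (r + x) ltac:(lra) Hrs A1).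
    specialize (D' r (r + x) ltac:(lra) A3 A2).
    apply Rle_lt_trans with (1 := Cmod_triangle_minus _ (quotient (fun s => W s 0) r (r + x)) _).
    rewrite (Cmod_minus_sym (dW r)). lra.
Qed.
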